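(* Let $\sigma:\mathfrak X\times\Omega\times[0,\tau]\to\mathbb C$ be a measurable function and let $b:\mathfrak X\times\Omega\times[0,\tau]\to\mathbb C$ be the measurable function defined by $$b(x,\omega,s)=\overline{\sigma(x,\omega,s)}\,q^{(\frac12+is)h_\omega(x)},\qquad (x,\omega,s)\in\mathfrak X\times\Omega\times[0,\tau].$$ Then the pseudo-differential operator $T_\sigma:L^2(\mathfrak X)\to L^2(\mathfrak X)$ is a Hilbert-Schmidt operator if and only if $b\in L^2(\mathfrak X\times\Omega\times[0,\tau])$. Moreover, in that case, the Hilbert-Schmidt norm satisfies $$\|T_\sigma\|_{S_2}=\|b\|_{L^2(\mathfrak X\times\Omega\times[0,\tau])}.$$
   Context: Let $q\ge 2$ be an integer and let $\mathfrak X$ be (the vertex set of) the homogeneous tree of degree $q+1$: the connected graph without loops (cycles) in which every vertex has exactly $q+1$ neighbours. $d(x,y)$ is the number of edges of the geodesic from $x$ to $y$; a reference vertex $o$ is fixed and $|x|=d(o,x)$. $\mathfrak X$ carries the counting measure and $L^p(\mathfrak X)$ is taken with respect to it. $\Omega$ is the set of infinite geodesic rays $\omega=(\omega_0,\omega_1,\dots)$ with $\omega_0=o$. The height function is $h_\omega(x)=\lim_{m\to\infty}(m-d(x,\omega_m))=2|c(x,\omega)|-|x|$, where $c(x,\omega)$ is the last vertex on the geodesic path $[o,x]$ that lies on $\omega$. $\nu$ is the probability measure on $\Omega$ (with the $\sigma$-algebra generated by the sets $E(x)=\{\omega:\omega\text{ passes through }x\}$) with $\nu(E(x))=\frac{q}{(q+1)q^{|x|}}$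 for $x\neq o$. Put $\tau=\pi/\log q$ and $d\mu(s)=c_P|c(s)|^{-2}ds$ on $[0,\tau]$, with $c_P=\frac{q\log q}{2\pi(q+1)}$ and $c(z)=\frac{q^{1/2}}{q+1}\,\frac{q^{1/2+iz}-q^{-1/2-iz}}{q^{iz}-q^{-iz}}$. $\Omega\times[0,\tau]$ carries $\nu\otimes\mu$ and $\mathfrak X\times\Omega\times[0,\tau]$ carries the product of counting measure with $\nu\otimes\mu$. For finitely supported $f:\mathfrak X\to\mathbb C$ the Fourier-Helgason transform is $\mathcal Hf(\omega,s)=\sum_{y\in\mathfrak X}f(y)q^{(\frac12+is)h_\omega(y)}$. For measurable $\sigma$ and finitely supported $f$, the pseudo-differential operator with symbol $\sigma$ is $T_\sigma f(x)=\int_\Omega\int_0^\tau q^{(\frac12-is)h_\omega(x)}\sigma(x,\omega,s)\mathcal Hf(\omega,s)\,d\nu(\omega)d\mu(s)$. Saying that $T_\sigma$ is an operator of a given class between $L^p$ spaces means that this integral converges absolutely for all finitely supported $f$ and all $x$, and that $T_\sigma$ extends from finitely supported functions to an operator of that class. *)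

(* Defs.v *)
From HB Require Import structures.
From mathcomp Require Import all_boot all_order all_algebra.
From mathcomp Require Import all_classical all_reals all_analysis.
From mathcomp Require Import measurable_realfun.
From mathcomp Require Import complex.
From mathcomp Require Import zify ring lra.

Set Implicit Arguments.
Unset Strict Implicit.
Unset Printing Implicit Defensive.

Import Order.TTheory GRing.Theory Num.Theory.
Import numFieldNormedType.Exports.
Import ComplexField.Normc.

Local Open Scope classical_set_scope.
Local Open Scope card_scope.
Local Open Scope ring_scope.
Local Open Scope complex_scope.

(* ucycle with two vertices is an edge travelled back and forth, so only the
   simple closed walks on at least three vertices are excluded. *)
Record homogeneous_tree (q : nat) := HomogeneousTree {
  tree_carrier : choiceType;
  tree_root : tree_carrier;
  tree_adj : rel tree_carrier;
  branching_ge2 : (2 <= q)%N;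
  tree_adj_sym : symmetric tree_adj;
  tree_adj_irr : irreflexive tree_adj;
  tree_connected : forall x y,
    exists2 p, path tree_adj x p & last x p = y;
  tree_acyclic : forall p, ucycle tree_adj p -> (size p <= 2)%N;
  tree_degree : forall x, [set y | tree_adj x y] #= `I_q.+1
}.

Definition vertex q (X : homogeneous_tree q) : Type := tree_carrier X.
Coercion vertex : homogeneous_tree >-> Sortclass.

Section tree.
Variables (q : nat) (X : homogeneous_tree q).

HB.instance Definition _ := Choice.on (vertex X).
HB.instance Definition _ := isPointed.Build (vertex X) (tree_root X).
HB.instance Definition _ := @isMeasurable.Build default_measure_display
  (vertex X) discrete_measurable discrete_measurable0
  discrete_measurableC discrete_measurableU.

Definition root : X := tree_root X.
Definition adj : rel X := @tree_adj q X.

Definition has_walk (x y : X) (n : nat) : bool :=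
  `[< exists p : seq X, [/\ path adj x p, last x p = y & size p = n] >].

Lemma has_walk_ex x y : exists n, has_walk x y n.
Proof.
have [p pp lp] := @tree_connected q X x y.
by exists (size p); apply/asboolP; exists p.
Qed.

Definition dist (x y : X) : nat := ex_minn (has_walk_ex x y).

Definition is_ray (w : nat -> X) : Prop :=
  w 0%N = root /\ forall m n, (m <= n)%N -> dist (w m) (w n) = (n - m)%N.

(* Walks are handled as functions on nat of which only an initial segment
   matters. *)
Let nobt (n : nat) (w : nat -> X) :=
  (forall i, (i < n)%N -> adj (w i) (w i.+1)) /\
  (forall i, (i.+1 < n)%N -> w i != w i.+2).

Let adjC x y : adj x y = adj y x. Proof. exact: tree_adj_sym. Qed.

Let path_iota (w : nat -> X) m i :
  (forall l, (i <= l < i + m)%N -> adj (w l) (w l.+1)) ->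
  path adj (w i) [seq w l | l <- iota i.+1 m].
Proof.
elim: m i => //= m IH i H; rewrite H ?IH//; last by lia.
by move=> l Hl; apply: H; lia.
Qed.

Let nobt_inj n (w : nat -> X) : nobt n w ->
  forall i j, (i < j <= n)%N -> w i != w j.
Proof.
move=> [aw bw] i j; have [k] := ubnP (j - i)%N.
elim: k i j => // k IH i j jik /andP[ij jn]; apply/eqP => wij.
pose p := [seq w l | l <- iota i (j - i)].
have sp : size p = (j - i)%N by rewrite size_map size_iota.
suff : ucycle adj p.
  move=> /(@tree_acyclic q X); rewrite sp => H.
  have [E|E] : j = i.+1 \/ j = i.+2 by lia.
    have H1 : (i < n)%N by lia.
    by have := aw i H1; rewrite -E wij /adj tree_adj_irr.
  have H1 : (i.+1 < n)%N by lia.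
  by have := bw i H1; rewrite -E wij eqxx.
rewrite /ucycle; apply/andP; split; last first.
  rewrite map_inj_in_uniq ?iota_uniq// => a b.
  rewrite !mem_iota => Ha Hb wab.
  have [ab|ab|//] := ltngtP a b; exfalso.
  - have : w a != w b by apply: IH; lia.
    by rewrite wab eqxx.
  - have : w b != w a by apply: IH; lia.
    by rewrite wab eqxx.
rewrite /p; have -> : (j - i)%N = (j - i).-1.+1 by lia.
rewrite /=.
have -> : rcons [seq w l | l <- iota i.+1 (j - i).-1] (w i) =
          [seq w l | l <- iota i.+1 (j - i)].
  have {2}-> : (j - i)%N = ((j - i).-1 + 1)%N by lia.
  rewrite iotaD map_cat cats1 /= wij; congr (rcons _ (w _)); lia.
by apply: path_iota => l Hl; apply: aw; lia.
Qed.

(* Two walks without backtracking that have the same ends have the same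
   length. *)
Let nobt_size n m (u v : nat -> X) : nobt n u -> nobt m v ->
  u 0%N = v 0%N -> u n = v m -> n = m.
Proof.
have [k] := ubnP (n + m)%N.
elim: k n m => // k IH n m nmk nu nv uv0 uvn.
have [n0|n0] := posnP n; have [m0|m0] := posnP m; [by rewrite n0| | |].
- have : v 0%N != v m by apply: nobt_inj nv _ _ _; lia.
  by rewrite -uvn -uv0 n0 eqxx.
- have : u 0%N != u n by apply: nobt_inj nu _ _ _; lia.
  by rewrite uvn uv0 m0 eqxx.
have [E|/eqP E] := eqVneq (u n.-1) (v m.-1).
  have [] := (nu, nv); move=> [u1 u2] [v1 v2].
  suff : n.-1 = m.-1 by lia.
  apply: IH => //; first by lia.
  - by split=> i Hi; [apply: u1|apply: u2]; lia.
  - by split=> i Hi; [apply: v1|apply: v2]; lia.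
exfalso.
pose w i := if (i <= n)%N then u i else v (n + m - i)%N.
have wv i : (n <= i)%N -> w i = v (n + m - i)%N.
  rewrite /w => ni; case: ifPn => // i_n.
  have -> : i = n by lia.
  by rewrite uvn; congr v; lia.
have wu i : (i <= n)%N -> w i = u i by rewrite /w => ->.
have nw : nobt (n + m)%N w.
  have [] := (nu, nv); move=> [u1 u2] [v1 v2]; split=> i Hi.
    have [ni|ni] := leqP n i.
      rewrite !wv; [|lia|lia].
      have -> : (n + m - i = (n + m - i.+1).+1)%N by lia.
      by rewrite adjC; apply: v1; lia.
    by rewrite !wu; [apply: u1; lia|lia|lia].
  have [ni|ni] := leqP n i.
    rewrite !wv; [|lia|lia].
    have -> : (n + m - i = (n + m - i.+2).+2)%N by lia.
    by rewrite eq_sym; apply: v2; lia.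
  have [ni'|ni'] := eqVneq i n.-1.
    rewrite (wv i.+2); last by lia.
    rewrite (wu i); last by lia.
    rewrite ni'; have -> : (n + m - n.-1.+2 = m.-1)%N by lia.
    exact/eqP.
  by rewrite !wu; [apply: u2; lia|lia|lia].
have : w 0%N != w (n + m)%N by apply: nobt_inj nw _ _ _; lia.
by rewrite (wu 0%N)// (wv (n + m)%N) ?leq_addr// subnn uv0 eqxx.
Qed.

Let walk_fun x y n : has_walk x y n -> exists w : nat -> X,
  [/\ w 0%N = x, w n = y & forall i, (i < n)%N -> adj (w i) (w i.+1)].
Proof.
move=> /asboolP[p [pp lp sp]]; exists (nth x (x :: p)); split => //.
  by rewrite -sp -lp (last_nth x).
by move=> i; rewrite -sp => ip; apply: (pathP x pp).
Qed.

Let fun_walk (w : nat -> X) n :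
  (forall i, (i < n)%N -> adj (w i) (w i.+1)) -> has_walk (w 0%N) (w n) n.
Proof.
move=> aw; apply/asboolP; exists [seq w l | l <- iota 1 n]; split.
- by apply: path_iota => l Hl; apply: aw; lia.
- case: n aw => // n _; have -> : n.+1 = (n + 1)%N by lia.
  by rewrite iotaD map_cat last_cat /=; congr w; lia.
- by rewrite size_map size_iota.
Qed.

Let dist_nobt n (w : nat -> X) : nobt n w -> dist (w 0%N) (w n) = n.
Proof.
move=> nw; rewrite /dist; case: ex_minnP => m hm minm.
have [v [v0 vm va]] := walk_fun hm.
apply: (@nobt_size m n v w) => //; split=> // i im; apply/eqP => vE.
pose v' l := if (l <= i)%N then v l else v l.+2.
have : has_walk (v' 0%N) (v' m.-2) m.-2.
  apply: fun_walk => l lm; rewrite /v'.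
  have [li|li|li] := ltngtP l i.
  - by apply: va; lia.
  - by apply: va; lia.
  - by rewrite li vE; apply: va; lia.
rewrite /v' /= v0; case: ifPn => mi.
  have Ei : m.-2 = i by lia.
  rewrite Ei vE (_ : i.+2 = m); last by lia.
  by rewrite vm => /minm; lia.
rewrite (_ : m.-2.+2 = m); last by lia.
by rewrite vm => /minm; lia.
Qed.

Let next_neighbour (y x : X) : exists z, adj x z /\ z != y.
Proof.
apply: contrapT => H.
have : [set z : X | adj x z] `<=` [set y].
  by move=> z /= xz; apply: contrapT => zy; apply: H; exists z; split=> //; exact/eqP.
move/subset_card_le => H1.
have : (`I_q.+1 #<= `I_1)%card.
  apply: card_le_trans (card_le_trans H1 _).
    by have := @tree_degree q X x; rewrite card_eq_le => /andP[].
  by have := @card_set1 X y; rewrite card_eq_le => /andP[].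
rewrite card_le_II; have := @branching_ge2 q X; lia.
Qed.

Lemma ray_exists : exists w, is_ray w.
Proof.
have [nx nxP] := choice (fun yx : X * X => next_neighbour yx.1 yx.2).
pose st := fix st i : X * X :=
  if i is i'.+1 then ((st i').2, nx (st i')) else (nx (root, root), root).
pose w i := (st i).2.
have aw i : adj (w i) (w i.+1) by rewrite /w /=; case: (nxP (st i)).
have bw i : w i != w i.+2.
  by rewrite /w /= eq_sym; case: (nxP ((st i).2, nx (st i))).
exists w; split => // m n mn.
pose v l := w (m + l)%N.
have -> : w m = v 0%N by rewrite /v addn0.
have -> : w n = v (n - m)%N by rewrite /v subnKC.
by apply: dist_nobt; split=> i _; rewrite /v !addnS.
Qed.

Record boundary := Boundary {
  ray :> nat -> X;
  rayP : is_ray ray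
}.

HB.instance Definition _ := gen_eqMixin boundary.
HB.instance Definition _ := gen_choiceMixin boundary.
HB.instance Definition _ := isPointed.Build boundary
  (Boundary (projT2 (cid ray_exists))).

Definition shadow (x : X) : set boundary := [set w | exists n, w n = x].

HB.instance Definition _ := Measurable.copy boundary
  (g_sigma_algebraType (range shadow)).

End tree.
Arguments root {q X}.

Section complex_valued.
Context d (T : measurableType d) (R : realType).
Variables (m : {measure set T -> \bar R}) (D : set T) (f : T -> R[i]).

Definition cmeasurable : Prop :=
  measurable_fun D (fun x => complex.Re (f x)) /\
  measurable_fun D (fun x => complex.Im (f x)).

Definition cintegrable : Prop :=
  cmeasurable /\ (\int[m]_(x in D) (normc (f x))%:E < +oo)%E.

Definition cintegral : R[i] :=
  Rintegral m D (fun x => complex.Re (f x)) +i*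
  Rintegral m D (fun x => complex.Im (f x)).

Definition L2norm : \bar R :=
  ((\int[m]_(x in D) (normc (f x) ^+ 2)%:E) `^ 2^-1)%E.

Definition inL2 : Prop := cmeasurable /\ (L2norm < +oo)%E.

End complex_valued.

Section spectral_side.
Variables (R : realType) (q : nat).

Definition cexp (z : R[i]) : R[i] :=
  (expR (complex.Re z))%:C * (cos (complex.Im z) +i* sin (complex.Im z)).

Definition qpow (z : R[i]) : R[i] := cexp ((ln q%:R)%:C * z).

Definition tau : R := pi / ln q%:R.

Definition cP : R := q%:R * ln q%:R / (2 * pi * q.+1%:R).

Definition cfun (z : R[i]) : R[i] :=
  (Num.sqrt q%:R / q.+1%:R)%:C *
  ((qpow (2^-1 + 'i * z) - qpow (- 2^-1 - 'i * z)) /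
   (qpow ('i * z) - qpow (- ('i * z)))).

(* At s = 0 and s = tau the denominator of cfun vanishes; with x / 0 = 0 the
   density is 0 there, which is also its limit. *)
Definition plancherel_density (s : R) : R := cP * normc (cfun s%:C) ^- 2.

Definition plancherel (A : set (measurableTypeR R)) : \bar R :=
  (\int[lebesgue_measure]_(s in A `&` `[0%R, tau]) (plancherel_density s)%:E)%E.

Let sq (z : R[i]) : R := complex.Re z ^+ 2 + complex.Im z ^+ 2.

Let normc_sq z : normc z ^+ 2 = sq z.
Proof. by case: z => a b; rewrite /= sqr_sqrtr// addr_ge0// sqr_ge0. Qed.

Let qpowE (a b : R) : qpow (a +i* b) =
  (expR (ln q%:R * a) * cos (ln q%:R * b)) +i*
  (expR (ln q%:R * a) * sin (ln q%:R * b)).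
Proof.
by rewrite /qpow /cexp /=; simpc.
Qed.

Let normc_qpow (a b : R) : normc (qpow (a +i* b)) = expR (ln q%:R * a).
Proof.
by rewrite qpowE /= !exprMn -mulrDr cos2Dsin2 mulr1 sqrtr_sqr ger0_norm// expR_ge0.
Qed.

Let args (s : R) :
  [/\ 2^-1 + 'i * s%:C = 2^-1 +i* s, - 2^-1 - 'i * s%:C = (- 2^-1) +i* (- s),
      'i * s%:C = 0 +i* s & - ('i * s%:C) = 0 +i* (- s)] .
Proof.
have H : (2^-1 : R[i]) = (2^-1 : R)%:C by rewrite fmorphV rmorph_nat.
by rewrite H; split; simpc.
Qed.

Let num s := qpow (2^-1 +i* s) - qpow ((- 2^-1) +i* (- s)).
Let den s := qpow (0 +i* s) - qpow (0 +i* (- s)).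

Let densityE s : plancherel_density s =
  cP * ((Num.sqrt q%:R / q.+1%:R) ^+ 2 * (sq (num s) * (sq (den s))^-1))^-1.
Proof.
rewrite /plancherel_density /cfun; have [-> -> -> ->] := args s.
rewrite -/(num s) -/(den s) !normcM normcV.
set K := Num.sqrt _ / _.
have nK : normc K%:C ^+ 2 = K ^+ 2 by rewrite normc_sq /sq /= expr0n addr0.
by clearbody K; rewrite !exprMn exprVn nK !normc_sq.
Qed.

Let density_ge0 s : 0 <= plancherel_density s.
Proof.
rewrite mulr_ge0//; last by rewrite invr_ge0 exprn_ge0// sqrtr_ge0.
have L : 0 <= ln q%:R :> R.
  by case: q => [|n]; [rewrite ln0|rewrite ln_ge0// ler1n].
by rewrite /cP divr_ge0// ?mulr_ge0 ?pi_ge0 ?ler0n.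
Qed.

Let measurable_inv (f : measurableTypeR R -> R) : measurable_fun setT f ->
  (forall x, 0 <= f x) -> measurable_fun setT (fun x => (f x)^-1).
Proof.
move=> mf f0; rewrite (_ : (fun x => _) = (fun x => (f x) `^ (-1))).
  exact: (measurableT_comp (measurable_powR _)).
by apply/funext => x; rewrite powR_inv1.
Qed.

Let sq_ge0 z : 0 <= sq z. Proof. by rewrite addr_ge0// sqr_ge0. Qed.

Let measurable_qpow (a c : R) :
  measurable_fun setT (fun s : measurableTypeR R => complex.Re (qpow (a +i* (c * s)))) /\
  measurable_fun setT (fun s : measurableTypeR R => complex.Im (qpow (a +i* (c * s)))).
Proof.
split; under eq_fun do rewrite qpowE /=; apply: measurable_funM => //.
  apply: (measurableT_comp (continuous_measurable_fun (@continuous_cos R))).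
  by apply: measurable_funM => //; apply: measurable_funM.
apply: (measurableT_comp (continuous_measurable_fun (@continuous_sin R))).
by apply: measurable_funM => //; apply: measurable_funM.
Qed.

Let measurable_sqB (a b : R) : measurable_fun setT
  (fun s : measurableTypeR R => sq (qpow (a +i* s) - qpow (b +i* (- s)))).
Proof.
have [m1 m2] := measurable_qpow a 1; have [m3 m4] := measurable_qpow b (-1).
apply: measurable_funD; apply: measurable_funX.
  apply: (eq_measurable_fun (fun s : measurableTypeR R =>
    complex.Re (qpow (a +i* (1 * s))) - complex.Re (qpow (b +i* (-1 * s))))).
    by move=> s _; rewrite mul1r mulN1r; do 2 case: qpow.
  exact: measurable_funB.
apply: (eq_measurable_fun (fun s : measurableTypeR R =>
  complex.Im (qpow (a +i* (1 * s))) - complex.Im (qpow (b +i* (-1 * s))))).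
  by move=> s _; rewrite mul1r mulN1r; do 2 case: qpow.
exact: measurable_funB.
Qed.

Lemma measurable_plancherel_density :
  measurable_fun [set: measurableTypeR R] plancherel_density.
Proof.
rewrite (funext densityE).
apply: measurable_funM => //; apply: measurable_inv; last first.
  by move=> s; rewrite !mulr_ge0 ?sqr_ge0 ?invr_ge0.
apply: measurable_funM => //; apply: measurable_funM; first exact: measurable_sqB.
by apply: measurable_inv; [exact: measurable_sqB|move=> s].
Qed.

Lemma plancherel_density_bounded :
  exists M : R, forall s, plancherel_density s <= M.
Proof.
have [q2|q2] := ltnP 1 q; last first.
  exists 0 => s; rewrite /plancherel_density /cP.
  have -> : ln q%:R = 0 :> R.
    by case: q q2 => [|[|//]] _; [rewrite ln0|rewrite ln1].
  by rewrite mulr0 !mul0r.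
have L0 : 0 < ln q%:R :> R by rewrite ln_gt0// ltr1n.
pose dl : R := expR (ln q%:R * 2^-1) - expR (ln q%:R * - 2^-1).
have dl0 : 0 < dl by rewrite subr_gt0 ltr_expR; nra.
have numge s : dl <= normc (num s).
  rewrite lerBlDr -(normc_qpow _ s) -(normc_qpow _ (- s)).
  apply: le_trans (@le_normcD _ _ _).
  by rewrite /num subrK.
have denle s : normc (den s) <= 2.
  apply: le_trans (@le_normcD _ _ _) _.
  rewrite normcN.
  by rewrite !normc_qpow mulr0 expR0.
exists (cP * ((Num.sqrt q%:R / q.+1%:R) ^+ 2 * (dl ^+ 2 * 4^-1))^-1) => s.
rewrite densityE; apply: ler_wpM2l.
  by rewrite /cP divr_ge0// ?mulr_ge0 ?pi_ge0 ?ler0n// ltW.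
have [->|d0] := eqVneq (sq (den s)) 0.
  by rewrite invr0 !mulr0 invr0 invr_ge0 mulr_ge0 ?sqr_ge0// mulr_ge0 ?sqr_ge0// invr_ge0.
have K0 : 0 < (Num.sqrt q%:R / q.+1%:R) ^+ 2 :> R.
  by rewrite exprn_gt0// divr_gt0// sqrtr_gt0 ltr0n; lia.
have d1 : 0 < sq (den s) by rewrite lt_neqAle eq_sym d0 sq_ge0.
have n1 : dl ^+ 2 <= sq (num s).
  by rewrite -normc_sq ler_pXn2r// ?nnegrE ?ltW// (lt_le_trans dl0).
have dd : sq (den s) <= 4.
  have -> : 4 = 2 ^+ 2 :> R by rewrite -natrX.
  by rewrite -normc_sq ler_pXn2r// ?nnegrE// sqrtr_ge0.
have n0 : 0 < sq (num s) by apply: lt_le_trans n1; rewrite exprn_gt0.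
rewrite lef_pV2 ?posrE; last 2 first.
- by rewrite mulr_gt0// divr_gt0.
- by rewrite mulr_gt0// mulr_gt0// exprn_gt0.
apply: ler_wpM2l; first exact: ltW.
apply: ler_pM n1 _; rewrite ?sqr_ge0 ?invr_ge0//.
by rewrite lef_pV2 ?posrE.
Qed.

Let plancherel0 : plancherel set0 = 0%E.
Proof. by rewrite /plancherel set0I integral_set0. Qed.

Let plancherel_ge0 A : (0 <= plancherel A)%E.
Proof. by apply: integral_ge0 => s _; rewrite lee_fin density_ge0. Qed.

Let plancherel_sigma_additive : semi_sigma_additive plancherel.
Proof.
move=> F mF tF mUF; rewrite /plancherel; apply: cvg_toP.
  apply: ereal_nondecreasing_is_cvgn => m n mn.
  apply: lee_sum_nneg_natr => // k _ _.
  by apply: integral_ge0 => /= x _; rewrite lee_fin density_ge0.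
rewrite setI_bigcupl ge0_integral_bigcup//=.
- by move=> k; exact: measurableI.
- apply: measurable_funTS; apply: measurableT_comp => //.
  exact: measurable_plancherel_density.
- by move=> x _; rewrite lee_fin density_ge0.
- exact: trivIset_setIr.
Qed.

HB.instance Definition _ := isMeasure.Build _ _ _ plancherel
  plancherel0 plancherel_ge0 plancherel_sigma_additive.

Let plancherel_fin : fin_num_fun plancherel.
Proof.
have [M HM] := plancherel_density_bounded.
apply: lty_fin_num_fun; rewrite /= /plancherel setTI.
apply: (@le_lt_trans _ _ (\int[lebesgue_measure]_(s in `[0%R, tau]) M%:E)%E).
  apply: ge0_le_integral => //.
  - by move=> x _; rewrite lee_fin density_ge0.
  - apply: measurable_funTS; apply: measurableT_comp => //.
    exact: measurable_plancherel_density.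
  - by move=> x _; rewrite lee_fin.
rewrite integral_cst//= lebesgue_measure_itv/=.
by case: ifP => _; rewrite ?mule0 ?ltry// -EFinD -EFinM ltry.
Qed.

HB.instance Definition _ := Measure_isFinite.Build _ _ _ plancherel
  plancherel_fin.

End spectral_side.
Arguments plancherel : clear implicits.

Section hilbert_schmidt.
Variables (R : realType) (q : nat) (X : homogeneous_tree q).

Local Notation cnt := (counting : set X -> \bar R).

Definition ell2 (f : X -> R[i]) : Prop := inL2 cnt setT f.

Definition ell2norm (f : X -> R[i]) : \bar R := L2norm cnt setT f.

Definition ell2dot (f g : X -> R[i]) : R[i] :=
  cintegral cnt setT (fun x => f x * (g x)^*).

Definition finitely_supported (f : X -> R[i]) : Prop :=
  finite_set [set x | f x != 0].

Definition orthonormal_basis (I : choiceType) (e : I -> X -> R[i]) : Prop :=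
  [/\ forall i, ell2 (e i),
      forall i j, ell2dot (e i) (e j) = (i == j)%:R &
      forall f, ell2 f -> forall eps : R, 0 < eps ->
        exists (s : seq I) (a : I -> R[i]),
          (ell2norm (fun x => f x - \sum_(i <- s) a i * e i x)%R < eps%:E)%E ].

(* An operator on L^2(X) is a function on all of X -> R[i], of which only the
   values on square-summable functions matter. *)
Definition bounded_operator (S : (X -> R[i]) -> X -> R[i]) : Prop :=
  [/\ forall f, ell2 f -> ell2 (S f),
      forall (a : R[i]) f g, ell2 f -> ell2 g ->
        S (fun x => a * f x + g x) = (fun x => a * S f x + S g x) &
      exists M : R, forall f, ell2 f ->
        (ell2norm (S f) <= M%:E * ell2norm f)%E ].

Definition HSnorm (I : choiceType) (e : I -> X -> R[i])
    (S : (X -> R[i]) -> X -> R[i]) : \bar R :=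
  ((\esum_(i in [set: I]) (ell2norm (S (e i)) `^ 2)) `^ 2^-1)%E.

Definition hilbert_schmidt (S : (X -> R[i]) -> X -> R[i]) : Prop :=
  bounded_operator S /\
  exists (I : choiceType) (e : I -> X -> R[i]),
    orthonormal_basis e /\ (HSnorm e S < +oo)%E.

End hilbert_schmidt.

Section pseudo_differential.
Variables (R : realType) (q : nat) (X : homogeneous_tree q).

Definition height (w : boundary X) (x : X) : R :=
  lim ((fun m : nat => m%:R - (dist x (w m))%:R : R) @ \oo).

Definition helgason (f : X -> R[i]) (p : boundary X * measurableTypeR R) :
    R[i] :=
  \sum_(y \in [set: X]) f y * qpow q ((2^-1 +i* p.2) * (height p.1 y)%:C).

(* Functions of the spectral parameter are defined on the whole line; the two
   domains below restrict every condition and integral to [0, tau]. *)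
Definition spectral_dom : set (boundary X * measurableTypeR R) :=
  [set: boundary X] `*` `[0, tau R q]%classic.

Definition phase_dom : set (X * (boundary X * measurableTypeR R)) :=
  [set: X] `*` spectral_dom.

Definition is_boundary_measure (nu : probability (boundary X) R) : Prop :=
  forall x : X, x != root ->
    nu (shadow x) = (q%:R / (q.+1%:R * q%:R ^+ dist root x))%:E.

Variable nu : probability (boundary X) R.

Definition spectral_measure :
    set (boundary X * measurableTypeR R)%type -> \bar R :=
  (nu \x plancherel R q)%E.

HB.instance Definition _ := Measure.on spectral_measure.

Let spectral_measure_fin : fin_num_fun spectral_measure.
Proof.
apply: lty_fin_num_fun; rewrite /=.
have -> : spectral_measure setT = (nu setT * plancherel R q setT)%E.
  by rewrite -product_measure1E// setXTT.
by rewrite probability_setT mul1e ltey_eq fin_num_measure.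
Qed.

HB.instance Definition _ := Measure_isFinite.Build _ _ _ spectral_measure
  spectral_measure_fin.

Definition phase_measure :
    set (X * (boundary X * measurableTypeR R))%type -> \bar R :=
  ((counting : set X -> \bar R) \x spectral_measure)%E.

HB.instance Definition _ := Measure.on phase_measure.

Variable sigma : X * (boundary X * measurableTypeR R) -> R[i].

Definition pdo_integrand (f : X -> R[i]) (x : X)
    (p : boundary X * measurableTypeR R) : R[i] :=
  qpow q ((2^-1 -i* p.2) * (height p.1 x)%:C) * sigma (x, p) * helgason f p.

Definition pdo (f : X -> R[i]) (x : X) : R[i] :=
  cintegral spectral_measure spectral_dom (pdo_integrand f x).

Definition pdo_converges : Prop :=
  forall f, finitely_supported f -> forall x,
    cintegrable spectral_measure spectral_dom (pdo_integrand f x).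

Definition pdo_extends_to (S : (X -> R[i]) -> X -> R[i]) : Prop :=
  forall f, finitely_supported f -> S f = pdo f.

Definition pdo_hilbert_schmidt : Prop :=
  pdo_converges /\ exists2 S, pdo_extends_to S & hilbert_schmidt S.

End pseudo_differential.
Arguments height R {q X} w x.
Arguments spectral_dom R {q} X _.
Arguments phase_dom R {q} X _.

(* Main.v *)
(* Write rho for nu (x) mu on Omega x [0, tau], b_x for b(x, .), and e_y(w, s) for
   z^(h_w(y)) with z = q^(1/2 + i s).  The matrix of T_sigma is
   K(x, y) = int conj(b_x) e_y drho, so that for every orthonormal basis Parseval
   in l^2 gives ||T_sigma||_{S_2}^2 = sum_x sum_y |K(x, y)|^2, and it remains to see
   that sum_y |K(x, y)|^2 = int |b_x|^2 drho.

   The e_y are orthonormal: the Omega-integral of e_y conj(e_y') only depends on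
   d(y, y'), it is a combination of z^(- d) and (z / q)^d with the coefficients of
   Harish-Chandra's c-function, and against the Plancherel density it becomes an
   integral of cosines.

   They are complete, even in L^2(w rho) for every integrable weight w >= 0.  The
   eigenvalue equation sum_{y' ~ y} e_y' = 2 q^(1/2) cos(s log q) e_y shows that
   the closure of their span is stable under multiplication by cos(s log q);
   iterating t |-> 3 t^2 - 2 t^3 on an affine function of that cosine gives the
   indicators of s < a, hence all bounded functions of s.  If p is the parent of y
   then e_y - z^(-1) e_p is a function of s times the indicator of E(y), and a
   monotone class argument reaches every bounded measurable function.

   Convergence of T_sigma on finitely supported functions only says that b_x is
   integrable.  The weight w = 1 + |b_x| gives Parseval's identity for b_x all the
   same, with both sides possibly infinite. *)
Require Import Defs.
From HB Require Import structures.
From mathcomp Require Import all_boot all_order all_algebra.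
From mathcomp Require Import all_classical all_reals all_analysis.
From mathcomp Require Import measurable_realfun.
From mathcomp Require Import complex.
From mathcomp Require Import zify ring lra.

Set Implicit Arguments.
Unset Strict Implicit.
Unset Printing Implicit Defensive.

Import Order.TTheory GRing.Theory Num.Theory.
Import numFieldNormedType.Exports.
Import ComplexField.Normc.

Local Open Scope classical_set_scope.
Local Open Scope ring_scope.
Local Open Scope complex_scope.

(* In [R[i]] both [conjc] (in [complex_scope]) and [Num.conj] (in [ring_scope])
   are written [^*]; here the notation always means the second one. *)
Local Notation "z ^*" := (Num.conj z) : complex_scope.

(** * Geometry of the tree *)

(** A truncation of [b_x] can be approximated by a combination [v] of waves, but what the
    coefficients of [b_x] control is [2 Re <b_x, v> - |v|^2], with [b_x] itself. Where [b_x] is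
    large the truncation is 0 and [v] is small only in the sense of the weight, which therefore has
    to contain [|b_x|]. The remaining price is [1 / t] times the L^1 norm of [b_x], so [t] is chosen
    before the quality of the approximation.

    The integrals against the Plancherel density are found without residues: with [u = q^(i s)], the
    integrals [K_n] of [Re (u^n / (q - u^2))] satisfy [q K_n = K_(n+2)] for [n > 0], and boundedness
    leaves only [K_n = 0].

    The closed form of the Omega-integral has the denominator [q - z^2], which vanishes on
    [[0, tau]] at the two end points only. There the density is 0 through the convention
    [x / 0 = 0], so identities are stated after multiplication by the density and hold for every
    [s]. *)

Section tree_metric.
Variables (q : nat) (X : homogeneous_tree q).
Implicit Types x y z : X.

Lemma adjC x y : adj x y = adj y x. Proof. exact: tree_adj_sym. Qed.

Lemma adjxx x : adj x x = false. Proof. exact: tree_adj_irr. Qed.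

Definition reduced (n : nat) (w : nat -> X) : Prop :=
  (forall i, (i < n)%N -> adj (w i) (w i.+1)) /\
  (forall i, (i.+1 < n)%N -> w i != w i.+2).

Definition walk (n : nat) (w : nat -> X) : Prop :=
  forall i, (i < n)%N -> adj (w i) (w i.+1).

Lemma path_map_iota (w : nat -> X) m i :
  (forall l, (i <= l < i + m)%N -> adj (w l) (w l.+1)) ->
  path (@adj q X) (w i) [seq w l | l <- iota i.+1 m].
Proof.
elim: m i => //= m IH i H; rewrite H ?IH//; last by lia.
by move=> l Hl; apply: H; lia.
Qed.

(** By induction on [j - i]: a shortest repetition closes up to a walk with distinct vertices, of
    length at most 2 by acyclicity. Length 1 contradicts irreflexivity and length 2 is a backtrack,
    which [reduced] forbids. *)
Lemma reduced_inj n (w : nat -> X) : reduced n w ->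
  forall i j, (i < j <= n)%N -> w i != w j.
Proof.
move=> [aw bw] i j; have [k] := ubnP (j - i)%N.
elim: k i j => // k IH i j jik /andP[ij jn]; apply/eqP => wij.
pose p := [seq w l | l <- iota i.+1 (j - i)].
have sp : size p = (j - i)%N by rewrite size_map size_iota.
have up : uniq p.
  have wne a b : (i < a < b)%N -> (b <= j)%N -> w a != w b.
    by move=> ? ?; apply: IH; lia.
  rewrite map_inj_in_uniq ?iota_uniq// => a b; rewrite !mem_iota => Ha Hb wab.
  have [ab|ab|//] := ltngtP a b; exfalso.
  - by have /eqP := wne a b ltac:(lia) ltac:(lia).
  - by have /eqP := wne b a ltac:(lia) ltac:(lia); rewrite wab.
have cp : cycle (@adj q X) p.
  have pp : path (@adj q X) (w i) p by apply: path_map_iota => l Hl; apply: aw; lia.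
  have lp : last (w i) p = w i.
    rewrite /p (_ : (j - i = (j - i).-1 + 1)%N); last by lia.
    by rewrite iotaD map_cat last_cat /= wij; congr w; lia.
  case: p pp lp {sp up} => //= a p /andP[ap pp] lp.
  by rewrite rcons_path pp lp.
have := @tree_acyclic q X p; rewrite sp /ucycle up andbT => /(_ cp) H.
have [E|E] : j = i.+1 \/ j = i.+2 by lia.
  by have := aw i ltac:(lia); rewrite -E wij adjxx.
by have := bw i ltac:(lia); rewrite -E wij eqxx.
Qed.

(** Common last edges are stripped off. Once the last edges differ, following [u] and then [v]
    backwards is a reduced walk that closes up, against [reduced_inj]. *)
Lemma reduced_size n m (u v : nat -> X) : reduced n u -> reduced m v ->
  u 0%N = v 0%N -> u n = v m -> n = m.
Proof.
have [k] := ubnP (n + m)%N.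
elim: k n m => // k IH n m nmk nu nv uv0 uvn.
have [n0|n0] := posnP n; have [m0|m0] := posnP m; [by rewrite n0| | |].
- have /eqP := reduced_inj nv (i := 0) (j := m) ltac:(lia).
  by rewrite -uvn -uv0 n0.
- have /eqP := reduced_inj nu (i := 0) (j := n) ltac:(lia).
  by rewrite uvn uv0 m0.
have [[u1 u2] [v1 v2]] := (nu, nv).
have [E|E] := eqVneq (u n.-1) (v m.-1).
  suff : n.-1 = m.-1 by lia.
  apply: IH => //; first by lia.
  - by split=> i Hi; [apply: u1|apply: u2]; lia.
  - by split=> i Hi; [apply: v1|apply: v2]; lia.
pose w i := if (i <= n)%N then u i else v (n + m - i)%N.
have wv i : (n <= i)%N -> w i = v (n + m - i)%N.
  rewrite /w => ni; case: ifPn => // i_n.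
  have -> : i = n by lia.
  by rewrite uvn; congr v; lia.
have wu i : (i <= n)%N -> w i = u i by rewrite /w => ->.
have nw : reduced (n + m)%N w.
  split=> i Hi.
    have [ni|ni] := leqP n i.
      rewrite !wv; [|lia|lia].
      have -> : (n + m - i = (n + m - i.+1).+1)%N by lia.
      by rewrite adjC; apply: v1; lia.
    by rewrite !wu; [apply: u1; lia|lia|lia].
  have [ni|ni] := leqP n i.
    rewrite !wv; [|lia|lia].
    have -> : (n + m - i = (n + m - i.+2).+2)%N by lia.
    by rewrite eq_sym; apply: v2; lia.
  (* The only new place for a backtrack is the turning point [n], where [u n.-1] and [v m.-1]
     differ. *)
  have [ni'|ni'] := eqVneq i n.-1.
    rewrite wu ?wv ?ni'; [|lia|lia].
    by rewrite (_ : (n + m - n.-1.+2 = m.-1)%N)//; lia.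
  by rewrite !wu; [apply: u2; lia|lia|lia].
have /eqP := reduced_inj nw (i := 0) (j := n + m) ltac:(lia).
by rewrite wu// wv ?leq_addr// subnn uv0.
Qed.

Lemma has_walkP x y n : has_walk x y n <->
  exists w, [/\ w 0%N = x, w n = y & walk n w].
Proof.
split=> [/asboolP[p [pp lp sp]]|[w [<- <- ww]]].
  exists (nth x (x :: p)); split => //; first by rewrite -sp -lp (last_nth x).
  by move=> i; rewrite -sp => ip; apply: (pathP x pp).
apply/asboolP; exists [seq w l | l <- iota 1 n]; split.
- by apply: path_map_iota => l Hl; apply: ww; lia.
- case: n ww => // n _; rewrite -(addn1 n) iotaD map_cat last_cat /=.
  by congr w; lia.
- by rewrite size_map size_iota.
Qed.

Lemma dist_geodesic x y :
  exists w, [/\ w 0%N = x, w (dist x y) = y & walk (dist x y) w].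
Proof. by rewrite /dist; case: ex_minnP => m /has_walkP. Qed.

Lemma dist_le_walk n w : walk n w -> (dist (w 0%N) (w n) <= n)%N.
Proof.
move=> ww; rewrite /dist; case: ex_minnP => m _; apply.
by apply/has_walkP; exists w.
Qed.

(** A geodesic is reduced, because a backtrack could be cut out of it, so [reduced_size] compares it
    with [w]. *)
Lemma reduced_dist n w : reduced n w -> dist (w 0%N) (w n) = n.
Proof.
move=> nw; have [v [v0 vm va]] := dist_geodesic (w 0%N) (w n).
apply: (reduced_size _ nw v0 vm); split=> // i im; apply/eqP => vE.
pose v' l := if (l <= i)%N then v l else v l.+2.
have Ei l : (i <= l)%N -> v' l = v l.+2.
  by rewrite /v'; case: ifPn => // li il; rewrite (_ : l = i) ?vE//; lia.
move: im vm va; set m := dist _ _ => im vm va.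
have : walk m.-2 v'.
  move=> l lm; have [li|li] := ltnP l i.
    by rewrite /v' li ltnW//; apply: va; lia.
  by rewrite !Ei; [apply: va; lia|lia|lia].
move=> /dist_le_walk; rewrite {1}/v' /= v0 Ei; last by lia.
rewrite (_ : m.-2.+2 = m); last by lia.
by rewrite vm -/m; lia.
Qed.

Lemma distxx x : dist x x = 0%N.
Proof.
by apply/eqP; rewrite -leqn0; apply: (@dist_le_walk 0 (fun=> x)) => i.
Qed.

Lemma dist_eq0 x y : dist x y = 0%N -> x = y.
Proof. by have [w [<- + _]] := dist_geodesic x y => + d0; rewrite d0. Qed.

Lemma distC x y : dist x y = dist y x.
Proof.
suff H (u v : X) : (dist u v <= dist v u)%N by apply/eqP; rewrite eqn_leq !H.
have [w [wv wu ww]] := dist_geodesic v u; set n := dist v u in wu ww *.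
have := @dist_le_walk n (fun i => w (n - i)%N).
rewrite subn0 subnn wu wv; apply => i ni; rewrite adjC.
by rewrite (_ : (n - i = (n - i.+1).+1)%N); [apply: ww; lia|lia].
Qed.

Lemma dist_adj_le x y y' : adj y y' -> (dist x y' <= (dist x y).+1)%N.
Proof.
move=> yy'; have [w [w0 wn ww]] := dist_geodesic x y; set n := dist x y in wn ww *.
pose v i := if (i <= n)%N then w i else y'.
have := @dist_le_walk n.+1 v; rewrite {3}/v ltnn {2}/v leq0n w0; apply => i.
rewrite ltnS leq_eqVlt /v => /orP[/eqP ->|lin]; first by rewrite leqnn ltnn wn.
by rewrite lin ltnW//; apply: ww.
Qed.

Lemma dist_triangle x y z : (dist x z <= dist x y + dist y z)%N.
Proof.
have [w [w0 wn ww]] := dist_geodesic y z; rewrite -{1}wn.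
have : (dist y z <= dist y z)%N by [].
elim: {1 3 4}(dist y z) => [_|k IH kn]; first by rewrite w0 addn0.
by rewrite addnS (leq_trans (dist_adj_le x (ww k kn)))// ltnS IH// ltnW.
Qed.

Lemma dist_adj x y : adj x y -> dist x y = 1%N.
Proof.
move=> xy; have := dist_adj_le x xy; rewrite distxx leq_eqVlt => /orP[/eqP//|].
by rewrite ltnS leqn0 => /eqP/dist_eq0 E; move: xy; rewrite E adjxx.
Qed.

Lemma dist1_adj x y : dist x y = 1%N -> adj x y.
Proof.
have [w [<- + ww]] := dist_geodesic x y => + d1; rewrite d1 => <-.
by apply: ww; rewrite d1.
Qed.

Lemma closer_exists z x : x != z -> exists2 x', adj x x' &
  dist z x = (dist z x').+1.
Proof.
move=> xz; have [w [w0 wn ww]] := dist_geodesic z x.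
case E : (dist z x) wn ww => [|n] wn ww; first by rewrite -w0 -wn eqxx in xz.
exists (w n); first by rewrite adjC -wn; exact: ww.
have : (dist z (w n) <= n)%N.
  by rewrite -w0; apply: dist_le_walk => i ni; apply: ww; lia.
by have := dist_adj_le z (ww n (leqnn _)); rewrite wn E; lia.
Qed.

(** A geodesic from [z] to [x'], prolonged by [x] and then by [x''], is reduced, so [reduced_dist]
    gives its length. This is the form in which acyclicity is used from here on. *)
Lemma closer_uniq z x x' x'' : adj x x' -> dist z x = (dist z x').+1 ->
  adj x x'' -> x'' != x' -> dist z x'' = (dist z x).+1.
Proof.
move=> xx' zx xx'' x''x'.
have [w [w0 wn ww]] := dist_geodesic z x'; set n := dist z x' in zx wn ww *.
pose v i := if (i <= n)%N then w i else if i == n.+1 then x else x''.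
have := @reduced_dist n.+2 v.
rewrite zx {3}/v ltnNge leqnSn /= eqn_leq ltnn /= {2}/v leq0n w0; apply.
have vw i : (i <= n)%N -> v i = w i by rewrite /v => ->.
have vx : v n.+1 = x by rewrite /v ltnn eqxx.
have vx'' : v n.+2 = x''.
  by rewrite /v ltnNge leqnSn /= eqn_leq ltnn.
have aw : walk n.+1 v.
  move=> i; rewrite ltnS leq_eqVlt => /orP[/eqP ->|lin].
    by rewrite vx vw// wn adjC.
  by rewrite !vw ?(ltnW lin)//; exact: ww.
split=> i.
  by rewrite ltnS leq_eqVlt => /orP[/eqP ->|/aw//]; rewrite vx vx''.
rewrite !ltnS leq_eqVlt => /orP[/eqP ->|lin].
  by rewrite vx'' vw// wn eq_sym.
(* A backtrack here would shorten the way from [z] to [x] or to [x']. *)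
apply/eqP => E; have := @dist_le_walk i v.
have iv : walk i v by move=> j ji; apply: aw; lia.
have := dist_le_walk iv; rewrite vw// w0 E.
move: lin; rewrite leq_eqVlt => /orP[/eqP lin|lin].
  by rewrite lin vx zx; lia.
rewrite vw// => le1.
have : (dist (w i.+2) x' <= n - i.+2)%N.
  have := @dist_le_walk (n - i.+2) (fun j => w (i.+2 + j)%N).
  rewrite addn0 subnKC// wn; apply => j jn; rewrite addnS; apply: ww; lia.
have := dist_triangle z (w i.+2) x'; rewrite -/n; lia.
Qed.

Lemma dist_adj_or z x y : adj x y ->
  dist z y = (dist z x).+1 \/ dist z x = (dist z y).+1.
Proof.
move=> xy; have [E|xz] := eqVneq x z.
  by left; rewrite -E distxx (dist_adj xy).
have [x' xx' zx] := closer_exists xz.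
have [->|yx'] := eqVneq y x'; [by right|left].
exact: closer_uniq xx' zx xy yx'.
Qed.

(* If no neighbour of [y] is closer to both [a] and [z], then [y] lies on the
   geodesic from [a] to [z]. *)
Lemma dist_between a y z :
  (forall x, adj y x -> dist a y = (dist a x).+1 ->
     dist z x = (dist z y).+1) ->
  dist a z = (dist a y + dist z y)%N.
Proof.
have [k] := ubnP (dist z y); elim: k y => // k IH y yk H.
have [->|yz] := eqVneq y z; first by rewrite distxx addn0.
have [y1 yy1 zy] := closer_exists yz.
have ay1 : dist a y1 = (dist a y).+1.
  by case: (dist_adj_or a yy1) => // /(H _ yy1); lia.
have -> : (dist a y + dist z y = dist a y1 + dist z y1)%N by lia.
apply: IH => [|x y1x ax]; first by lia.
have [->//|xy] := eqVneq x y.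
by have := closer_uniq (z := a) _ ay1 y1x xy; rewrite adjC => /(_ yy1); lia.
Qed.

End tree_metric.

(** * Rays, their shadows and the height function *)

Section rays.
Variables (R : realType) (q : nat) (X : homogeneous_tree q).
Implicit Types (x y z : X) (w : boundary X).

Local Notation o := (@Defs.root q X).
Local Notation lvl := (dist o).

Lemma ray0 w : w 0%N = o. Proof. by have [] := rayP w. Qed.

Lemma ray_dist w m n : (m <= n)%N -> dist (w m) (w n) = (n - m)%N.
Proof. by have [_] := rayP w; apply. Qed.

Lemma ray_lvl w n : lvl (w n) = n.
Proof. by rewrite -(ray0 w) ray_dist ?subn0. Qed.

Lemma ray_adj w n : adj (w n) (w n.+1).
Proof. by apply: dist1_adj; rewrite ray_dist// subSnn. Qed.

(** Moving away from [y] is irreversible: the ray does not turn back, and by [closer_uniq] every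
    neighbour other than the previous vertex is farther. *)
Lemma ray_away w y m k : dist y (w m.+1) = (dist y (w m)).+1 ->
  dist y (w (m + k)%N) = (dist y (w m) + k)%N.
Proof.
move=> away.
suff : dist y (w (m + k).+1) = (dist y (w (m + k)%N)).+1 /\
       dist y (w (m + k)%N) = (dist y (w m) + k)%N by case.
elim: k => [|k [IH1 IH2]]; first by rewrite !addn0.
rewrite addnS; split; last by rewrite IH1 IH2 addnS.
apply: (closer_uniq (x' := w (m + k)%N)) => //; rewrite ?ray_adj// 1?adjC ?ray_adj//.
apply/eqP => E; have := ray_dist w (m := m + k) (n := (m + k).+2) ltac:(lia).
by rewrite E distxx; lia.
Qed.

(** A step towards [y] at time [m] would force all earlier steps to go towards [y] as well, so that
    the root would be at distance at least [m.+1] from [y]. *)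
Lemma ray_away_lvl w y m : (lvl y <= m)%N ->
  dist y (w m.+1) = (dist y (w m)).+1.
Proof.
move=> ym; case: (dist_adj_or y (ray_adj w m)) => // closer.
have H k : (k <= m)%N -> dist y (w k) = (dist y (w k.+1)).+1.
  move=> km; case: (dist_adj_or y (ray_adj w k)) => // away.
  have := ray_away (m - k) away; have := ray_away (m - k).+1 away.
  by rewrite addnS subnKC//; lia.
have : (dist y (w m.+1) + m.+1 = dist y (w 0%N))%N.
  move: {-2}m (leqnn m) => n; elim: n => [|n IH] nm.
    by rewrite addn1 -(H 0%N).
  by rewrite -IH; [rewrite (H n.+1)//; lia|lia].
by rewrite ray0 (distC y o); lia.
Qed.

(** From [m] on the sequence that defines [height] is constant. *)
Lemma height_away w y m : dist y (w m.+1) = (dist y (w m)).+1 ->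
  height R w y = m%:R - (dist y (w m))%:R.
Proof.
move=> away; apply/cvg_lim => //; apply: cvg_near_cst; exists m => // n /= mn.
rewrite -(subnKC mn) ray_away// !natrD opprD; ring.
Qed.

Lemma height_lvl w y m : (lvl y <= m)%N ->
  height R w y = m%:R - (dist y (w m))%:R.
Proof. by move=> ym; apply/height_away/ray_away_lvl. Qed.

Lemma shadowP w y : shadow y w <-> w (lvl y) = y.
Proof. by split=> [[n <-]|yE]; [rewrite ray_lvl|exists (lvl y)]. Qed.

Lemma height_shadow w y : shadow y w -> height R w y = (lvl y)%:R.
Proof. by move=> /shadowP yw; rewrite (height_lvl _ (leqnn _)) yw distxx subr0. Qed.

Lemma height_root w : height R w o = 0.
Proof. by rewrite height_shadow ?distxx//; exists 0%N; rewrite ray0. Qed.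

(** The ray reaches [y'] from [p], so its next step leads to another neighbour of [y'] and away from
    [y]. *)
Lemma height_beyond w y y' p : shadow y' w -> adj y' p ->
  lvl y' = (lvl p).+1 -> dist y y' = (dist y p).+1 ->
  height R w y = (lvl y')%:R - (dist y y')%:R.
Proof.
move=> /shadowP yw y'p y'E yE; rewrite (@height_away _ _ (lvl y')) ?yw//.
have pw : w (lvl p) = p.
  apply: contrapT => /eqP npw.
  have : lvl (w (lvl p)) = (lvl y').+1.
    apply: (closer_uniq (x' := p)) => //.
    by rewrite adjC -[X in adj _ X]yw y'E ray_adj.
  by rewrite ray_lvl; lia.
apply: (closer_uniq (x' := p)) => //; first by rewrite -[X in adj X]yw ray_adj.
apply/eqP => E; have := ray_lvl w (lvl y').+1; rewrite E; lia.
Qed.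

(** Seen from the vertex [v] of the ray at the level of [y], the parent [p] is nearer than [y]:
    otherwise the geodesic from the root to [v] would run through [y], and equality of levels would
    give [v = y]. *)
Lemma height_parent w y p : adj y p -> lvl y = (lvl p).+1 ->
  ~ shadow y w -> height R w y = height R w p - 1.
Proof.
move=> yp yE ny; rewrite (height_lvl w (leqnn (lvl y))).
rewrite (@height_lvl _ p (lvl y)); last by rewrite yE.
suff -> : dist y (w (lvl y)) = (dist p (w (lvl y))).+1.
  by rewrite -(addn1 (dist p _)) natrD; ring.
rewrite !(distC _ (w _)); set v := w (lvl y).
case: (dist_adj_or v yp) => // far; exfalso.
have : lvl v = (lvl y + dist v y)%N.
  apply: dist_between => x yx xE; have [->//|xp] := eqVneq x p.
  by have := closer_uniq yp yE yx xp; rewrite xE; lia.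
rewrite /v ray_lvl => vE; apply: ny; apply/shadowP.
by apply: dist_eq0; lia.
Qed.

(** The vertex [v] one level beyond [y] is far enough along the ray to compute the heights of [y]
    and of all its neighbours, and exactly one of these is nearer to [v]. *)
Lemma height_neighbour w y : exists p0, [/\ adj y p0,
  height R w p0 = height R w y + 1 &
  forall x, adj y x -> x != p0 -> height R w x = height R w y - 1].
Proof.
pose v := w (lvl y).+1.
have hv x : adj y x -> height R w x = (lvl y).+1%:R - (dist v x)%:R.
  by move=> yx; rewrite /v (distC (w _)) -height_lvl//; exact: dist_adj_le.
have hy : height R w y = (lvl y).+1%:R - (dist v y)%:R.
  by rewrite /v (distC (w _)) -height_lvl.
have yv : y != v by apply/eqP => yv; have := ray_lvl w (lvl y).+1; rewrite -/v -yv; lia.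
have [p0 yp0 p0E] := closer_exists yv.
exists p0; split=> //; first by rewrite hv// hy p0E -natr1; ring.
by move=> x yx xp0; rewrite hv// hy (closer_uniq yp0 p0E yx xp0) -natr1; ring.
Qed.

Lemma height_bound w y : `|height R w y| <= (lvl y)%:R.
Proof.
rewrite (height_lvl w (leqnn _)); have := dist_triangle y o (w (lvl y)).
rewrite ray_lvl (distC y o) => le2.
have le2' : (dist y (w (lvl y)))%:R <= (lvl y)%:R *+ 2 :> R.
  by rewrite mulr2n -natrD ler_nat; lia.
by rewrite ler_norml; apply/andP; split; [lra|rewrite lerBlDr lerDl].
Qed.

Lemma ray_eq w w' n k : w n = w' n -> (k <= n)%N -> w k = w' k.
Proof.
elim: n k => [|n IH] k wn; first by rewrite leqn0 => /eqP ->.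
rewrite leq_eqVlt => /orP[/eqP -> //|]; rewrite ltnS; apply: IH.
apply/esym/eqP; apply: contraT => neq.
have := @closer_uniq _ _ o (w n.+1) (w n) (w' n).
rewrite !ray_lvl {2}wn -(adjC (w n)) -(adjC (w' n)) !ray_adj.
by move=> /(_ erefl erefl erefl neq); lia.
Qed.

Lemma shadow_sub y y' w : (lvl y <= lvl y')%N -> shadow y w -> shadow y' w ->
  shadow y' `<=` shadow y.
Proof.
move=> yy' /shadowP yw /shadowP y'w w' /shadowP y'w'; apply/shadowP.
by rewrite -[RHS]yw; apply: ray_eq yy'; rewrite y'w y'w'.
Qed.

(** Supplies the stability under intersection that the monotone class argument on the boundary
    requires. *)
Lemma shadow_setI y y' :
  [\/ shadow y `&` shadow y' = set0, shadow y `&` shadow y' = shadow y |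
      shadow y `&` shadow y' = shadow y'].
Proof.
have [[w [yw y'w]]|H] := pselect (exists w, shadow y w /\ shadow y' w); last first.
  by apply: Or31; rewrite -subset0 => w [? ?]; apply: H; exists w.
have [yy'|/ltnW y'y] := leqP (lvl y) (lvl y').
  by apply/Or33/setIidPr; exact: shadow_sub yw y'w.
by apply/Or32/setIidPl; exact: shadow_sub y'w yw.
Qed.

Lemma shadow_root : shadow o = [set: boundary X].
Proof. by apply/seteqP; split=> // w _; exists 0%N; exact: ray0. Qed.

End rays.

(** * Local finiteness and countability of the tree *)

Section counting_vertices.
Variables (q : nat) (X : homogeneous_tree q).
Implicit Types x y : X.

Lemma neighbours x : exists s : seq X,
  [/\ uniq s, size s = q.+1 & forall y, (y \in s) = adj x y].
Proof.
have E := @tree_degree q X x; set A := [set y | _] in E.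
have finA : finite_set A by exists q.+1.
exists (finmap.enum_fset (fset_set A)); split; first exact: finmap.fset_uniq.
  by apply/card_eq_fsetP; rewrite fset_setK.
move=> y; apply: etrans (in_fset_set finA y) _.
by apply/idP/idP; rewrite inE.
Qed.

(** Each sphere is covered by the finite neighbour sets of the vertices of the previous sphere. *)
Lemma countable_tree : countable [set: X].
Proof.
have sphere n : countable [set x : X | dist (@Defs.root q X) x = n].
  elim: n => [|n IH].
    rewrite (_ : [set _ | _] = [set Defs.root]) //.
    by apply/seteqP; split=> x /=; [move=> /dist_eq0|move=> ->; exact: distxx].
  apply: sub_countable (bigcup_countable (F := fun x => [set y | adj x y]) IH _).
    apply: subset_card_le => y /= yn.
    have [x yx xE] : exists2 x, adj y x & dist (@Defs.root q X) y = (dist Defs.root x).+1.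
      by apply: closer_exists; apply/eqP => yr; rewrite yr distxx in yn.
    by exists x; rewrite /= ?(adjC x)//; move: xE; rewrite yn => -[].
  by move=> x _; apply: finite_set_countable; exists q.+1; exact: tree_degree.
apply: sub_countable (bigcup_countable (D := setT) _ (fun n _ => sphere n)) => //.
by apply: subset_card_le => x _; exists (dist Defs.root x).
Qed.

End counting_vertices.

(** * Square-integrable complex functions *)

Section complex_parts.
Variable R : realType.
Implicit Types x y : R[i].

Lemma reD x y : complex.Re (x + y) = complex.Re x + complex.Re y.
Proof. by case: x y => [? ?] [? ?]. Qed.
Lemma imD x y : complex.Im (x + y) = complex.Im x + complex.Im y.
Proof. by case: x y => [? ?] [? ?]. Qed.
Lemma reN x : complex.Re (- x) = - complex.Re x.
Proof. by case: x. Qed.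
Lemma imN x : complex.Im (- x) = - complex.Im x.
Proof. by case: x. Qed.
Lemma reM x y : complex.Re (x * y) =
  complex.Re x * complex.Re y - complex.Im x * complex.Im y.
Proof. by case: x y => [? ?] [? ?]. Qed.
Lemma imM x y : complex.Im (x * y) =
  complex.Re x * complex.Im y + complex.Im x * complex.Re y.
Proof. by case: x y => [? ?] [? ?]. Qed.
Lemma reJ x : complex.Re x^* = complex.Re x. Proof. by case: x. Qed.
Lemma imJ x : complex.Im x^* = - complex.Im x. Proof. by case: x. Qed.
Lemma conjc_realC (a : R) : (a%:C)^* = a%:C. Proof. exact: conjc_real. Qed.

Lemma conjcM x y : (x * y)^* = x^* * y^*. Proof. exact: rmorphM. Qed.
Lemma conjcI x : x^*^* = x. Proof. exact: conjCK. Qed.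
Lemma conjcD x y : (x + y)^* = x^* + y^*. Proof. exact: rmorphD. Qed.

Definition reim := (reD, imD, reN, imN, reM, imM, reJ, imJ).

Lemma complex_eq x y : complex.Re x = complex.Re y ->
  complex.Im x = complex.Im y -> x = y.
Proof. by case: x y => [? ?] [? ?] /= -> ->. Qed.

Lemma re_sum I (s : seq I) (F : I -> R[i]) :
  complex.Re (\sum_(i <- s) F i) = \sum_(i <- s) complex.Re (F i).
Proof. by elim: s => [|i s IH]; rewrite ?(big_nil, big_cons)//= reD IH. Qed.

Lemma sqr_normcE x : normc x ^+ 2 = complex.Re x ^+ 2 + complex.Im x ^+ 2.
Proof. by case: x => a b /=; rewrite sqr_sqrtr// addr_ge0// sqr_ge0. Qed.

Lemma normc_ge0 x : 0 <= normc x.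
Proof. by case: x => a b; exact: sqrtr_ge0. Qed.

Lemma normc_conj x : normc x^* = normc x.
Proof. by case: x => a b /=; rewrite sqrrN. Qed.

Lemma normc_real (a : R) : normc a%:C = `|a|.
Proof. by rewrite /= expr0n addr0 sqrtr_sqr. Qed.

Lemma normc_realB (a b : R) : normc (a%:C - b%:C) = `|a - b|.
Proof. by rewrite -normc_real rmorphB. Qed.

Lemma mulcJ x : x * x^* = (normc x ^+ 2)%:C.
Proof.
by rewrite sqr_normcE; apply: complex_eq; rewrite !reim /=; ring.
Qed.

Lemma addcJ x : x + x^* = 2 * (complex.Re x)%:C.
Proof.
rewrite -[2](rmorph_nat (real_complex R)).
by apply: complex_eq; rewrite !reim /=; ring.
Qed.

Lemma ler_norm_Re x : `|complex.Re x| <= normc x.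
Proof.
rewrite -(ler_pXn2r (n := 2))// ?nnegrE ?normc_ge0// sqr_normcE.
by rewrite real_normK ?num_real// lerDl sqr_ge0.
Qed.

Lemma ler_norm_Im x : `|complex.Im x| <= normc x.
Proof.
rewrite -(ler_pXn2r (n := 2))// ?nnegrE ?normc_ge0// sqr_normcE.
by rewrite real_normK ?num_real// lerDr sqr_ge0.
Qed.

Lemma sqr_normcB x y : normc (x - y) ^+ 2 =
  normc x ^+ 2 - 2 * complex.Re (x * y^*) + normc y ^+ 2.
Proof. by rewrite !sqr_normcE !reim; ring. Qed.

Lemma sqr_normcD_le x y : normc (x + y) ^+ 2 <= 2 * normc x ^+ 2 + 2 * normc y ^+ 2.
Proof.
rewrite -subr_ge0 (_ : _ - _ = normc (x - y) ^+ 2) ?sqr_ge0//.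
by rewrite !sqr_normcE !reim; ring.
Qed.

Lemma normc_sum_le I (s : seq I) (F : I -> R[i]) :
  normc (\sum_(i <- s) F i) <= \sum_(i <- s) normc (F i).
Proof.
elim: s => [|i s IH]; first by rewrite !big_nil normc0.
by rewrite !big_cons (le_trans (le_normcD _ _))// lerD2l.
Qed.

End complex_parts.

Section complex_measurable.
Context d (T : measurableType d) (R : realType) (D : set T).
Implicit Types f g : T -> R[i].

Lemma cmeasurable_real (f : T -> R) : measurable_fun D f ->
  cmeasurable D (fun x => (f x)%:C).
Proof. by move=> mf; split=> //=. Qed.

Lemma cmeasurable_cst (a : R[i]) : cmeasurable D (fun=> a).
Proof. by split. Qed.

Lemma cmeasurableD f g : cmeasurable D f -> cmeasurable D g ->
  cmeasurable D (fun x => f x + g x).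
Proof.
move=> [f1 f2] [g1 g2]; split.
- by under eq_fun do rewrite reD; exact: measurable_funD.
- by under eq_fun do rewrite imD; exact: measurable_funD.
Qed.

Lemma cmeasurableM f g : cmeasurable D f -> cmeasurable D g ->
  cmeasurable D (fun x => f x * g x).
Proof.
move=> [f1 f2] [g1 g2]; split.
- under eq_fun do rewrite reM.
  by apply: measurable_funB; exact: measurable_funM.
- under eq_fun do rewrite imM.
  by apply: measurable_funD; exact: measurable_funM.
Qed.

Lemma cmeasurableZ a f : cmeasurable D f -> cmeasurable D (fun x => a * f x).
Proof. by apply: cmeasurableM; exact: cmeasurable_cst. Qed.

Lemma cmeasurableB f g : cmeasurable D f -> cmeasurable D g ->
  cmeasurable D (fun x => f x - g x).
Proof.
move=> mf mg; under eq_fun do rewrite -mulN1r.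
by apply: cmeasurableD => //; exact: cmeasurableZ.
Qed.

Lemma cmeasurableJ f : cmeasurable D f -> cmeasurable D (fun x => (f x)^*).
Proof.
move=> [f1 f2]; split.
- by under eq_fun do rewrite reJ.
- by under eq_fun do rewrite imJ; exact: measurableT_comp.
Qed.

Lemma cmeasurable_sum I (s : seq I) (F : I -> T -> R[i]) :
  (forall i, cmeasurable D (F i)) ->
  cmeasurable D (fun x => \sum_(i <- s) F i x).
Proof.
move=> mF; elim: s => [|i s IH].
  by under eq_fun do rewrite big_nil; exact: cmeasurable_cst.
by under eq_fun do rewrite big_cons; exact: cmeasurableD.
Qed.

Lemma measurable_sqr_normc f : cmeasurable D f ->
  measurable_fun D (fun x => normc (f x) ^+ 2).
Proof.
move=> [f1 f2]; under eq_fun do rewrite sqr_normcE.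
by apply: measurable_funD; exact: measurable_funX.
Qed.

Lemma measurable_normc f : cmeasurable D f ->
  measurable_fun D (fun x => normc (f x)).
Proof.
move=> mf; rewrite (_ : (fun x => _) = (fun x => (normc (f x) ^+ 2) `^ 2^-1)).
  apply: (measurableT_comp (measurable_powR _)); exact: measurable_sqr_normc.
apply/funext => x; rewrite powR12_sqrt ?sqr_ge0// sqrtr_sqr ger0_norm//.
exact: normc_ge0.
Qed.

Lemma cmeasurableS (E : set T) f : measurable E -> D `<=` E ->
  cmeasurable E f -> cmeasurable D f.
Proof. by move=> mE DE [f1 f2]; split; [exact: measurable_funS f1|exact: measurable_funS f2]. Qed.

End complex_measurable.

Section complex_integral.
Context d (T : measurableType d) (R : realType).
Variables (m : {measure set T -> \bar R}) (D : set T) (mD : measurable D).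
Implicit Types f g : T -> R[i].

Lemma cintegrable_norm f : cintegrable m D f <->
  cmeasurable D f /\ m.-integrable D (fun x => (normc (f x))%:E).
Proof.
split=> -[mf fi]; split=> //.
  apply/integrableP; split; first exact/measurable_EFinP/measurable_normc.
  by under eq_integral do rewrite gee0_abs ?lee_fin ?normc_ge0//.
move/integrableP : fi => [_].
by under eq_integral do rewrite gee0_abs ?lee_fin ?normc_ge0//.
Qed.

Lemma cintegrable_le f (g : T -> R) : cmeasurable D f ->
  m.-integrable D (EFin \o g) -> (forall x, D x -> normc (f x) <= g x) ->
  cintegrable m D f.
Proof.
move=> mf ig fg; apply/cintegrable_norm; split=> //.
apply: le_integrable ig => //; first exact/measurable_EFinP/measurable_normc.
move=> x Dx; rewrite gee0_abs ?lee_fin ?normc_ge0// ger0_norm.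
  exact: fg.
by rewrite (le_trans _ (fg x Dx))// normc_ge0.
Qed.

Lemma cintegrable_Re f : cintegrable m D f ->
  m.-integrable D (EFin \o (fun x => complex.Re (f x))).
Proof.
move=> /cintegrable_norm[mf fi]; apply: le_integrable fi => //.
  by apply/measurable_EFinP; case: mf.
move=> x Dx /=; rewrite lee_fin (ger0_norm (normc_ge0 _)).
exact: ler_norm_Re.
Qed.

Lemma cintegrable_Im f : cintegrable m D f ->
  m.-integrable D (EFin \o (fun x => complex.Im (f x))).
Proof.
move=> /cintegrable_norm[mf fi]; apply: le_integrable fi => //.
  by apply/measurable_EFinP; case: mf.
move=> x Dx /=; rewrite lee_fin (ger0_norm (normc_ge0 _)).
exact: ler_norm_Im.
Qed.

Lemma cintegrableD f g : cintegrable m D f -> cintegrable m D g ->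
  cintegrable m D (fun x => f x + g x).
Proof.
move=> /cintegrable_norm[mf fi] /cintegrable_norm[mg gi].
apply: (cintegrable_le (g := fun x => normc (f x) + normc (g x))).
- exact: cmeasurableD.
- by apply: eq_integrable (integrableD mD fi gi) => // x _.
- by move=> x _; exact: le_normcD.
Qed.

Lemma cintegrableZ a f : cintegrable m D f ->
  cintegrable m D (fun x => a * f x).
Proof.
move=> /cintegrable_norm[mf fi].
apply: (cintegrable_le (g := fun x => normc a * normc (f x))).
- exact: cmeasurableZ.
- by apply: eq_integrable (integrableZl mD (normc a) fi) => // x _.
- by move=> x _; rewrite normcM.
Qed.

Lemma cintegrable0 : cintegrable m D (fun=> 0).
Proof.
apply: (cintegrable_le (g := fun=> 0)); first exact: cmeasurable_cst.
  exact: integrable0.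
by move=> x _; rewrite normc0.
Qed.

Lemma cintegrable_sum I (s : seq I) (F : I -> T -> R[i]) :
  (forall i, cintegrable m D (F i)) ->
  cintegrable m D (fun x => \sum_(i <- s) F i x).
Proof.
move=> mF; elim: s => [|i s IH].
  by under eq_fun do rewrite big_nil; exact: cintegrable0.
by under eq_fun do rewrite big_cons; exact: cintegrableD.
Qed.

Lemma cintegrableJ f : cintegrable m D f -> cintegrable m D (fun x => (f x)^*).
Proof.
move=> /cintegrable_norm[mf fi]; apply: (cintegrable_le _ fi).
  exact: cmeasurableJ.
by move=> x _; rewrite normc_conj.
Qed.

Lemma cintegrable_bounded f g (M : R) : cmeasurable D g ->
  (forall x, D x -> normc (g x) <= M) -> cintegrable m D f ->
  cintegrable m D (fun x => f x * g x).
Proof.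
move=> mg gM /cintegrable_norm[mf fi].
apply: (cintegrable_le (g := fun x => M * normc (f x))).
- exact: cmeasurableM.
- by apply: eq_integrable (integrableZl mD M fi) => // x _.
- by move=> x Dx; rewrite normcM mulrC ler_wpM2r ?normc_ge0// gM.
Qed.

Lemma eq_cintegral f g : {in D, f =1 g} -> cintegral m D f = cintegral m D g.
Proof.
by move=> fg; congr Complex; apply: eq_Rintegral => x xD; rewrite fg.
Qed.

Lemma cintegralD f g : cintegrable m D f -> cintegrable m D g ->
  cintegral m D (fun x => f x + g x) = cintegral m D f + cintegral m D g.
Proof.
move=> fi gi; apply: complex_eq; rewrite ?reim /=.
- rewrite -RintegralD//; [|exact: cintegrable_Re..].
  by apply: eq_Rintegral => x _; rewrite reD.
- rewrite -RintegralD//; [|exact: cintegrable_Im..].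
  by apply: eq_Rintegral => x _; rewrite imD.
Qed.

Lemma cintegralZ a f : cintegrable m D f ->
  cintegral m D (fun x => a * f x) = a * cintegral m D f.
Proof.
move=> fi; have [f1 f2] := (cintegrable_Re fi, cintegrable_Im fi).
have sc (b : R) (h : T -> R) : m.-integrable D (EFin \o h) ->
    m.-integrable D (EFin \o (fun x => b * h x)).
  by move=> hi; apply: eq_integrable (integrableZl mD b hi) => // x _.
apply: complex_eq; rewrite ?reim /=.
- rewrite -!RintegralZl// -RintegralB//; [|exact: sc..].
  by apply: eq_Rintegral => x _; rewrite reM.
- rewrite -!RintegralZl// -RintegralD//; [|exact: sc..].
  by apply: eq_Rintegral => x _; rewrite imM.
Qed.

Lemma cintegral0 : cintegral m D (fun=> 0) = 0.
Proof.
by apply: complex_eq; rewrite /= Rintegral_cst// mul0r.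
Qed.

Lemma cintegral_sum I (s : seq I) (F : I -> T -> R[i]) :
  (forall i, cintegrable m D (F i)) ->
  cintegral m D (fun x => \sum_(i <- s) F i x) =
  \sum_(i <- s) cintegral m D (F i).
Proof.
move=> Fi; elim: s => [|i s IH].
  by under eq_fun do rewrite big_nil; rewrite big_nil cintegral0.
under eq_fun do rewrite big_cons.
by rewrite big_cons cintegralD ?IH//; exact: cintegrable_sum.
Qed.

Lemma cintegralJ f : cintegrable m D f ->
  cintegral m D (fun x => (f x)^*) = (cintegral m D f)^*.
Proof.
move=> fi; apply: complex_eq; rewrite ?reim /=.
  by apply: eq_Rintegral => x _; rewrite reJ.
rewrite -mulN1r -RintegralZl//; last exact: cintegrable_Im.
by apply: eq_Rintegral => x _; rewrite imJ mulN1r.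
Qed.

Lemma cintegral_real (f : T -> R) :
  cintegral m D (fun x => (f x)%:C) = (\int[m]_(x in D) f x)%:C.
Proof. by apply: complex_eq => //=; rewrite Rintegral_cst// mul0r. Qed.

(** Multiplying [f] by the conjugate of its integral makes the integral real and nonnegative, which
    reduces the claim to real functions. *)
Lemma le_normc_cintegral f : cintegrable m D f ->
  normc (cintegral m D f) <= \int[m]_(x in D) normc (f x).
Proof.
move=> fi; set I := cintegral m D f; have [_ fni] := (cintegrable_norm f).1 fi.
have [->|I0] := eqVneq (normc I) 0.
  by apply: Rintegral_ge0 => x _; exact: normc_ge0.
have Ip : 0 < normc I by rewrite lt_neqAle eq_sym I0 normc_ge0.
have : normc I ^+ 2 <= normc I * \int[m]_(x in D) normc (f x).
  have -> : normc I ^+ 2 = complex.Re (cintegral m D (fun x => I^* * f x)).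
    by rewrite cintegralZ// mulrC mulcJ.
  rewrite -RintegralZl//; apply: le_Rintegral => //.
  - exact/cintegrable_Re/cintegrableZ.
  - by apply: eq_integrable (integrableZl mD (normc I) fni) => // x _.
  - move=> x _; apply: le_trans (ler_norm _) _.
    by apply: le_trans (ler_norm_Re _) _; rewrite normcM normc_conj.
by rewrite expr2 ler_pM2l.
Qed.

End complex_integral.

(** * Inner products and Bessel's inequality *)

Section square_integrable.
Context d (T : measurableType d) (R : realType).
Variables (m : {measure set T -> \bar R}) (D : set T) (mD : measurable D).
Implicit Types f g h : T -> R[i].

Definition sqint f : Prop := cmeasurable D f /\
  m.-integrable D (EFin \o (fun x => normc (f x) ^+ 2)).

Definition sqnorm f : R := \int[m]_(x in D) normc (f x) ^+ 2.

(** Later also applied to an [f] that is merely integrable, against a bounded [g]. *)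
Definition cdot f g : R[i] := cintegral m D (fun x => f x * (g x)^*).

Lemma sqintP f : sqint f <-> cmeasurable D f /\
  (\int[m]_(x in D) (normc (f x) ^+ 2)%:E < +oo)%E.
Proof.
have E : (\int[m]_(x in D) `|(EFin \o (fun x => normc (f x) ^+ 2)%R) x| =
          \int[m]_(x in D) (normc (f x) ^+ 2)%:E)%E.
  by apply: eq_integral => x _ /=; rewrite ger0_norm// sqr_ge0.
split=> -[mf fi]; split=> //; first by move/integrableP : fi => [_]; rewrite E.
apply/integrableP; rewrite E; split=> //.
exact/measurable_EFinP/measurable_sqr_normc.
Qed.

Lemma sqnormE f : sqint f ->
  (\int[m]_(x in D) (normc (f x) ^+ 2)%:E)%E = (sqnorm f)%:E.
Proof. by move=> [_ fi]; rewrite /sqnorm/Rintegral fineK// integrable_fin_num. Qed.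

Lemma sqnorm_ge0 f : 0 <= sqnorm f.
Proof. by apply: Rintegral_ge0 => x _; rewrite sqr_ge0. Qed.

Lemma sqint_le f (g : T -> R) : cmeasurable D f ->
  m.-integrable D (EFin \o g) ->
  (forall x, D x -> normc (f x) ^+ 2 <= g x) -> sqint f.
Proof.
move=> mf ig fg; split=> //; apply: le_integrable ig => //.
  exact/measurable_EFinP/measurable_sqr_normc.
move=> x Dx; rewrite gee0_abs ?lee_fin ?sqr_ge0// ger0_norm ?fg//.
by rewrite (le_trans _ (fg x Dx))// sqr_ge0.
Qed.

Lemma sqintD f g : sqint f -> sqint g -> sqint (fun x => f x + g x).
Proof.
move=> [mf fi] [mg gi].
apply: (sqint_le (g := fun x => 2 * normc (f x) ^+ 2 + 2 * normc (g x) ^+ 2)).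
- exact: cmeasurableD.
- apply: eq_integrable (integrableD mD (integrableZl mD 2 fi)
    (integrableZl mD 2 gi)) => // x _.
- by move=> x _; exact: sqr_normcD_le.
Qed.

Lemma sqintZ a f : sqint f -> sqint (fun x => a * f x).
Proof.
move=> [mf fi].
apply: (sqint_le (g := fun x => normc a ^+ 2 * normc (f x) ^+ 2)).
- exact: cmeasurableZ.
- by apply: eq_integrable (integrableZl mD (normc a ^+ 2) fi) => // x _.
- by move=> x _; rewrite normcM exprMn.
Qed.

Lemma sqintB f g : sqint f -> sqint g -> sqint (fun x => f x - g x).
Proof.
move=> sf sg; rewrite (_ : (fun x => _) = (fun x => f x + (-1) * g x)).
  by apply: sqintD => //; exact: sqintZ.
by apply/funext => x; rewrite mulN1r.
Qed.

Lemma sqint0 : sqint (fun=> 0).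
Proof.
apply: (sqint_le (g := fun=> 0)); first exact: cmeasurable_cst.
  exact: integrable0.
by move=> x _; rewrite normc0 expr0n.
Qed.

Lemma sqint_sum (I : Type) (s : seq I) (F : I -> T -> R[i]) :
  (forall i, sqint (F i)) -> sqint (fun x => \sum_(i <- s) F i x).
Proof.
move=> mF; elim: s => [|i s IH].
  by under eq_fun do rewrite big_nil; exact: sqint0.
by under eq_fun do rewrite big_cons; exact: sqintD.
Qed.

Lemma cdot_cintegrable f g : sqint f -> sqint g ->
  cintegrable m D (fun x => f x * (g x)^*).
Proof.
move=> [mf fi] [mg gi].
apply: (cintegrable_le mD (g := fun x => normc (f x) ^+ 2 + normc (g x) ^+ 2)).
- by apply: cmeasurableM => //; exact: cmeasurableJ.
- by apply: eq_integrable (integrableD mD fi gi) => // x _.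
- move=> x _; rewrite normcM normc_conj.
  have := sqr_ge0 (normc (f x) - normc (g x)).
  have : 0 <= normc (f x) * normc (g x) by rewrite mulr_ge0 ?normc_ge0.
  nra.
Qed.

Lemma cdotDl f g h : sqint f -> sqint g -> sqint h ->
  cdot (fun x => f x + g x) h = cdot f h + cdot g h.
Proof.
move=> sf sg sh; rewrite /cdot -cintegralD//; [|exact: cdot_cintegrable..].
by apply: eq_cintegral => x _; rewrite mulrDl.
Qed.

Lemma cdotZl a f g : sqint f -> sqint g ->
  cdot (fun x => a * f x) g = a * cdot f g.
Proof.
move=> sf sg; rewrite /cdot -cintegralZ//; last exact: cdot_cintegrable.
by apply: eq_cintegral => x _; rewrite mulrA.
Qed.

Lemma cdotC f g : sqint f -> sqint g -> cdot g f = (cdot f g)^*.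
Proof.
move=> sf sg; rewrite /cdot -cintegralJ//; last exact: cdot_cintegrable.
by apply: eq_cintegral => x _; rewrite conjcM conjcI mulrC.
Qed.

Lemma cdotZr a f g : sqint f -> sqint g ->
  cdot f (fun x => a * g x) = a^* * cdot f g.
Proof.
move=> sf sg; rewrite cdotC ?cdotZl//; last exact: sqintZ.
by rewrite (cdotC sf sg) conjcM conjcI.
Qed.

Lemma cdot_suml (I : Type) (s : seq I) (a : I -> R[i]) (F : I -> T -> R[i]) g :
  (forall i, sqint (F i)) -> sqint g ->
  cdot (fun x => \sum_(i <- s) a i * F i x) g = \sum_(i <- s) a i * cdot (F i) g.
Proof.
move=> sF sg; elim: s => [|i s IH].
  under eq_fun do rewrite big_nil; rewrite big_nil /cdot.
  by under eq_fun do rewrite mul0r; exact: cintegral0.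
under eq_fun do rewrite big_cons.
rewrite big_cons cdotDl// ?cdotZl ?IH//; first exact: sqintZ.
by apply: sqint_sum => j; exact: sqintZ.
Qed.

Lemma cdot_self f : cdot f f = (sqnorm f)%:C.
Proof.
by rewrite -(cintegral_real m mD); apply: eq_cintegral => x _; rewrite mulcJ.
Qed.

Lemma sqnormB f g : sqint f -> sqint g ->
  sqnorm (fun x => f x - g x) =
  sqnorm f - 2 * complex.Re (cdot f g) + sqnorm g.
Proof.
move=> sf sg; have Z (k : R) (u : T -> R) : m.-integrable D (EFin \o u) ->
    m.-integrable D (EFin \o (fun x => k * u x)).
  by move=> ui; apply: eq_integrable (integrableZl mD k ui) => // x _.
have ri := cintegrable_Re mD (cdot_cintegrable sf sg).
rewrite /sqnorm -RintegralZl//= -RintegralB//; [|exact: sf.2|exact: Z].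
rewrite -RintegralD//; [|rewrite /comp|exact: sg.2].
  by apply: eq_Rintegral => x _; rewrite sqr_normcB.
by apply: eq_integrable (integrableB mD sf.2 (Z 2 _ ri)) => // x _.
Qed.

Lemma sqnormZ a f : sqint f -> sqnorm (fun x => a * f x) = normc a ^+ 2 * sqnorm f.
Proof.
move=> [mf fi]; rewrite /sqnorm -RintegralZl//.
by apply: eq_Rintegral => x _; rewrite normcM exprMn.
Qed.

(** The squared norm of [f - t k g] with [k = cdot f g] is a nonnegative quadratic polynomial in the
    real number [t]. *)
Lemma cauchy_schwarz f g : sqint f -> sqint g ->
  normc (cdot f g) ^+ 2 <= sqnorm f * sqnorm g.
Proof.
move=> sf sg; set k := cdot f g; set F := sqnorm f; set G := sqnorm g.
have [G0 F0] : 0 <= G /\ 0 <= F by rewrite !sqnorm_ge0.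
have H (t : R) : 0 <= F - 2 * t * normc k ^+ 2 + t ^+ 2 * normc k ^+ 2 * G.
  have := sqnorm_ge0 (fun x => f x - t%:C * k * g x).
  rewrite sqnormB//; last exact: sqintZ.
  rewrite sqnormZ// normcM normc_real exprMn real_normK ?num_real//.
  rewrite (cdotZr _ sf sg) -/k conjcM conjc_realC -mulrA [_^* * _]mulrC mulcJ.
  by rewrite reM /= mul0r subr0 mulrA.
(* If [g] has norm 0 the polynomial is affine, and this [t] gives it the value -1 unless [k = 0];
   otherwise the minimum at [t = G^-1] is used. *)
have [G1|G1] := eqVneq G 0.
  have := H ((F + 1) / 2 / normc k ^+ 2); have [->|k0] := eqVneq (normc k ^+ 2) 0.
    by rewrite mulr_ge0.
  by rewrite G1 mulr0 addr0 -mulrA divfK//; lra.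
have Gp : 0 < G by rewrite lt_neqAle eq_sym G1.
have := H G^-1; rewrite -subr_ge0.
rewrite (_ : F - _ + _ = (F * G - normc k ^+ 2) / G); last by field.
by rewrite pmulr_lge0// invr_gt0.
Qed.

Section orthonormal.
Variables (I : choiceType) (e : I -> T -> R[i]).
Hypotheses (se : forall i, sqint (e i)).
Hypothesis oe : forall i j, cdot (e i) (e j) = (i == j)%:R.

(** Lists without repetition make [sqnorm_comb] applicable; [in_span_cons] merges a coefficient into
    an existing one when needed. *)
Definition in_span (v : T -> R[i]) : Prop := exists (s : seq I) (a : I -> R[i]),
  uniq s /\ v = fun x => \sum_(i <- s) a i * e i x.

Lemma in_span_cons c i v : in_span v -> in_span (fun x => c * e i x + v x).
Proof.
move=> [s [a [us ->]]]; have [si|si] := boolP (i \in s).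
  exists s, (fun j => (if j == i then c else 0) + a j); split=> //.
  apply/funext => x; under [RHS]eq_bigr do rewrite mulrDl.
  rewrite big_split /=; congr (_ + _); rewrite (bigD1_seq i)//= eqxx.
  by rewrite big1 ?addr0// => j /negPf ->; rewrite mul0r.
exists (i :: s), (fun j => if j == i then c else a j); split.
  by rewrite /= si.
apply/funext => x; rewrite big_cons eqxx; congr (_ + _).
by apply: eq_big_seq => j sj; case: eqP => // ji; rewrite -ji sj in si.
Qed.

Lemma in_span0 : in_span (fun=> 0).
Proof.
by exists [::], (fun=> 0); split=> //; apply/funext => x; rewrite big_nil.
Qed.

Lemma in_span_lin c u v : in_span u -> in_span v ->
  in_span (fun x => c * u x + v x).
Proof.
move=> [s [a [_ ->]]] sv.
under eq_fun do rewrite big_distrr.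
elim: s => [|i s IH].
  by rewrite (_ : (fun x => _) = v)//; apply/funext => x; rewrite big_nil add0r.
rewrite (_ : (fun x => _) = (fun x => (c * a i) * e i x +
    (\sum_(j <- s) c * (a j * e j x) + v x))); first exact: in_span_cons.
by apply/funext => x; rewrite big_cons /= mulrA addrA.
Qed.

Lemma in_span_sum (s : seq I) (a : I -> R[i]) :
  in_span (fun x => \sum_(i <- s) a i * e i x).
Proof.
elim: s => [|i s IH].
  by under eq_fun do rewrite big_nil; exact: in_span0.
by under eq_fun do rewrite big_cons; exact: in_span_cons.
Qed.

Lemma cdot_comb (s : seq I) (a : I -> R[i]) f : uniq s -> sqint f ->
  cdot f (fun x => \sum_(i <- s) a i * e i x) =
  \sum_(i <- s) (a i)^* * cdot f (e i).
Proof.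
move=> us sf.
have sv : sqint (fun x => \sum_(i <- s) a i * e i x).
  by apply: sqint_sum => i; exact: sqintZ.
rewrite (cdotC sv sf) cdot_suml// (big_morph _ (@conjcD R) (conjC0 _)).
by apply: eq_bigr => i _; rewrite conjcM -cdotC.
Qed.

Lemma sqnorm_comb (s : seq I) (a : I -> R[i]) : uniq s ->
  sqnorm (fun x => \sum_(i <- s) a i * e i x) = \sum_(i <- s) normc (a i) ^+ 2.
Proof.
move=> us; set v := fun x => _.
have sv : sqint v by apply: sqint_sum => i; exact: sqintZ.
suff : cdot v v = (\sum_(i <- s) normc (a i) ^+ 2)%:C.
  by rewrite cdot_self => -[].
rewrite {2}/v cdot_comb// raddf_sum; apply: eq_big_seq => i si.
rewrite /v cdot_suml// (bigD1_seq i)//= oe eqxx mulr1 big1 ?addr0.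
  by rewrite mulrC mulcJ.
by move=> j /negPf ji; rewrite oe ji mulr0.
Qed.

(** Completes the square in each coefficient: the choice [a i = cdot f (e i)] gives Bessel's
    inequality, and any other choice can only increase the distance. *)
Lemma sqnorm_sub_comb (s : seq I) (a : I -> R[i]) f : uniq s -> sqint f ->
  sqnorm (fun x => f x - \sum_(i <- s) a i * e i x) =
  sqnorm f - \sum_(i <- s) normc (cdot f (e i)) ^+ 2 +
  \sum_(i <- s) normc (cdot f (e i) - a i) ^+ 2.
Proof.
move=> us sf; rewrite sqnormB//; last first.
  by apply: sqint_sum => i; exact: sqintZ.
rewrite sqnorm_comb// cdot_comb// re_sum mulr_sumr -!addrA; congr (_ + _).
rewrite -!sumrN -!big_split /=; apply: eq_bigr => i _.
by rewrite sqr_normcB [_^* * _]mulrC !addrA addNr add0r.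
Qed.

Lemma bessel (s : seq I) f : uniq s -> sqint f ->
  \sum_(i <- s) normc (cdot f (e i)) ^+ 2 <= sqnorm f.
Proof.
move=> us sf.
have := sqnorm_ge0 (fun x => f x - \sum_(i <- s) cdot f (e i) * e i x).
rewrite sqnorm_sub_comb// [X in _ + X]big1 ?addr0 ?subr_ge0// => i _.
by rewrite subrr normc0 expr0n.
Qed.

Lemma bessel_approx f (eps : R) v : sqint f -> in_span v ->
  sqnorm (fun x => f x - v x) < eps -> exists s : seq I, uniq s /\
  sqnorm f - eps < \sum_(i <- s) normc (cdot f (e i)) ^+ 2.
Proof.
move=> sf [s [a [us ->]]]; rewrite sqnorm_sub_comb// => H; exists s; split=> //.
rewrite ltrBlDr -ltrBlDl (le_lt_trans _ H)// lerDl.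
by apply: sumr_ge0 => i _; exact: sqr_ge0.
Qed.

End orthonormal.

End square_integrable.

Section esum_seq.
Context (R : realType) (I : choiceType).
Implicit Type a : I -> \bar R.
Local Open Scope ereal_scope.

Lemma esum_le_seq a b : (forall s, uniq s -> \sum_(i <- s) a i <= b) ->
  \esum_(i in [set: I]) a i <= b.
Proof.
move=> H; apply: ge_ereal_sup => _ [A [finA _] <-].
by rewrite fsbig_finite//; apply: H; exact: finmap.fset_uniq.
Qed.

Lemma seq_le_esum a (s : seq I) : (forall i, 0 <= a i) -> uniq s ->
  \sum_(i <- s) a i <= \esum_(i in [set: I]) a i.
Proof.
move=> a0 us; apply: esum_ge; exists [set` s].
  by split=> //; exact: finite_seq.
by rewrite fsbig_seq.
Qed.

End esum_seq.

Section parseval.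
Context d (T : measurableType d) (R : realType).
Variables (m : {measure set T -> \bar R}) (D : set T) (mD : measurable D).
Variables (I : choiceType) (e : I -> T -> R[i]).
Hypotheses (se : forall i, sqint m D (e i)).
Hypothesis oe : forall i j, cdot m D (e i) (e j) = (i == j)%:R.

(** An approximating [v] involves finitely many indices, and the coefficients of [f] at these
    already exhaust its norm up to [eps]; Bessel's inequality is the other half. *)
Lemma parseval f : sqint m D f ->
  (forall eps : R, 0 < eps -> exists2 v, in_span e v &
     sqnorm m D (fun x => f x - v x) < eps) ->
  (\esum_(i in [set: I]) (normc (cdot m D f (e i)) ^+ 2)%:E =
   \int[m]_(x in D) (normc (f x) ^+ 2)%:E)%E.
Proof.
move=> sf fe; rewrite sqnormE//; apply/eqP; rewrite eq_le; apply/andP; split.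
  apply: esum_le_seq => s us; rewrite sumEFin lee_fin.
  exact: (bessel mD se oe).
apply/lee_addgt0Pr => eps eps0; have [v sv fv] := fe _ eps0.
have [s [us]] := bessel_approx mD se oe sf sv fv.
rewrite ltrBlDr => /ltW; rewrite -lee_fin => /le_trans; apply.
rewrite EFinD leeD2r// -sumEFin; apply: seq_le_esum => // i.
by rewrite lee_fin sqr_ge0.
Qed.

End parseval.

(** * A monotone class theorem for bounded complex functions *)

Section functional_monotone_class.
Import HBNNSimple.
Context d (T : measurableType d) (R : realType).
Variable P : (T -> R[i]) -> Prop.
Hypothesis P1 : P (fun=> 1).
Hypothesis Plin : forall c f g, P f -> P g -> P (fun x => c * f x + g x).
Hypothesis Plim : forall (f : nat -> T -> R[i]) g (M : R),
  (forall n, cmeasurable setT (f n)) -> cmeasurable setT g ->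
  (forall n, P (f n)) -> (forall n x, normc (f n x) <= M) ->
  (forall x, normc (g x) <= M) ->
  (forall x, (fun n => normc (f n x - g x)) @ \oo --> 0) -> P g.

Lemma monotone_class_sum (I : Type) (s : seq I) (c : I -> R[i]) F :
  (forall i, P (F i)) -> P (fun x => \sum_(i <- s) c i * F i x).
Proof.
move=> PF; elim: s => [|i s IH].
  rewrite (_ : (fun x => _) = fun x => (-1) * 1 + 1); first exact: Plin.
  by apply/funext => x; rewrite big_nil mulr1 addNr.
by under eq_fun do rewrite big_cons; exact: Plin.
Qed.

(** Simple functions increase to [h], stay in [[0, M]], and are finite combinations of
    indicators. *)
Lemma monotone_class_real (h : T -> R) (M : R) : measurable_fun setT h ->
  (forall x, 0 <= h x <= M) ->
  (forall A, measurable A -> P (fun x => (\1_A x)%:C)) ->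
  P (fun x => (h x)%:C).
Proof.
move=> mh hM Pi; have mh' : measurable_fun setT (EFin \o h) by exact/measurable_EFinP.
have h0 x : setT x -> (0 <= (EFin \o h) x)%E by move=> _; rewrite lee_fin; case/andP: (hM x).
pose s := nnsfun_approx measurableT mh'.
apply: (@Plim (fun n x => (s n x)%:C) _ M).
- by move=> n; exact: cmeasurable_real.
- exact: cmeasurable_real.
- move=> n; rewrite (_ : (fun x => _) = (fun x =>
      \sum_(r <- finmap.enum_fset (fset_set (range (s n)))) r%:C * (\1_(s n @^-1` [set r]) x)%:C)).
    by apply: monotone_class_sum => r; apply: Pi.
  apply/funext => x; rewrite {1}(fimfunE (s n) x) fsbig_finite//= rmorph_sum.
  by apply: eq_bigr => r _; rewrite rmorphM.
- move=> n x; rewrite normc_real ger0_norm ?fun_ge0//.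
  have [_ hx] := andP (hM x); apply: le_trans hx.
  by rewrite -lee_fin /s nnsfun_approxE; exact: le_approx.
- by move=> x; have /andP[h0x hx] := hM x; rewrite normc_real ger0_norm.
- move=> x; under eq_fun do rewrite normc_realB.
  have /fine_cvgP[_ sh] := cvg_nnsfun_approx measurableT mh' h0 (x := x) I.
  rewrite -(normr0 R) -(subrr (h x)); apply: cvg_norm; apply: cvgB => //.
  exact: cvg_cst.
Qed.

(** Dynkin's theorem gives the indicators, simple functions then the bounded nonnegative functions,
    a shift by [M] the real ones, and real and imaginary parts the complex ones. *)
Lemma monotone_class (G : set (set T)) f (M : R) :
  @measurable _ T = <<s G >> -> setI_closed G ->
  (forall A, G A -> P (fun x => (\1_A x)%:C)) ->
  cmeasurable setT f -> (forall x, normc (f x) <= M) -> P f.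
Proof.
move=> GE GI PG [mf1 mf2] fM.
have P0 : P (fun=> 0).
  rewrite (_ : (fun=> 0) = fun x : T => (-1) * 1 + 1); first exact: Plin.
  by apply/funext => x; rewrite mulr1 addNr.
have PZ c g : P g -> P (fun x => c * g x).
  move=> Pg; rewrite (_ : (fun x => _) = fun x => c * g x + 0); first exact: Plin.
  by apply/funext => x; rewrite addr0.
have Pind A : measurable A -> P (fun x => (\1_A x)%:C).
  move=> mA; apply: (dynkin_induction (P := fun A => P (fun x => (\1_A x)%:C)) GE GI).
  - by rewrite (_ : (fun x => _) = fun=> 1)//; apply/funext => x; rewrite indicT.
  - exact: PG.
  - move=> S _ PS; rewrite (_ : (fun x => _) = fun x => (-1) * (\1_S x)%:C + 1).
      exact: Plin.
    apply/funext => x; rewrite !indicE in_setC.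
    by case: (x \in S) => /=; rewrite ?mulr1 ?mulr0 ?addNr ?add0r.
  - move=> F mF tF PF.
    have bU n x : (\big[setU/set0]_(i < n) F i) x <-> exists2 i, (i < n)%N & F i x.
      by rewrite -bigcup_mkord.
    apply: (@Plim (fun n x => (\1_(\big[setU/set0]_(i < n) F i) x)%:C) _ 1).
    + by move=> n; apply: cmeasurable_real; apply: measurable_indic; exact: bigsetU_measurable.
    + by apply: cmeasurable_real; apply: measurable_indic; exact: bigcup_measurable.
    + elim=> [|n IH].
        by rewrite (_ : (fun x => _) = fun=> 0)//; apply/funext => x; rewrite big_ord0 indic0.
      (* Disjointness turns the union with [F n] into a sum of indicators. *)
      rewrite (_ : (fun x => _) = fun x =>
          1 * (\1_(\big[setU/set0]_(i < n) F i) x)%:C + (\1_(F n) x)%:C).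
        exact: Plin.
      apply/funext => x; rewrite big_ord_recr /= mul1r -rmorphD; congr _%:C.
      rewrite !indicE in_setU; case: (boolP (x \in F n)) => [xn|_]; last first.
        by rewrite orbF addr0.
      rewrite orbT; case: (boolP (x \in _)) => [|_]; last by rewrite add0r.
      rewrite inE => /bU[i iN Fi]; move: (tF i n I I) => E.
      have := E (ex_intro _ x (conj Fi (set_mem xn))); lia.
    + by move=> n x; rewrite normc_real indicE; case: (_ \in _); rewrite ?normr1 ?normr0.
    + by move=> x; rewrite normc_real indicE; case: (_ \in _); rewrite ?normr1 ?normr0.
    (* At each point the indicators of the partial unions are eventually constant. *)
    + move=> x; apply: cvg_near_cst.
      have [[k _ kx]|nx] := pselect ((\bigcup_k F k) x).
        exists k.+1 => // n kn; rewrite normc_realB !indicE !mem_set; last 2 first.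
        - by exists k.
        - by apply/bU; exists k.
        by rewrite subrr normr0.
      exists 0%N => // n _; rewrite normc_realB !indicE !memNset; last 2 first.
      - by [].
      - by move=> /bU[k _ kx]; apply: nx; exists k.
      by rewrite subrr normr0.
  - by rewrite -GE.
have Pre (h : T -> R) : measurable_fun setT h -> (forall x, `|h x| <= M) ->
    P (fun x => (h x)%:C).
  move=> mh hM.
  rewrite (_ : (fun x => _) = (fun x => (-1) * (M%:C * 1) + (h x + M)%:C)).
    apply: Plin; first exact: PZ.
    apply: (@monotone_class_real _ (M + M)) => //; first exact: measurable_funD.
    by move=> x; have := hM x; rewrite ler_norml => /andP[]; lra.
  by apply/funext => x; rewrite rmorphD mulr1 mulN1r addrC addrK.
rewrite (_ : f = fun x => (0 +i* 1) * (complex.Im (f x))%:C + (complex.Re (f x))%:C).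
  apply: Plin; apply: Pre => // x.
    by rewrite (le_trans (ler_norm_Im _)).
  by rewrite (le_trans (ler_norm_Re _)).
by apply/funext => x; apply: complex_eq; rewrite !reim /=; ring.
Qed.

End functional_monotone_class.

(** * The waves [z^(h_w(y))] *)

Section waves.
Variables (R : realType) (q : nat) (q2 : (2 <= q)%N).
Implicit Types (s h : R) (n : nat).

Lemma cexpD (a b : R[i]) : cexp (a + b) = cexp a * cexp b.
Proof.
rewrite /cexp !reim expRD cosD sinD rmorphM.
by apply: complex_eq; rewrite !reim /=; ring.
Qed.

Lemma conj_cexp (a : R[i]) : (cexp a)^* = cexp a^*.
Proof.
rewrite /cexp reJ imJ cosN sinN.
by apply: complex_eq; rewrite !reim /=; ring.
Qed.

Lemma normc_cexp (a : R[i]) : normc (cexp a) = expR (complex.Re a).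
Proof.
rewrite /cexp normcM normc_real ger0_norm ?expR_ge0//=.
by rewrite cos2Dsin2 sqrtr1 mulr1.
Qed.

(** [z^h] for [z = q^(1/2 + i s)]; in particular [wave s 1] is [z]. *)
Definition wave s h : R[i] := qpow q ((2^-1 +i* s) * h%:C).

Lemma waveE s h : wave s h = cexp ((ln q%:R * h / 2) +i* (ln q%:R * s * h)).
Proof.
by congr cexp; apply: complex_eq; rewrite !reim /=; ring.
Qed.

Lemma waveD s h k : wave s (h + k) = wave s h * wave s k.
Proof.
by rewrite /wave /qpow -cexpD -mulrDr -mulrDr rmorphD.
Qed.

Lemma wave0 s : wave s 0 = 1.
Proof.
rewrite waveE !mulr0 mul0r /cexp /= expR0 cos0 sin0.
by apply: complex_eq; rewrite !reim /=; ring.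
Qed.

Lemma normc_wave s h : normc (wave s h) = expR (ln q%:R * h / 2).
Proof. by rewrite waveE normc_cexp. Qed.

Lemma wave_neq0 s h : wave s h != 0.
Proof.
apply/eqP => E; have := normc_wave s h; rewrite E normc0.
by move=> /esym/eqP; rewrite expR_eq0.
Qed.

Lemma waveN s h : wave s (- h) = (wave s h)^-1.
Proof.
by apply: (mulfI (wave_neq0 s h)); rewrite -waveD subrr wave0 divff// wave_neq0.
Qed.

Lemma wave_nat s n : wave s n%:R = wave s 1 ^+ n.
Proof.
elim: n => [|n IH]; first by rewrite wave0 expr0.
by rewrite -natr1 waveD IH exprSr.
Qed.

Let q0 : 0 < q%:R :> R. Proof. by rewrite ltr0n; lia. Qed.

Lemma lnq_gt0 : 0 < ln q%:R :> R.
Proof. by rewrite ln_gt0// ltr1n. Qed.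

(** So the conjugate of [z] is [q / z], and every expression in [z] and its conjugate becomes a
    rational function of [z], within reach of [field]. *)
Lemma wave1J s : wave s 1 * (wave s 1)^* = q%:R.
Proof.
rewrite mulcJ normc_wave mulr1 -expRM_natl -[RHS](rmorph_nat (real_complex R)).
by congr (_ %:C); rewrite mulr_natl -mulr_natr divfK ?pnatr_eq0// lnK// posrE.
Qed.

Lemma wave_ge0_bound s h (M : R) : `|h| <= M ->
  normc (wave s h) <= expR (ln q%:R * M / 2).
Proof.
move=> hM; rewrite normc_wave ler_expR ler_pM2r// ler_pM2l ?lnq_gt0//.
exact: le_trans (ler_norm _) hM.
Qed.

End waves.

Section boundary_waves.
Variables (R : realType) (q : nat) (X : homogeneous_tree q).
Local Notation lvl := (dist (@Defs.root q X)).

Lemma parent_exists (y : X) : y != Defs.root ->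
  exists2 p, adj y p & lvl y = (lvl p).+1.
Proof. exact: closer_exists. Qed.

Lemma measurable_shadow (y : X) : measurable (shadow y : set (boundary X)).
Proof. by apply: sub_sigma_algebra; exists y. Qed.

(** Induction along the parents: on the shadow of [y] the height is the level of [y], off it that of
    the parent minus 1. *)
Lemma measurable_height (y : X) :
  measurable_fun [set: boundary X] (fun w : boundary X => height R w y).
Proof.
have [n] := ubnP (lvl y); elim: n y => // n IH y yn.
have [->|y0] := eqVneq y Defs.root.
  by rewrite (_ : (fun w => _) = cst 0)//; apply/funext => w; rewrite height_root.
have [p yp yE] := parent_exists y0.
rewrite (_ : (fun w => _) = fun w => (\1_(shadow y) w) *
    ((lvl y)%:R - (height R w p - 1)) + (height R w p - 1)).
  have mp : measurable_fun [set: boundary X] (fun w : boundary X => height R w p).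
    by apply: IH; lia.
  apply: measurable_funD; last by apply: measurable_funB.
  apply: measurable_funM; first by apply: measurable_indic; exact: measurable_shadow.
  by apply: measurable_funB => //; apply: measurable_funB.
apply/funext => w; rewrite indicE.
have [yw|yw] := pselect (shadow y w).
  by rewrite mem_set// mul1r subrK height_shadow.
by rewrite memNset// mul0r add0r (height_parent _ yp).
Qed.

Definition bwave (y : X) (p : boundary X * measurableTypeR R) : R[i] :=
  wave q p.2 (height R p.1 y).

Lemma normc_bwave (y : X) p : normc (bwave y p) <= expR (ln q%:R * (lvl y)%:R / 2).
Proof. by apply: wave_ge0_bound; [exact: branching_ge2 X|exact: height_bound]. Qed.

Lemma cmeasurable_wave d (T : measurableType d) (f g : T -> R) D :
  measurable_fun D f -> measurable_fun D g ->
  cmeasurable D (fun x => wave q (f x) (g x)).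
Proof.
move=> mf mg; under eq_fun do rewrite waveE.
apply: cmeasurableM.
  apply: cmeasurable_real; apply: measurableT_comp => //=.
  by apply: measurable_funM => //; exact: measurable_funM.
split=> /=; apply: measurableT_comp.
- exact: (continuous_measurable_fun (@continuous_cos R)).
- by apply: measurable_funM => //; exact: measurable_funM.
- exact: (continuous_measurable_fun (@continuous_sin R)).
- by apply: measurable_funM => //; exact: measurable_funM.
Qed.

Lemma cmeasurable_bwave (y : X) : cmeasurable setT (bwave y).
Proof.
apply: cmeasurable_wave; first exact: measurable_snd.
exact: (measurableT_comp (measurable_height y) measurable_fst).
Qed.

Lemma bwave_root p : bwave Defs.root p = 1.
Proof. by rewrite /bwave height_root wave0. Qed.

End boundary_waves.

Section finite_measure_integrable.
Context d (T : measurableType d) (R : realType).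
Variables (m : {finite_measure set T -> \bar R}) (D : set T).

Lemma cintegrable_finite (f : T -> R[i]) (M : R) : measurable D ->
  cmeasurable D f -> (forall x, D x -> normc (f x) <= M) -> cintegrable m D f.
Proof.
move=> mD mf fM; apply: (cintegrable_le mD (g := fun=> M)) => //.
exact: finite_measure_integrable_cst.
Qed.

Lemma sqint_finite (f : T -> R[i]) (M : R) : measurable D ->
  cmeasurable D f -> (forall x, D x -> normc (f x) <= M) -> sqint m D f.
Proof.
move=> mD mf fM; apply: (sqint_le mD (g := fun=> M ^+ 2)) => //.
  exact: finite_measure_integrable_cst.
by move=> x Dx; rewrite lerXn2r// ?nnegrE ?normc_ge0 ?fM// (le_trans _ (fM x Dx))// normc_ge0.
Qed.

End finite_measure_integrable.

(** * Inner products over the boundary for a fixed spectral parameter *)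

Section fibre_product.
Variables (R : realType) (q : nat) (X : homogeneous_tree q).
Variable nu : probability (boundary X) R.
Hypothesis Hnu : is_boundary_measure nu.
Local Notation lvl := (dist (@Defs.root q X)).
Implicit Types (x y : X) (s : R).

Let q2 := branching_ge2 X.

Definition fibre_dot s y y' : R[i] := cintegral nu setT
  (fun w => bwave y (w, s) * (bwave y' (w, s))^*).

Lemma cmeasurable_bwave_fibre s y :
  cmeasurable [set: boundary X] (fun w => bwave y (w, s)).
Proof.
by apply: (cmeasurable_wave q (f := fun=> s) (g := fun w => height R w y));
  [exact: measurable_cst|exact: measurable_height].
Qed.

Lemma cintegrable_bwave_fibre s y y' : cintegrable nu setT
  (fun w => bwave y (w, s) * (bwave y' (w, s))^*).
Proof.
apply: (@cintegrable_finite _ _ _ nu _ _ (expR (ln q%:R * (lvl y)%:R / 2) *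
  expR (ln q%:R * (lvl y')%:R / 2))) => //.
  apply: cmeasurableM; first exact: cmeasurable_bwave_fibre.
  exact/cmeasurableJ/cmeasurable_bwave_fibre.
move=> w _; rewrite normcM normc_conj.
by apply: ler_pM; rewrite ?normc_ge0 ?normc_bwave.
Qed.

Lemma fibre_dotC s y y' : fibre_dot s y y' = (fibre_dot s y' y)^*.
Proof.
rewrite /fibre_dot -cintegralJ//; last exact: cintegrable_bwave_fibre.
by apply: eq_cintegral => w _; rewrite conjcM conjcI mulrC.
Qed.

Lemma fibre_dot_root s : fibre_dot s Defs.root Defs.root = 1.
Proof.
rewrite /fibre_dot (_ : (fun w => _) = fun w => 1%:C).
  rewrite cintegral_real// Rintegral_cst// mul1r.
  by have /= -> := probability_setT nu.
by apply/funext => w; rewrite !bwave_root conjC1 mulr1.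
Qed.

(** Off the shadow of [y'] the wave of [y'] is [z^-1] times that of its parent; on the shadow the
    product with the wave of [y] is constant, because the ray has left [y] behind or [y = y']. The
    factor [z / q] is the inverse of the conjugate of [z]. *)
Lemma fibre_dot_step s y y' p' : adj y' p' -> lvl y' = (lvl p').+1 ->
  y = y' \/ dist y y' = (dist y p').+1 ->
  fibre_dot s y y' = wave q s 1 / q%:R * fibre_dot s y p' +
    (q%:R - wave q s 1 ^+ 2 / q%:R) / q.+1%:R * wave q s 1 ^- dist y y'.
Proof.
move=> yp' y'E H; set z := wave q s 1; set m := lvl y'; set d := dist y y'.
have z0 : z != 0 by exact: wave_neq0.
have q0 : q%:R != 0 :> R[i] by rewrite pnatr_eq0; lia.
have zJ : z^* = q%:R / z by rewrite -(wave1J q2 s) mulrC mulKf.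
have hy w : shadow y' w -> height R w y = m%:R - d%:R.
  move=> yw; case: H => [E|far]; last exact: height_beyond far.
  by rewrite /m /d E distxx subr0 height_shadow.
(* The defect on the shadow: the product of the waves there is [z^(m - d)] times the conjugate of
   [z^m], and the term with the parent is [z^2 / q^2] times that. *)
pose K : R[i] := z ^+ m * z ^- d * (z^* ^+ m * (1 - z ^+ 2 / q%:R ^+ 2)).
have E w : bwave y (w, s) * (bwave y' (w, s))^* =
  z / q%:R * (bwave y (w, s) * (bwave p' (w, s))^*) + K * (\1_(shadow y') w)%:C.
  rewrite indicE; have [yw|yw] := pselect (shadow y' w).
    have pw : height R w p' = m%:R - 1.
      rewrite (@height_beyond _ _ _ w p' y' p')// ?distxx ?(distC p')//.
        by rewrite (dist_adj yp').
      by rewrite (dist_adj yp').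
    rewrite mem_set// /bwave /= hy// pw height_shadow// -/m.
    rewrite !waveD !waveN !wave_nat -/z mulr1 !conjcM !rmorphXn /= fmorphV /= zJ.
    by rewrite /K zJ; field; rewrite z0 q0 expf_neq0.
  rewrite memNset// mulr0 addr0 /bwave /= (height_parent _ yp')// waveD waveN -/z.
  by rewrite conjcM fmorphV /= zJ invf_div; ring.
rewrite /fibre_dot (funext E).
have mE := measurable_shadow y'.
have iE : cintegrable nu setT (fun w => (\1_(shadow y') w)%:C).
  apply: (@cintegrable_finite _ _ _ nu _ _ 1) => //.
    by apply: cmeasurable_real; exact: measurable_indic.
  by move=> w _; rewrite normc_real indicE ger0_norm// lern1 leq_b1.
rewrite cintegralD//; last 2 first.
- exact/cintegrableZ/cintegrable_bwave_fibre.
- exact: cintegrableZ.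
rewrite cintegralZ//; last exact: cintegrable_bwave_fibre.
congr (_ + _); rewrite cintegralZ// cintegral_real//.
have -> : \int[nu]_(w in setT) \1_(shadow y') w = q%:R / (q.+1%:R * q%:R ^+ m).
  have y'0 : y' != Defs.root by apply/eqP => yr; rewrite yr distxx in y'E.
  by rewrite /Rintegral integral_indic// setIT; have /= -> := Hnu y'0.
rewrite /K zJ !rmorphM fmorphV !rmorphM !rmorphXn !rmorph_nat.
rewrite expr_div_n; have := expf_neq0 m z0; have := expf_neq0 d z0.
have := expf_neq0 m q0; move: (z ^+ m) (z ^+ d) (q%:R ^+ m) => a b c c0 b0 a0.
have q10 : q.+1%:R != 0 :> R[i] by rewrite pnatr_eq0.
by rewrite -natr1 in q10 *; field; rewrite a0 b0 c0 q0 q10.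
Qed.

(** The solution with value 1 at 0 of the recursion in [fibre_dot_step] along a growing distance:
    [z^-n] is a particular and [(z / q)^n] the homogeneous solution. They coincide when [z^2 = q],
    hence the denominator. *)
Definition spherical s n : R[i] :=
  let z := wave q s 1 in let Q := q%:R : R[i] in
  (Q ^+ 2 - z ^+ 2) / (q.+1%:R * (Q - z ^+ 2)) * z ^- n +
  Q * (1 - z ^+ 2) / (q.+1%:R * (Q - z ^+ 2)) * (z / Q) ^+ n.

Lemma spherical0 s : wave q s 1 ^+ 2 != q%:R -> spherical s 0 = 1.
Proof.
move=> zq; rewrite /spherical !expr0 invr1 !mulr1.
have q10 : q.+1%:R != 0 :> R[i] by rewrite pnatr_eq0.
rewrite -natr1 in q10 *.
by field; rewrite q10 subr_eq0 eq_sym zq.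
Qed.

Lemma sphericalS s n : wave q s 1 ^+ 2 != q%:R ->
  spherical s n.+1 = wave q s 1 / q%:R * spherical s n +
    (q%:R - wave q s 1 ^+ 2 / q%:R) / q.+1%:R * wave q s 1 ^- n.+1.
Proof.
move=> zq; rewrite /spherical.
have q10 : q.+1%:R != 0 :> R[i] by rewrite pnatr_eq0.
have q0 : q%:R != 0 :> R[i] by rewrite pnatr_eq0; lia.
have := wave_neq0 q s 1; set z := wave q s 1 in zq * => z0.
rewrite -natr1 in q10 *; rewrite !expr_div_n !(exprS _ n).
have := expf_neq0 n z0; have := expf_neq0 n q0.
move: (z ^+ n) (q%:R ^+ n) => a c c0 a0.
have zq' : q%:R - z ^+ 2 != 0 by rewrite subr_eq0 eq_sym.
by field; rewrite q10 zq' a0 c0 q0 z0.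
Qed.

(** Conjugation replaces [z] by [q / z] and interchanges the two terms. *)
Lemma sphericalJ s n : wave q s 1 ^+ 2 != q%:R ->
  (spherical s n)^* = spherical s n.
Proof.
move=> zq; rewrite /spherical.
have q10 : q.+1%:R != 0 :> R[i] by rewrite pnatr_eq0.
have q0 : q%:R != 0 :> R[i] by rewrite pnatr_eq0; lia.
have := wave_neq0 q s 1; have := wave1J q2 s.
move: (wave q s 1) zq => z zq zz z0.
have zJ : z^* = q%:R / z by rewrite -zz mulrC mulKf.
rewrite !(rmorphD, rmorphN, rmorphM, fmorphV, rmorphXn, rmorph_nat, rmorph1) /=.
rewrite zJ -natr1 in q10 *; rewrite !expr_div_n.
have := expf_neq0 n z0; have := expf_neq0 n q0.
move: (z ^+ n) (q%:R ^+ n) => a c c0 a0.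
have zq' : q%:R - z ^+ 2 != 0 by rewrite subr_eq0 eq_sym.
have zq2 : q%:R * z ^+ 2 - q%:R ^+ 2 != 0.
  by rewrite expr2 -mulrBr mulf_neq0// subr_eq0.
by field; rewrite q10 zq' a0 c0 z0 /= ?andbT -!expr2.
Qed.

(** Of two distinct vertices, at least one has its parent on the geodesic to the other; the
    recursion is applied to that one, after a conjugation if it is the first argument. For [y = y']
    one step leads to distance 1 but still lowers the sum of the levels. *)
Lemma fibre_dotE s y y' : wave q s 1 ^+ 2 != q%:R ->
  fibre_dot s y y' = spherical s (dist y y').
Proof.
move=> zq; have [k] := ubnP (lvl y + lvl y')%N.
elim: k y y' => // k IH.
have step y y' p' : adj y' p' -> lvl y' = (lvl p').+1 ->
    dist y y' = (dist y p').+1 -> (lvl y + lvl y' < k.+1)%N ->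
    fibre_dot s y y' = spherical s (dist y y').
  move=> yp' y'E far yk.
  rewrite (fibre_dot_step s yp' y'E (or_intror far)) far sphericalS// IH//; lia.
move=> y y' yk; have [E|yy'] := eqVneq y y'.
  rewrite -{}E in yk *; have [->|y0] := eqVneq y Defs.root.
    by rewrite fibre_dot_root distxx spherical0.
  have [p yp yE] := parent_exists y0.
  rewrite (fibre_dot_step s yp yE (or_introl erefl)) IH; last lia.
  rewrite distxx (dist_adj yp) sphericalS// spherical0// expr1 invr1 mulr1.
  have q10 : q.+1%:R != 0 :> R[i] by rewrite pnatr_eq0.
  have q0 : q%:R != 0 :> R[i] by rewrite pnatr_eq0; lia.
  have z0 := wave_neq0 q s 1.
  by rewrite -natr1 in q10 *; field; rewrite q10 q0 z0.
(* If no parent of [x] is nearer to [x'], then [x] lies between the root and [x'], which cannot hold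
   in both directions. *)
have far_parent x x' : x' != x -> ~ (lvl x' = lvl x + dist x x')%N ->
    exists p, [/\ adj x p, lvl x = (lvl p).+1 & dist x' x = (dist x' p).+1].
  move=> x'x nb; apply: contrapT => np; apply: nb.
  rewrite (distC x x'); apply: dist_between => p xp pE.
  by case: (dist_adj_or x' xp) => // close; case: np; exists p.
have [E|nE] := pselect (lvl y = lvl y' + dist y' y)%N; last first.
  have [p [yp pE far]] := far_parent y' y yy' nE.
  by apply: (step _ _ p).
have nE' : ~ (lvl y' = lvl y + dist y y')%N.
  move=> E'; have : dist y y' = 0%N by rewrite (distC y' y) in E; lia.
  by move=> /dist_eq0 yy; rewrite yy eqxx in yy'.
have [p [yp pE far]] := far_parent y y' ltac:(by rewrite eq_sym) nE'.
rewrite fibre_dotC (step _ _ p)//; last by rewrite addnC.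
by rewrite sphericalJ// distC.
Qed.

End fibre_product.

(** * Orthonormality of the waves *)

Section complex_inverse_measurable.
Context d (T : measurableType d) (R : realType) (D : set T).

(** The inverse is the conjugate over the squared norm; at a zero of [f] both are 0 by
    convention. *)
Lemma cmeasurableV (f : T -> R[i]) : cmeasurable D f ->
  cmeasurable D (fun x => (f x)^-1).
Proof.
move=> mf.
rewrite (_ : (fun x => _) = fun x =>
  (f x)^* * ((normc (f x) ^+ 2) `^ (-1))%:C).
  apply: cmeasurableM; first exact: cmeasurableJ.
  apply: cmeasurable_real; apply: (measurableT_comp (measurable_powR _)).
  exact: measurable_sqr_normc.
apply/funext => x; rewrite powR_inv1 ?sqr_ge0//.
rewrite [(_^-1)%:C](fmorphV (real_complex R)) /= -mulcJ.
have [->|f0] := eqVneq (f x) 0; first by rewrite conjC0 mul0r invr0.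
have f0' : (f x)^* != 0 by rewrite conjC_eq0.
by rewrite invfM mulrCA divff// mulr1.
Qed.

Lemma cmeasurableX (f : T -> R[i]) n : cmeasurable D f ->
  cmeasurable D (fun x => f x ^+ n).
Proof.
move=> mf; elim: n => [|n IH].
  by under eq_fun do rewrite expr0; exact: cmeasurable_cst.
by under eq_fun do rewrite exprS; exact: cmeasurableM.
Qed.

End complex_inverse_measurable.

(** The algebra of [spherical_density] in free variables: [r] is the square root of [q], [w] is
    [q^(i s)], [a] and [b] are the [n]-th powers of [w] and [r], and [c] is the Plancherel
    constant. *)
Lemma spherical_identity (F : numFieldType) (r w c a b : F) :
  r != 0 -> w != 0 -> a != 0 -> b != 0 -> 1 - w ^+ 2 != 0 ->
  r ^+ 2 + 1 != 0 -> r ^+ 2 - w ^+ 2 != 0 -> r ^+ 2 * w ^+ 2 - 1 != 0 ->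
  ((r ^+ 2 ^+ 2 - r ^+ 2 * w ^+ 2) /
   ((r ^+ 2 + 1) * (r ^+ 2 - r ^+ 2 * w ^+ 2)) / (b * a) +
   r ^+ 2 * (1 - r ^+ 2 * w ^+ 2) /
   ((r ^+ 2 + 1) * (r ^+ 2 - r ^+ 2 * w ^+ 2)) *
   (b * a / b ^+ 2)) *
  (c /
   (r / (r ^+ 2 + 1) * ((r * w - (r * w)^-1) / (w - w^-1)) *
    (r / (r ^+ 2 + 1) * ((r / w - (r / w)^-1) / (w^-1 - w))))) =
  2 * c * (r ^+ 2 + 1) / b *
  (2^-1 *
   (a * (1 - w ^+ 2) / (r ^+ 2 - w ^+ 2) +
    a^-1 * (1 - w ^- 2) / (r ^+ 2 - w ^- 2))).
Proof.
move=> r0 w0 a0 b0 w1 q1 qw qw'.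
have w2 : w * w - 1 != 0 by rewrite -opprB oppr_eq0.
have rw : r ^+ 2 - (r * w) ^+ 2 != 0.
  by rewrite exprMn -[X in X - _]mulr1 -mulrBr mulf_neq0 ?expf_neq0.
by field; rewrite w0 a0 b0 r0 q1 qw w2 rw mulNr -expr2 w1 exprMn qw'.
Qed.

(** * Integrals against the Plancherel density *)

Section phase.
Variables (R : realType) (q : nat) (q2 : (2 <= q)%N).
Implicit Types (s : R) (n : nat).
Local Notation lnq := (ln q%:R : R).
Local Notation I := `[0, tau R q]%classic.

(** [q^(i s)], so that [z] is the square root of [q] times [phase s]. *)
Definition phase s : R[i] := cos (lnq * s) +i* sin (lnq * s).

Lemma phase_cexp s : phase s = cexp (0 +i* (lnq * s)).
Proof. by rewrite /cexp expR0; apply: complex_eq; rewrite !reim /=; ring. Qed.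

Lemma normc_phase s : normc (phase s) = 1.
Proof. by rewrite phase_cexp normc_cexp expR0. Qed.

Lemma phase_neq0 s : phase s != 0.
Proof.
by apply/eqP => E; have := normc_phase s; rewrite E normc0 => /esym/eqP; rewrite oner_eq0.
Qed.

Lemma phaseJ s : (phase s)^* = (phase s)^-1.
Proof.
apply: (mulfI (phase_neq0 s)); rewrite mulcJ normc_phase expr1n divff//.
exact: phase_neq0.
Qed.

Lemma Re_phaseX s n : complex.Re (phase s ^+ n) = cos (n%:R * lnq * s).
Proof.
suff -> : phase s ^+ n = cexp (0 +i* (n%:R * lnq * s)).
  by rewrite /cexp expR0 reM /= mul0r subr0 mul1r.
elim: n => [|n IH].
  rewrite expr0 !mul0r /cexp expR0 cos0 sin0.
  by apply: complex_eq; rewrite !reim /=; ring.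
rewrite exprS IH phase_cexp -cexpD; congr cexp; rewrite -natr1.
by apply: complex_eq; rewrite !reim /=; ring.
Qed.

Lemma cmeasurable_phase : cmeasurable [set: measurableTypeR R] phase.
Proof.
split=> /=; apply: measurableT_comp; try exact: measurable_funM.
- exact: (continuous_measurable_fun (@continuous_cos R)).
- exact: (continuous_measurable_fun (@continuous_sin R)).
Qed.

(** Each coefficient of [spherical] cancels one of the two [c]-factors of the density. The other
    factor leaves [(1 - u^2) / (q - u^2)] with [u = phase s], up to constants; its numerator
    produces the difference of two kernels in [spherical_density]. *)
Definition kern n s : R := complex.Re (phase s ^+ n / (q%:R - phase s ^+ 2)).

Lemma normc_natr n : normc (n%:R : R[i]) = n%:R.
Proof. by rewrite -(rmorph_nat (real_complex R)) normc_real ger0_norm. Qed.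

Lemma normcX (x : R[i]) n : normc (x ^+ n) = normc x ^+ n.
Proof. by elim: n => [|n IH]; rewrite ?expr0 ?normc1// !exprS normcM IH. Qed.

Lemma ge1_normc_sub_phase s : 1 <= normc (q%:R - phase s ^+ 2).
Proof.
have := le_normcD (q%:R - phase s ^+ 2) (phase s ^+ 2).
rewrite subrK normc_natr normcX normc_phase expr1n.
have : 2 <= q%:R :> R by rewrite ler_nat.
by move: (normc _) => a; lra.
Qed.

Lemma sub_phase_neq0 s : q%:R - phase s ^+ 2 != 0.
Proof.
apply/eqP => E; have := ge1_normc_sub_phase s.
by rewrite E normc0 ler10.
Qed.

Lemma kern_bound n s : `|kern n s| <= 1.
Proof.
apply: le_trans (ler_norm_Re _) _.
rewrite normcM normcV normcX normc_phase expr1n mul1r invf_le1//.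
  exact: ge1_normc_sub_phase.
exact: lt_le_trans (ge1_normc_sub_phase s).
Qed.

Lemma kern_rec n s : q%:R * kern n s - kern n.+2 s = cos (n%:R * lnq * s).
Proof.
have s0 := sub_phase_neq0 s.
have re_natM (x : R[i]) : q%:R * complex.Re x = complex.Re (q%:R * x).
  by rewrite -[X in _ = complex.Re (X * _)](rmorph_nat (real_complex R)) reM /= mul0r subr0.
rewrite -Re_phaseX /kern re_natM -reN -reD; congr complex.Re.
by rewrite !(exprS _ n.+1) (exprS _ n); field.
Qed.

Lemma measurable_kern n : measurable_fun [set: measurableTypeR R] (kern n).
Proof.
apply: (cmeasurableM (cmeasurableX n cmeasurable_phase) (cmeasurableV _)).1.
apply: cmeasurableB; first exact: cmeasurable_cst.
exact/cmeasurableX/cmeasurable_phase.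
Qed.

Lemma lebesgue_I : lebesgue_measure (I : set (measurableTypeR R)) = (tau R q)%:E.
Proof.
rewrite lebesgue_measure_itv /= lte_fin ifT ?oppr0 ?adde0//.
by rewrite divr_gt0 ?pi_gt0 ?lnq_gt0.
Qed.

Lemma integrable_bounded_I (f : measurableTypeR R -> R) (M : R) :
  measurable_fun setT f -> (forall s, `|f s| <= M) ->
  lebesgue_measure.-integrable I (EFin \o f).
Proof.
move=> mf fM; apply: measurable_bounded_integrable => //.
- by have /= -> := lebesgue_I; rewrite ltry.
- exact: measurable_funS mf.
- by exists M; split; [exact: num_real|move=> x Mx s _; exact: le_trans (fM s) (ltW Mx)].
Qed.

(** For [n > 0] the antiderivative vanishes at both ends, because [log q] times [tau] is [pi]. *)
Lemma Rintegral_cos n : \int[lebesgue_measure]_(s in I) cos (n%:R * lnq * s) =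
  if n == 0%N then tau R q else 0.
Proof.
have t0 : 0 < tau R q by rewrite divr_gt0 ?pi_gt0 ?lnq_gt0.
case: eqP => [->|/eqP n0].
  under eq_Rintegral do rewrite !mul0r cos0.
  by rewrite Rintegral_cst//; have /= -> := lebesgue_I; rewrite mul1r.
have a0 : n%:R * lnq != 0 by rewrite mulf_neq0 ?pnatr_eq0// gt_eqF ?lnq_gt0.
set a := n%:R * lnq in a0 *.
pose F := a^-1 \*: (@sin R \o (a \*: idfun)) : R -> R.
have dF s : is_derive s 1 F (cos (a * s)).
  have -> : cos (a * s) = a^-1 *: (cos (a *: s) * (a *: 1)).
    by rewrite /GRing.scale /= mulr1 mulrCA mulVf// mulr1.
  by apply: is_deriveZ; apply: is_derive1_comp; apply: is_deriveZ.
have cF : continuous F.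
  by move=> s; apply/differentiable_continuous/derivable1_diffP; case: (dF s).
rewrite /Rintegral (@continuous_FTC2 _ _ F)//.
- rewrite /F /= /GRing.scale /= mulr0 sin0 mulr0 oppr0 addr0.
  rewrite /a /tau -mulrA [lnq * _]mulrC divfK ?gt_eqF ?lnq_gt0//.
  suff -> : sin (n%:R * pi) = 0 :> R by rewrite mulr0.
  elim: (n) => [|k IH]; first by rewrite mul0r sin0.
  by rewrite -natr1 mulrDl mul1r sinDpi IH oppr0.
- apply: continuous_subspaceT => s.
  apply: continuous_comp; last exact: continuous_cos.
  by apply: cvgM; [exact: cvg_cst|exact: cvg_id].
- split; first by move=> s _; case: (dF s).
    by apply: cvg_at_right_filter; exact: cF.
  by apply: cvg_at_left_filter; exact: cF.
- by move=> s _; rewrite derive1E; case: (dF s).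
Qed.

Definition kernI n : R := \int[lebesgue_measure]_(s in I) kern n s.

Lemma kernI_rec n : q%:R * kernI n - kernI n.+2 = if n == 0%N then tau R q else 0.
Proof.
have iK k : lebesgue_measure.-integrable I (EFin \o (kern k : measurableTypeR R -> R)).
  exact: integrable_bounded_I (measurable_kern k) (kern_bound k).
rewrite -Rintegral_cos /kernI -RintegralZl// -RintegralB//.
  by apply: eq_Rintegral => s _; rewrite kern_rec.
by apply: eq_integrable (integrableZl _ q%:R (iK n)) => //.
Qed.

(** The recursion multiplies by [q] at each step of 2, while all these integrals are bounded by
    [tau]. *)
Lemma kernI0 n : (0 < n)%N -> kernI n = 0.
Proof.
move=> n0; have H k : kernI (n + k.*2) = q%:R ^+ k * kernI n.
  elim: k => [|k IH]; first by rewrite addn0 expr0 mul1r.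
  have := kernI_rec (n + k.*2); rewrite (_ : _ == _ = false); last by lia.
  by rewrite doubleS !addnS IH exprS; lra.
have B k : `|kernI k| <= tau R q.
  have iK := integrable_bounded_I (measurable_kern k) (kern_bound k).
  apply: le_trans (le_normr_Rintegral _ iK) _ => //.
  rewrite [leRHS](_ : tau R q = \int[lebesgue_measure]_(s in I) 1); last first.
    by rewrite Rintegral_cst//; have /= -> := lebesgue_I; rewrite mul1r.
  apply: le_Rintegral => //.
  - exact: integrable_norm.
  - by apply: (integrable_bounded_I (M := 1)) => // s; rewrite normr1.
  - by move=> s _; exact: kern_bound.
apply/eqP; apply: contraT => K0.
have Kp : 0 < `|kernI n| by rewrite normr_gt0.
have [k kK] : exists k : nat, tau R q / `|kernI n| < k%:R.
  by exists (Num.truncn (tau R q / `|kernI n|)).+1; exact: truncnS_gt.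
have := B (n + k.*2)%N; rewrite H normrM normrX ger0_norm// leNgt => /negP[].
rewrite -ltr_pdivrMr// (lt_trans kK)// -natrX ltr_nat.
by rewrite ltn_expl.
Qed.

Lemma kernI_diff n : kernI n - kernI n.+2 = if n == 0%N then tau R q / q%:R else 0.
Proof.
case: n => [|n]; last by rewrite !kernI0// subrr.
have := kernI_rec 0; rewrite (kernI0 (n := 2))// !subr0 /= => <-.
by rewrite mulrC mulKf// pnatr_eq0; lia.
Qed.

Lemma wave1_phase s : wave q s 1 = (expR (lnq / 2))%:C * phase s.
Proof.
rewrite waveE mulr1 phase_cexp /cexp !mulr1 expR0.
by apply: complex_eq; rewrite !reim /=; ring.
Qed.

Let q0 : q%:R != 0 :> R[i]. Proof. by rewrite pnatr_eq0; lia. Qed.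

Let r := (expR (lnq / 2))%:C : R[i].

Lemma sqrt_q : r ^+ 2 = q%:R.
Proof.
rewrite -rmorphXn /= -expRM_natl -[RHS](rmorph_nat (real_complex R)).
by congr (_ %:C); rewrite mulr_natl -mulr_natr divfK ?pnatr_eq0// lnK// posrE ltr0n; lia.
Qed.

Let r0 : r != 0.
Proof. by apply/eqP => r0; move: q0; rewrite -sqrt_q r0 expr0n eqxx. Qed.

Lemma cfun_phase s : cfun q s%:C =
  r / q.+1%:R * ((r * phase s - (r * phase s)^-1) / (phase s - (phase s)^-1)).
Proof.
have H : (2^-1 : R[i]) = (2^-1 : R)%:C by rewrite fmorphV rmorph_nat.
rewrite /cfun; congr (_ * ((_ - _) / (_ - _))).
- rewrite rmorphM fmorphV rmorph_nat; congr (_ / _).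
  have e0 : 0 <= expR (lnq / 2) by exact: expR_ge0.
  rewrite /r -[in RHS](ger0_norm e0) -sqrtr_sqr; congr (Num.sqrt _)%:C.
  by have := sqrt_q; rewrite /r -rmorphXn /= -(rmorph_nat (real_complex R)) => -[->].
- rewrite -wave1_phase /wave; congr qpow; rewrite H.
  by apply: complex_eq; rewrite !reim /=; ring.
- rewrite -wave1_phase -waveN /wave; congr qpow; rewrite H.
  by apply: complex_eq; rewrite !reim /=; ring.
- rewrite phase_cexp /qpow; congr cexp.
  by apply: complex_eq; rewrite !reim /=; ring.
- rewrite -phaseJ phase_cexp conj_cexp /qpow; congr cexp.
  by apply: complex_eq; rewrite !reim /=; ring.
Qed.

Lemma spherical_density s n :
  spherical q s n * (plancherel_density q s)%:C =
  (2 * cP R q * q.+1%:R * expR (lnq / 2) ^- n * (kern n s - kern n.+2 s))%:C.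
Proof.
set u := phase s ^+ n * (1 - phase s ^+ 2) / (q%:R - phase s ^+ 2).
have kE : (kern n s - kern n.+2 s)%:C = 2^-1 * (u + u^*).
  have -> : kern n s - kern n.+2 s = complex.Re u.
    rewrite /kern -reN -reD; congr complex.Re.
    by rewrite /u mulrBr mulr1 mulrBl -exprD addn2.
  by rewrite addcJ mulKf// pnatr_eq0.
pose K := cfun q s%:C.
have dE : (plancherel_density q s)%:C = (cP R q)%:C * (K * K^*)^-1.
  by rewrite mulcJ -[in RHS](fmorphV (real_complex R)) /= -rmorphM.
rewrite dE [RHS](_ : _ = 2 * (cP R q)%:C * q.+1%:R * r ^- n * (2^-1 * (u + u^*))); last first.
  have aux (a b k : R) : (2 * a * q.+1%:R / b ^+ n * k)%:C =
      2 * a%:C * q.+1%:R / b%:C ^+ n * k%:C.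
    by rewrite !rmorphM fmorphV rmorphXn !rmorph_nat.
  by rewrite aux kE.
move: (cP R q)%:C => c; have w0 := phase_neq0 s.
have rJ : r^* = r by exact: conjc_realC.
have KJ : K^* = r / q.+1%:R *
    ((r / phase s - (r / phase s)^-1) / ((phase s)^-1 - phase s)).
  rewrite /K cfun_phase.
  rewrite !(rmorphD, rmorphN, rmorphM, fmorphV, rmorphXn, rmorph_nat, rmorph1) /=.
  by rewrite rJ phaseJ !invrK.
have uJ : u^* = (phase s ^+ n)^-1 * (1 - phase s ^- 2) / (q%:R - phase s ^- 2).
  rewrite /u !(rmorphD, rmorphN, rmorphM, fmorphV, rmorphXn, rmorph_nat, rmorph1) /=.
  by rewrite phaseJ -!expr2 !exprVn.
have qw := sub_phase_neq0 s.
have qw' : q%:R * phase s ^+ 2 - 1 != 0.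
  have := qw; rewrite -conjC_eq0 rmorphB rmorph_nat rmorphXn /= phaseJ.
  by apply: contraNN => /eqP E; rewrite exprVn subr_eq0; apply/eqP;
    apply: (mulIf (expf_neq0 2 w0)); rewrite mulVf ?expf_neq0//; apply/eqP;
    rewrite -subr_eq0 E.
have q10 : q.+1%:R != 0 :> R[i] by rewrite pnatr_eq0.
(* Here [cfun] has denominator 0, so the density is 0 by convention, and [u] vanishes through its
   numerator. *)
have [w1|w1] := eqVneq (phase s ^+ 2) 1.
  have wV : (phase s)^-1 = phase s.
    by apply: (mulfI w0); rewrite divff// -expr2 w1.
  by rewrite /K /u cfun_phase wV subrr invr0 w1 subrr !(mulr0, mul0r, invr0, conjC0, addr0).
rewrite /K -/K KJ uJ /K cfun_phase /u /spherical wave1_phase -/r !expr_div_n !exprMn.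
have := expf_neq0 n w0; have := expf_neq0 n r0.
move: (phase s) w0 w1 qw qw' {uJ KJ u kE K dE} => w w0 w1 qw qw'.
rewrite -[q.+1%:R]natr1 in q10 *; rewrite -sqrt_q in q10 qw qw' *.
rewrite (exprAC r 2 n) => b0 a0; apply: spherical_identity => //.
by rewrite subr_eq0 eq_sym.
Qed.

Lemma plancherel_sub A : measurable A -> A `<=` I ->
  plancherel R q A = (\int[lebesgue_measure]_(s in A) (plancherel_density q s)%:E)%E.
Proof. by move=> mA AI; rewrite /plancherel setIidl. Qed.

Lemma plancherel_dominated : plancherel R q `<< @lebesgue_measure R.
Proof.
apply/null_content_dominatesP => A mA A0.
apply: null_set_integral.
- exact: measurableI.
- apply: measurable_funTS; apply/measurable_EFinP.
  exact: measurable_plancherel_density.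
- by apply/eqP; rewrite eq_le measure_ge0 andbT -A0 measureIl.
Qed.

(** The change of variables goes through the Radon-Nikodym derivative, which is identified with the
    density almost everywhere on [I] by comparing integrals over the measurable subsets of [I]. *)
Lemma integral_plancherel (f : measurableTypeR R -> R) :
  (plancherel R q).-integrable I (EFin \o f) ->
  (\int[plancherel R q]_(s in I) (f s)%:E =
   \int[lebesgue_measure]_(s in I) (f s * plancherel_density q s)%:E)%E.
Proof.
move=> fi; have mf := measurable_int _ fi.
rewrite -(Radon_Nikodym_change_of_variables plancherel_dominated)//=.
apply: ae_eq_integral => //.
- apply: emeasurable_funM => //; apply: (measurable_int lebesgue_measure).
  apply: (integrableS _ _ (@subsetT _ _)) => //=.
  by apply: Radon_Nikodym_integrable; exact: plancherel_dominated.
- apply: (eq_measurable_fun (fun s => ((f s)%:E * (plancherel_density q s)%:E)%E)) => [s _|].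
    by rewrite EFinM.
  apply: emeasurable_funM => //; apply: measurable_funTS; apply/measurable_EFinP.
  exact: measurable_plancherel_density.
- rewrite (_ : (fun s => (f s * _)%:E) =
    fun s => ((f s)%:E * (plancherel_density q s)%:E)%E); last first.
    by apply/funext => s; rewrite EFinM.
  apply: ae_eqe_mul2l => /=.
  rewrite Radon_NikodymE//=; first exact: plancherel_dominated.
  move=> abmu.
  case: cid => /= h [h1 h2 h3].
  apply: integral_ae_eq => //=.
  + exact: integrableS h2.
  + apply: measurable_funTS; apply/measurable_EFinP.
    exact: measurable_plancherel_density.
  + by move=> E EI mE; rewrite -h3//= plancherel_sub.
Qed.

(** Comparing [g] with [spherical] after multiplication by the density leaves [g] free where the
    density is 0, in particular where [z^2 = q]. *)
Lemma cintegral_spherical (g : measurableTypeR R -> R[i]) n :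
  cintegrable (plancherel R q) I g ->
  (forall s, g s * (plancherel_density q s)%:C =
     spherical q s n * (plancherel_density q s)%:C) ->
  cintegral (plancherel R q) I g = (n == 0%N)%:R.
Proof.
move=> gi gE.
have gE' s : g s * (plancherel_density q s)%:C =
    (2 * cP R q * q.+1%:R * expR (lnq / 2) ^- n * (kern n s - kern n.+2 s))%:C.
  by rewrite gE spherical_density.
have iK k : lebesgue_measure.-integrable I (EFin \o (kern k : measurableTypeR R -> R)).
  exact: integrable_bounded_I (measurable_kern k) (kern_bound k).
have gR s : complex.Re (g s) * plancherel_density q s =
    2 * cP R q * q.+1%:R * expR (lnq / 2) ^- n * (kern n s - kern n.+2 s).
  have : complex.Re (g s * (plancherel_density q s)%:C) =
    complex.Re (g s) * plancherel_density q s by rewrite reM /= mulr0 subr0.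
  by rewrite gE' => <-.
have gI s : complex.Im (g s) * plancherel_density q s = 0.
  have : complex.Im (g s * (plancherel_density q s)%:C) =
    complex.Im (g s) * plancherel_density q s by rewrite imM /= mulr0 add0r.
  by rewrite gE' => <-.
apply: complex_eq.
  rewrite /= /Rintegral integral_plancherel; last exact: cintegrable_Re.
  under eq_integral do rewrite gR.
  rewrite -/(Rintegral _ _ _) RintegralZl//; last first.
    by apply: eq_integrable (integrableB _ (iK n) (iK n.+2)) => // s _.
  rewrite RintegralB// -/(kernI n) -/(kernI n.+2) kernI_diff.
  case: eqP => [->|_]; last by rewrite mulr0.
  (* The constants combine to [2 cP (q + 1) tau / q = 1], which is what the normalisation [cP] is
     made for. *)
  rewrite expr0 invr1 mulr1 /cP /tau /=.
  have l0 : lnq != 0 by rewrite gt_eqF ?lnq_gt0.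
  have p0 : pi != 0 :> R by rewrite gt_eqF ?pi_gt0.
  have n0 : q%:R != 0 :> R by rewrite pnatr_eq0; lia.
  have n1 : q.+1%:R != 0 :> R by rewrite pnatr_eq0.
  rewrite -natr1 in n1 *; move: (pi : R) p0 (ln q%:R : R) l0 => P p0 L l0.
  by field; rewrite l0 p0 n0 n1.
rewrite /= /Rintegral integral_plancherel; last exact: cintegrable_Im.
under eq_integral do rewrite gI.
by rewrite integral0 /=; case: eqP.
Qed.

End phase.

(** * Orthogonality relations on the product space *)

Section orthonormal_waves.
Variables (R : realType) (q : nat) (X : homogeneous_tree q).
Variable nu : probability (boundary X) R.
Hypothesis Hnu : is_boundary_measure nu.
Local Notation I := `[0, tau R q]%classic.
Local Notation rho := (spectral_measure nu).
Local Notation D := (spectral_dom R X).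

Let q2 := branching_ge2 X.

Lemma measurable_spectral_dom : measurable D.
Proof. exact: measurableX. Qed.

Lemma integrable_spectral (f : boundary X * measurableTypeR R -> R) (M : R) :
  measurable_fun setT f -> (forall p, `|f p| <= M) ->
  rho.-integrable D (EFin \o f).
Proof.
move=> mf fM; have mD := measurable_spectral_dom.
apply: (le_integrable mD (g := cst M%:E)) => //.
- exact/measurable_EFinP/measurable_funTS.
- move=> p _ /=; rewrite lee_fin (le_trans (fM p))// ler_norm//.
- exact: finite_measure_integrable_cst.
Qed.

Lemma integrable_fibre (f : boundary X * measurableTypeR R -> R) (M : R) s :
  measurable_fun setT f -> (forall p, `|f p| <= M) ->
  nu.-integrable setT (EFin \o (fun w => f (w, s))).
Proof.
move=> mf fM; apply: (le_integrable _ (g := cst M%:E)) => //.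
- exact/measurable_EFinP/(measurableT_comp mf)/measurable_pair2.
- move=> w _ /=; rewrite lee_fin (le_trans (fM _))// ler_norm//.
- exact: finite_measure_integrable_cst.
Qed.

Lemma measurable_fibre_integral (f : boundary X * measurableTypeR R -> R) (M : R) :
  measurable_fun setT f -> (forall p, `|f p| <= M) ->
  measurable_fun setT (fun s => \int[nu]_(w in setT) f (w, s)).
Proof.
move=> mf fM; apply: measurableT_comp => //.
have iT : (nu \x plancherel R q)%E.-integrable setT (EFin \o f).
  apply: (le_integrable measurableT (g := cst M%:E)) => //.
  - exact/measurable_EFinP.
  - move=> p _ /=; rewrite lee_fin (le_trans (fM p))// ler_norm//.
  - exact: (finite_measure_integrable_cst rho).
exact: measurable_fubini_G iT.
Qed.

(** Fubini on the whole product, after extension by 0 outside the domain. *)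
Lemma Rintegral_spectral (f : boundary X * measurableTypeR R -> R) (M : R) :
  measurable_fun setT f -> (forall p, `|f p| <= M) ->
  \int[rho]_(p in D) f p =
  \int[plancherel R q]_(s in I) \int[nu]_(w in setT) f (w, s).
Proof.
move=> mf fM.
pose fI := (EFin \o f) \_ D.
have mfI : measurable_fun setT fI.
  apply/(measurable_restrictT _ measurable_spectral_dom).
  exact/measurable_EFinP/measurable_funTS.
have iI : (nu \x plancherel R q)%E.-integrable setT fI.
  exact/(integrable_mkcond _ measurable_spectral_dom)/(integrable_spectral mf fM).
rewrite /Rintegral integral_mkcond.
transitivity (fine (\int[(nu \x plancherel R q)%E]_p fI p)%E) => //.
rewrite -integral21_prod_meas1//; congr fine; rewrite [RHS]integral_mkcond.
apply: eq_integral => s _; rewrite /fubini_G /fI patchE; case: ifPn => [sI|sI].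
  rewrite fineK; last exact/integrable_fin_num/(integrable_fibre s mf fM).
  apply: eq_integral => w _; rewrite patchE mem_set//; split=> //=.
  exact: set_mem sI.
apply: integral0_eq => w _; rewrite patchE memNset//.
by move=> [_ /=]; move: sI; rewrite notin_setE.
Qed.

Lemma cdot_bwave y y' : cdot rho D (bwave y) (bwave y') = (y == y')%:R.
Proof.
pose F p := bwave y p * (bwave (R := R) y' p)^*.
pose M := expR (ln q%:R * (dist Defs.root y)%:R / 2) *
  expR (ln q%:R * (dist Defs.root y')%:R / 2) : R.
have [mF1 mF2] : cmeasurable setT F.
  apply: cmeasurableM; first exact: cmeasurable_bwave.
  exact/cmeasurableJ/cmeasurable_bwave.
have FM p : normc (F p) <= M.
  by rewrite normcM normc_conj; apply: ler_pM; rewrite ?normc_ge0 ?normc_bwave.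
have FM1 p : `|complex.Re (F p)| <= M by exact: le_trans (ler_norm_Re _) (FM p).
have FM2 p : `|complex.Im (F p)| <= M by exact: le_trans (ler_norm_Im _) (FM p).
transitivity (cintegral (plancherel R q) I (fun s => fibre_dot nu s y y')).
  apply: complex_eq.
    exact: (Rintegral_spectral mF1 FM1).
  exact: (Rintegral_spectral mF2 FM2).
rewrite (@cintegral_spherical _ _ q2 _ (dist y y'))//.
- have [->|yy'] := eqVneq y y'; first by rewrite distxx.
  by case: eqP => // /dist_eq0 E; rewrite E eqxx in yy'.
- apply: (@cintegrable_finite _ _ _ (plancherel R q) _ _ M) => //.
    by split; apply: measurable_funTS; [exact: (measurable_fibre_integral mF1 FM1)|
      exact: (measurable_fibre_integral mF2 FM2)].
  move=> s _; apply: le_trans (le_normc_cintegral _ (cintegrable_bwave_fibre _ _ _ _)) _ => //.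
  rewrite -[leRHS]mulr1 -(_ : fine (nu setT) = 1); last by have /= -> := probability_setT nu.
  rewrite -Rintegral_cst//; apply: le_Rintegral => //.
  + by have [_] := (cintegrable_norm _ _ _).1 (cintegrable_bwave_fibre nu s y y').
  + exact: finite_measure_integrable_cst.
  + by move=> w _; exact: (FM (w, s)).
(* Where [z^2 = q], out of reach of [fibre_dotE], the denominator of [cfun] vanishes and with it the
   density. *)
- move=> s; have [w1|w1] := eqVneq (wave q s 1 ^+ 2) q%:R; last by rewrite fibre_dotE.
  suff -> : plancherel_density q s = 0 by rewrite !mulr0.
  rewrite /plancherel_density cfun_phase//.
  have -> : phase q s - (phase q s)^-1 = 0.
    apply/eqP; rewrite subr_eq0; apply/eqP; apply: (mulfI (phase_neq0 q s)).
    have q0 : q%:R != 0 :> R[i] by rewrite pnatr_eq0; lia.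
    rewrite divff ?phase_neq0// -expr2; apply: (mulfI q0).
    by rewrite mulr1 -[RHS]w1 wave1_phase exprMn sqrt_q.
  by rewrite invr0 !mulr0 normc0 expr0n invr0 mulr0.
Qed.

End orthonormal_waves.

(** * Weighted completeness of the waves *)

Section smoothstep.
Variable R : realType.
Implicit Type t : R.

(** Fixes 0, 1/2 and 1, and 1/2 is repelling, so the iterates separate the two halves of [[0, 1]];
    being polynomials they stay in the algebra of multipliers. *)
Definition smoothstep t := 3 * t ^+ 2 - 2 * t ^+ 3.

Lemma smoothstep_itv t : 0 <= t <= 1 -> 0 <= smoothstep t <= 1.
Proof.
move=> /andP[t0 t1].
have E : 1 - smoothstep t = (1 - t) ^+ 2 * (1 + 2 * t) by rewrite /smoothstep; ring.
have E' : smoothstep t = t ^+ 2 * (3 - 2 * t) by rewrite /smoothstep; ring.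
apply/andP; split; first by rewrite E' mulr_ge0 ?sqr_ge0//; lra.
by rewrite -subr_ge0 E mulr_ge0 ?sqr_ge0//; lra.
Qed.

Lemma iter_smoothstep_itv n t : 0 <= t <= 1 -> 0 <= iter n smoothstep t <= 1.
Proof. by move=> t01; elim: n => // n IH; exact: smoothstep_itv. Qed.

Lemma iter_smoothstepC n t : iter n smoothstep (1 - t) = 1 - iter n smoothstep t.
Proof. by elim: n => //= n ->; rewrite /smoothstep; ring. Qed.

Lemma cvg_smoothstep0 t : 0 <= t < 2^-1 ->
  (fun n => iter n smoothstep t) @ \oo --> (0 : R).
Proof.
move=> /andP[t0 t1].
(* On [[0, t]] the map shrinks its argument at least by the factor [r], and
   [1 - r = (1 - t) (1 - 2 t)] is positive. *)
pose r := t * (3 - 2 * t).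
have r01 : 0 <= r < 1 by rewrite /r; apply/andP; split; nra.
have H n : 0 <= iter n smoothstep t <= r ^+ n * t /\ iter n smoothstep t <= t.
  elim: n => [|n [/andP[IH1 IH2] IH3]]; first by rewrite expr0 mul1r t0 lexx.
  set a := iter n smoothstep t in IH1 IH2 IH3 *.
  have ar : a * (3 - 2 * a) <= r by rewrite /r; nra.
  have sE : smoothstep a = a * (3 - 2 * a) * a by rewrite /smoothstep; ring.
  have s0 : 0 <= a * (3 - 2 * a) by apply: mulr_ge0 => //; lra.
  rewrite iterS -/a sE; split; last first.
    by apply: le_trans IH3; rewrite ler_piMl//; case/andP: r01 => ? ?; lra.
  by rewrite mulr_ge0//= exprS -[leRHS]mulrA ler_pM.
apply: (@squeeze_cvgr _ _ _ _ (fun=> 0) (fun n => r ^+ n * t)).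
- by apply: nearW => n; case: (H n).
- exact: cvg_cst.
- rewrite -[X in _ --> X](mul0r t); apply: cvgM; last exact: cvg_cst.
  by apply: cvg_expr; case/andP: r01 => ? ?; rewrite ger0_norm.
Qed.

Lemma cvg_smoothstep1 t : 2^-1 < t <= 1 ->
  (fun n => iter n smoothstep t) @ \oo --> (1 : R).
Proof.
move=> /andP[t0 t1].
rewrite -[X in _ --> X](subr0 (1 : R)).
rewrite (_ : (fun n => _) = fun n => 1 - iter n smoothstep (1 - t)); last first.
  by apply/funext => n; rewrite iter_smoothstepC; ring.
apply: cvgB; first exact: cvg_cst.
by apply: cvg_smoothstep0; apply/andP; split; lra.
Qed.

Lemma iter_smoothstep_half n : iter n smoothstep 2^-1 = 2^-1.
Proof. by elim: n => //= n ->; rewrite /smoothstep; field. Qed.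

End smoothstep.

(** * Approximation by waves in a weighted space *)

Section weighted_density.
Variables (R : realType) (q : nat) (X : homogeneous_tree q).
Variable nu : probability (boundary X) R.
Local Notation I := `[0, tau R q]%classic.
Local Notation rho := (spectral_measure nu).
Local Notation D := (spectral_dom R X).
Local Notation T := (boundary X * measurableTypeR R)%type.
Variable w : T -> R.
Hypotheses (w0 : forall p, 0 <= w p) (mw : measurable_fun setT w).
Hypothesis iw : rho.-integrable D (EFin \o w).

Let q2 := branching_ge2 X.
Let mD : measurable D := @measurable_spectral_dom R q X.

(** The square of the norm of [L^2(w rho)], possibly infinite. *)
Definition wnorm (f : T -> R[i]) : \bar R :=
  (\int[rho]_(p in D) (normc (f p) ^+ 2 * w p)%:E)%E.

Definition bounded_meas (f : T -> R[i]) : Prop :=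
  cmeasurable setT f /\ exists M : R, forall p, normc (f p) <= M.

Definition approximable (f : T -> R[i]) : Prop := forall eps : R, 0 < eps ->
  exists2 v, in_span (@bwave R q X) v & (wnorm (fun p => (f p - v p)%R) <= eps%:E)%E.

Lemma measurable_weighted (f : T -> R[i]) : cmeasurable setT f ->
  measurable_fun D (fun p => (normc (f p) ^+ 2 * w p)%:E).
Proof.
move=> mf; apply/measurable_EFinP/measurable_funTS/measurable_funM => //.
exact: measurable_sqr_normc.
Qed.

Lemma bounded_meas_span v : in_span (@bwave R q X) v -> bounded_meas v.
Proof.
move=> [s [a [_ ->]]]; split.
  by apply: cmeasurable_sum => y; apply: cmeasurableZ; exact: cmeasurable_bwave.
exists (\sum_(y <- s) normc (a y) * expR (ln q%:R * (dist Defs.root y)%:R / 2)) => p.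
apply: le_trans (normc_sum_le _ _) _; apply: ler_sum => y _.
by rewrite normcM ler_wpM2l ?normc_ge0// normc_bwave.
Qed.

Lemma bounded_measB f g : bounded_meas f -> bounded_meas g ->
  bounded_meas (fun p => f p - g p).
Proof.
move=> [mf [M fM]] [mg [N gN]]; split; first exact: cmeasurableB.
exists (M + N) => p; apply: le_trans (le_normcD _ _) _.
by rewrite normcN lerD.
Qed.

Lemma bounded_measM f g : bounded_meas f -> bounded_meas g ->
  bounded_meas (fun p => f p * g p).
Proof.
move=> [mf [M fM]] [mg [N gN]]; split; first exact: cmeasurableM.
exists (M * N) => p; rewrite normcM; apply: ler_pM; by rewrite ?normc_ge0.
Qed.

Lemma bounded_measD f g : bounded_meas f -> bounded_meas g ->
  bounded_meas (fun p => f p + g p).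
Proof.
move=> [mf [M fM]] [mg [N gN]]; split; first exact: cmeasurableD.
by exists (M + N) => p; apply: le_trans (le_normcD _ _) _; rewrite lerD.
Qed.

Lemma bounded_meas_cst a : bounded_meas (fun=> a).
Proof. by split; [exact: cmeasurable_cst|exists (normc a)]. Qed.

Lemma wnormD f g : cmeasurable setT f -> cmeasurable setT g ->
  (wnorm (fun p => (f p + g p)%R) <= 2%:E * wnorm f + 2%:E * wnorm g)%E.
Proof.
move=> mf mg; rewrite /wnorm -!ge0_integralZl//; try exact: measurable_weighted;
  try by move=> p _; rewrite lee_fin mulr_ge0 ?sqr_ge0.
rewrite -ge0_integralD//; try (apply: emeasurable_funM => //; exact: measurable_weighted);
  try by move=> p _; rewrite -EFinM lee_fin !mulr_ge0 ?sqr_ge0.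
apply: ge0_le_integral => //.
- by move=> p _; rewrite lee_fin mulr_ge0 ?sqr_ge0.
- by apply: measurable_weighted; exact: cmeasurableD.
- by apply: emeasurable_funD; apply: emeasurable_funM => //; exact: measurable_weighted.
- move=> p _; rewrite -!EFinM -EFinD lee_fin.
  rewrite (_ : 2 * _ + _ = (2 * normc (f p) ^+ 2 + 2 * normc (g p) ^+ 2) * w p).
    by rewrite ler_wpM2r// sqr_normcD_le.
  by ring.
- by move=> p _; rewrite mule_ge0// lee_fin mulr_ge0 ?sqr_ge0.
- by move=> p _; rewrite mule_ge0// lee_fin mulr_ge0 ?sqr_ge0.
Qed.

Lemma wnormM f g (M : R) : cmeasurable setT f -> cmeasurable setT g ->
  (forall p, normc (g p) <= M) ->
  (wnorm (fun p => (g p * f p)%R) <= (M ^+ 2)%:E * wnorm f)%E.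
Proof.
move=> mf mg gM; rewrite /wnorm -ge0_integralZl//; try exact: measurable_weighted;
  try by move=> p _; rewrite lee_fin ?mulr_ge0 ?sqr_ge0.
apply: ge0_le_integral => //.
- by move=> p _; rewrite lee_fin mulr_ge0 ?sqr_ge0.
- by apply: measurable_weighted; exact: cmeasurableM.
- by apply: emeasurable_funM => //; exact: measurable_weighted.
- move=> p _; rewrite -EFinM lee_fin normcM exprMn -mulrA ler_wpM2r//.
    by rewrite mulr_ge0 ?sqr_ge0.
  by rewrite lerXn2r// ?nnegrE ?normc_ge0 ?gM// (le_trans _ (gM p))// normc_ge0.
- by move=> p _; rewrite lee_fin mulr_ge0 ?sqr_ge0.
- by rewrite lee_fin sqr_ge0.
Qed.

Lemma approximable_close f : bounded_meas f ->
  (forall eps : R, 0 < eps -> exists g, [/\ bounded_meas g, approximable g &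
     (wnorm (fun p => (f p - g p)%R) <= eps%:E)%E]) -> approximable f.
Proof.
(* The 4 pays for the two factors 2 in [wnormD]. *)
move=> bf H eps eps0; have e4 : 0 < eps / 4 by rewrite divr_gt0.
have [g [bg ag fg]] := H _ e4; have [v sv gv] := ag _ e4; exists v => //.
have bv := bounded_meas_span sv.
have -> : (fun p => f p - v p) = (fun p => (f p - g p) + (g p - v p)).
  by apply/funext => p; rewrite addrA subrK.
apply: le_trans (wnormD _ _) _; [exact: (bounded_measB bf bg).1|exact: (bounded_measB bg bv).1|].
apply: (@le_trans _ _ (2%:E * (eps / 4)%:E + 2%:E * (eps / 4)%:E)%E).
  by apply: leeD; rewrite lee_pmul2l.
by rewrite -!EFinM -EFinD lee_fin; lra.
Qed.

Lemma approximable_span v : in_span (@bwave R q X) v -> approximable v.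
Proof.
move=> sv eps eps0; exists v => //; rewrite /wnorm.
under eq_integral do rewrite subrr normc0 expr0n mul0r.
by rewrite integral0 lee_fin ltW.
Qed.

Lemma approximable_lin c f g : bounded_meas f -> bounded_meas g ->
  approximable f -> approximable g -> approximable (fun p => c * f p + g p).
Proof.
move=> bf bg af ag eps eps0.
have c1 : 0 < normc c ^+ 2 + 1 by rewrite ltr_pwDr// sqr_ge0.
have e1 : 0 < eps / 4 / (normc c ^+ 2 + 1) by rewrite !divr_gt0.
have e2 : 0 < eps / 4 by rewrite divr_gt0.
have [u su fu] := af _ e1; have [v sv gv] := ag _ e2.
exists (fun p => c * u p + v p); first exact: in_span_lin.
have bfu := bounded_measB bf (bounded_meas_span su).
have bgv := bounded_measB bg (bounded_meas_span sv).
rewrite (_ : (fun p => _) = (fun p => c * (f p - u p) + (g p - v p))); last first.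
  by apply/funext => p; ring.
apply: le_trans (wnormD _ _) _; [exact: cmeasurableZ bfu.1|exact: bgv.1|].
have := wnormM (f := fun p => f p - u p) (g := fun=> c) (M := normc c) bfu.1
  (cmeasurable_cst _ _) (fun=> lexx _).
move=> cfu.
apply: (@le_trans _ _ (2%:E * (eps / 4)%:E + 2%:E * (eps / 4)%:E)%E); last first.
  by rewrite -!EFinM -EFinD lee_fin; lra.
apply: leeD; rewrite lee_pmul2l//.
apply: le_trans cfu _.
apply: (@le_trans _ _ ((normc c ^+ 2)%:E * (eps / 4 / (normc c ^+ 2 + 1))%:E)%E).
  by apply: lee_wpmul2l => //; rewrite lee_fin sqr_ge0.
rewrite -EFinM lee_fin mulrA ler_pdivrMr// mulrC ler_wpM2l// ?ltW//.
by rewrite ltrDl.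
Qed.

Lemma approximable_eq f g : (forall p, D p -> f p = g p) ->
  approximable f -> approximable g.
Proof.
move=> fg af eps /af[v sv fv]; exists v => //.
rewrite /wnorm (eq_integral (fun p => (normc (f p - v p) ^+ 2 * w p)%:E))//.
by move=> p /set_mem pD; rewrite fg.
Qed.

(** Dominated convergence with the majorant [(2 M)^2 w]: integrability of the weight is what admits
    bounded pointwise limits. *)
Lemma approximable_lim (f : nat -> T -> R[i]) g (M : R) :
  (forall n, cmeasurable setT (f n)) -> cmeasurable setT g ->
  (forall n p, normc (f n p) <= M) -> (forall p, normc (g p) <= M) ->
  (forall p, D p -> (fun n => normc (f n p - g p)) @ \oo --> 0) ->
  (forall n, approximable (f n)) -> approximable g.
Proof.
move=> mf mg fM gM fg af.
have bg : bounded_meas g by split=> //; exists M.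
have bf n : bounded_meas (f n) by split=> //; exists M.
apply: approximable_close => // eps eps0.
pose h n p : \bar R := (normc (g p - f n p) ^+ 2 * w p)%:E.
have mh n : measurable_fun D (h n).
  by apply: measurable_weighted; exact: cmeasurableB.
have h0 : {ae rho, forall p, D p -> h ^~ p @ \oo --> (cst 0%E p : \bar R)}.
  apply: aeW => p Dp; apply/fine_cvgP; split; first exact: nearW.
  rewrite /= [X in _ --> X](_ : _ = (0 ^+ 2) * w p); last by rewrite expr0n mul0r.
  apply: cvgM; last exact: cvg_cst.
  under eq_fun do rewrite -normcN opprB expr2.
  by rewrite expr2; apply: cvgM; exact: fg.
have iW : rho.-integrable D (fun p => ((M + M) ^+ 2)%:E * (w p)%:E)%E.
  exact: integrableZl.
have hW : {ae rho, forall p n, D p -> (`|h n p| <= ((M + M) ^+ 2)%:E * (w p)%:E)%E}.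
  apply: aeW => p n _; rewrite gee0_abs; last first.
    by rewrite lee_fin mulr_ge0 ?sqr_ge0.
  rewrite -EFinM lee_fin ler_wpM2r// lerXn2r// ?nnegrE ?normc_ge0//.
    by rewrite addr_ge0// (le_trans _ (gM p))// normc_ge0.
  by apply: le_trans (le_normcD _ _) _; rewrite normcN lerD.
have [_ _ H] := dominated_convergence mD mh (measurable_cst _) h0 iW hW.
move: H; rewrite integral0 => /fine_cvgP[fin] /cvgr_lt /(_ _ eps0) small.
have [n [fn sn]] : exists n, (\int[rho]_(p in D) h n p \is a fin_num)%E /\
    fine (\int[rho]_(p in D) h n p)%E < eps.
  have [N _ HN] := filterI fin small; exists N; exact: (HN N (leqnn N)).
exists (f n); split => //; rewrite /wnorm -/(h n) -(fineK fn) lee_fin ltW//.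
Qed.

(** Functions of the spectral parameter that act on the closure of the waves; they form an algebra
    stable under bounded limits, so that one cosine suffices to produce all of them. *)
Definition multiplier (g : R -> R[i]) : Prop :=
  bounded_meas (fun p => g p.2) /\
  forall f, bounded_meas f -> approximable f -> approximable (fun p => g p.2 * f p).

Lemma cmeasurable_snd (g : measurableTypeR R -> R[i]) : cmeasurable setT g ->
  cmeasurable [set: T] (fun p => g p.2).
Proof.
by move=> [g1 g2]; split; [exact: (measurableT_comp g1 measurable_snd)|
  exact: (measurableT_comp g2 measurable_snd)].
Qed.

Lemma multiplier_cst a : multiplier (fun=> a).
Proof.
split=> [|f bf af]; first exact: bounded_meas_cst.
have b0 := bounded_meas_cst 0.
have a0 : approximable (fun=> 0) by apply: approximable_span; exact: in_span0.
rewrite (_ : (fun p => _) = (fun p => a * f p + 0)); first exact: approximable_lin.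
by apply/funext => p; rewrite addr0.
Qed.

Lemma multiplier_lin c f g : multiplier f -> multiplier g ->
  multiplier (fun s => c * f s + g s).
Proof.
move=> [bf af] [bg ag]; split.
  by apply: bounded_measD => //; apply: bounded_measM => //; exact: bounded_meas_cst.
move=> h bh ah; rewrite (_ : (fun p => _) = (fun p => c * (f p.2 * h p) + g p.2 * h p)).
  by apply: approximable_lin; [exact: bounded_measM|exact: bounded_measM|exact: af|exact: ag].
by apply/funext => p; ring.
Qed.

Lemma multiplierM f g : multiplier f -> multiplier g ->
  multiplier (fun s => f s * g s).
Proof.
move=> [bf af] [bg ag]; split; first exact: bounded_measM.
move=> h bh ah; under eq_fun do rewrite -mulrA.
by apply: af; [exact: bounded_measM|exact: ag].
Qed.

Lemma multiplier_lim (f : nat -> R -> R[i]) (g : measurableTypeR R -> R[i]) (M : R) :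
  cmeasurable setT g ->
  (forall n s, normc (f n s) <= M) -> (forall s, normc (g s) <= M) ->
  (forall s, I s -> (fun n => normc (f n s - g s)) @ \oo --> 0) ->
  (forall n, multiplier (f n)) -> multiplier g.
Proof.
move=> mg fM gM fg mf.
have bg : bounded_meas (fun p => g p.2).
  by split; [exact: cmeasurable_snd|exists M => p].
split=> // h bh ah; have [mh [N hN]] := bh.
apply: (@approximable_lim (fun n p => f n p.2 * h p) _ (M * N)).
- by move=> n; apply: cmeasurableM => //; exact: (mf n).1.1.
- by apply: cmeasurableM => //; exact: bg.1.
- by move=> n p; rewrite normcM; apply: ler_pM; rewrite ?normc_ge0.
- by move=> p; rewrite normcM; apply: ler_pM; rewrite ?normc_ge0.
- move=> p [_ pI]; under eq_fun do rewrite -mulrBl normcM.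
  rewrite -(mul0r (normc (h p))); apply: cvgM; last exact: cvg_cst.
  exact: fg.
- by move=> n; apply: (mf n).2.
Qed.

Lemma multiplier_eq f (g : measurableTypeR R -> R[i]) (M : R) : cmeasurable setT g ->
  (forall s, normc (g s) <= M) -> (forall s, I s -> f s = g s) ->
  multiplier f -> multiplier g.
Proof.
move=> mg gM fg [bf af]; split.
  by split; [exact: cmeasurable_snd|exists M => p].
move=> h bh ah; apply: approximable_eq (af h bh ah) => p [_ pI].
by rewrite fg.
Qed.

(** Along a given ray one neighbour is one higher and the [q] others one lower, so the eigenvalue is
    [z + q / z], twice the real part of [z]. *)
Lemma bwave_neighbours y (s : seq X) p : uniq s -> size s = q.+1 ->
  (forall y', (y' \in s) = adj y y') ->
  \sum_(y' <- s) bwave y' p =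
  (2 * expR (ln q%:R / 2) * cos (ln q%:R * p.2))%:C * bwave (R := R) y p.
Proof.
move=> us ss sE; have [p0 [yp0 h0 hs]] := height_neighbour R p.1 y.
have sp0 : p0 \in s by rewrite sE.
(* [c] is the common value at the lower neighbours; subtracting it leaves a single term of the
   sum. *)
set z := wave q p.2 1; pose c := bwave y p * z^-1.
have E : \sum_(y' <- s) (bwave y' p - c) = bwave p0 p - c.
  rewrite (bigD1_seq p0)//= [X in _ + X]big1_seq ?addr0// => y' /andP[y'p0 sy'].
  by rewrite /bwave hs -?sE// waveD waveN subrr.
move: E; rewrite sumrB => /eqP; rewrite subr_eq => /eqP ->.
rewrite big_const_seq count_predT ss iter_addr_0 mulrS addrA subrK.
rewrite /c /bwave h0 waveD -/z -mulrnAr -mulrDr mulrC; congr (_ * _).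
rewrite -[z^-1 *+ q]mulr_natr -(wave1J q2 p.2) -/z mulKf ?wave_neq0// addcJ.
have aux (a b : R) : (2 * a * b)%:C = 2 * (a * b)%:C.
  by rewrite -mulrA rmorphM rmorph_nat.
by rewrite aux /z wave1_phase !reim /= mul0r subr0.
Qed.

Lemma in_span_cos v : in_span (@bwave R q X) v ->
  in_span (@bwave R q X) (fun p => (cos (ln q%:R * p.2))%:C * v p).
Proof.
move=> [s [a [_ ->]]]; elim: s => [|y s IH].
  rewrite (_ : (fun p => _) = fun=> 0); first exact: in_span0.
  by apply/funext => p; rewrite big_nil mulr0.
rewrite (_ : (fun p => _) = fun p => a y * ((cos (ln q%:R * p.2))%:C * bwave y p) +
    (cos (ln q%:R * p.2))%:C * \sum_(i <- s) a i * bwave i p); last first.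
  by apply/funext => p; rewrite big_cons mulrDr mulrCA.
apply: in_span_lin => //.
have [t [ut st tE]] := neighbours y.
pose r : R := 2 * expR (ln q%:R / 2).
have r0 : r != 0 by rewrite mulf_neq0// ?pnatr_eq0// gt_eqF// expR_gt0.
rewrite (_ : (fun p => _) = fun p => \sum_(y' <- t) r^-1%:C * bwave y' p).
  exact: in_span_sum.
apply/funext => p; rewrite -mulr_sumr (bwave_neighbours _ ut st tE) mulrA -rmorphM.
by rewrite /= -/r mulKf.
Qed.

(** The cosine is bounded by 1, so multiplying an approximation by it does not increase the error,
    whatever the weight. *)
Lemma multiplier_cos : multiplier (fun s => (cos (ln q%:R * s))%:C).
Proof.
have mc : cmeasurable [set: T] (fun p => (cos (ln q%:R * p.2))%:C).
  apply: (@cmeasurable_snd (fun s => (cos (ln q%:R * s))%:C)).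
  apply: cmeasurable_real; apply: measurableT_comp => //.
  exact: (continuous_measurable_fun (@continuous_cos R)).
have c1 (p : T) : normc (cos (ln q%:R * p.2))%:C <= 1.
  by rewrite normc_real ler_norml cos_geN1 cos_le1.
split; first by split=> //; exists 1.
move=> f bf af eps eps0; have [v sv fv] := af _ eps0.
exists (fun p => (cos (ln q%:R * p.2))%:C * v p); first exact: in_span_cos.
under eq_fun do rewrite -mulrBr.
have bv := bounded_meas_span sv.
apply: le_trans (wnormM (bounded_measB bf bv).1 mc c1) _.
by rewrite expr1n mul1e.
Qed.

Lemma multiplier_smoothstep (h : R -> R) n : multiplier (fun s => (h s)%:C) ->
  multiplier (fun s => (iter n (@smoothstep R) (h s))%:C).
Proof.
move=> mh; elim: n => // n IH; set g := fun s => _ in IH.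
rewrite (_ : (fun s => _) = fun s => 3 * (g s * g s) + ((- 2) * (g s * (g s * g s)) + 0)).
  apply: multiplier_lin; first exact: multiplierM.
  apply: multiplier_lin; last exact: multiplier_cst.
  by apply: multiplierM => //; exact: multiplierM.
apply/funext => s; rewrite iterS /smoothstep /g; move: (iter n _ _) => t.
by apply: complex_eq; rewrite !exprS expr0 !reim /=; ring.
Qed.

(** The division by 4 keeps the values in [[0, 1]]. The cosine decreases on [[0, tau]], so for [a]
    and [s] in this interval [h a s] exceeds 1/2 exactly when [s < a]. *)
Let h (a s : R) : R := 2^-1 + (cos (ln q%:R * s) - cos (ln q%:R * a)) / 4.

Let h_itv a s : 0 <= h a s <= 1.
Proof.
have := cos_le1 (ln q%:R * s); have := cos_geN1 (ln q%:R * s).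
have := cos_le1 (ln q%:R * a); have := cos_geN1 (ln q%:R * a).
by rewrite /h => ? ? ? ?; apply/andP; split; lra.
Qed.

Let multiplier_h a : multiplier (fun s => (h a s)%:C).
Proof.
rewrite (_ : (fun s => _) = fun s => (4^-1)%:C * (cos (ln q%:R * s))%:C +
   (2^-1 - cos (ln q%:R * a) / 4)%:C).
  by apply: multiplier_lin; [exact: multiplier_cos|exact: multiplier_cst].
by apply/funext => s; rewrite -rmorphM -rmorphD /h; congr (_ %:C); ring.
Qed.

(** The value 1/2 at [a] is the limit of the smoothstep iterates there. *)
Definition step (a s : R) : R :=
  if s < a then 1 else if s == a then 2^-1 else 0.

Lemma measurable_step a : measurable_fun [set: measurableTypeR R] (step a).
Proof.
rewrite (_ : step a = fun s => \1_(`]-oo, a[%classic) s +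
    2^-1 * \1_([set a]) s).
  apply: measurable_funD; first exact: measurable_indic.
  by apply: measurable_funM => //; exact: measurable_indic.
apply/funext => s; rewrite !indicE /step.
have -> : (s \in `]-oo, a[%classic) = (s < a).
  by apply/idP/idP; rewrite inE /= in_itv.
have -> : (s \in [set a]) = (s == a).
  by apply/idP/idP; rewrite inE => /eqP.
by case: ltgtP; rewrite ?mulr0 ?mulr1 ?addr0 ?add0r.
Qed.

Lemma multiplier_step a : I a -> multiplier (fun s => (step a s)%:C).
Proof.
move=> /=; rewrite in_itv /= => /andP[a0 at_].
apply: (@multiplier_lim (fun n s => (iter n (@smoothstep R) (h a s))%:C) _ 1).
- exact: (cmeasurable_real (measurable_step a)).
- move=> n s; have /andP[? ?] := iter_smoothstep_itv n (h_itv a s).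
  by rewrite normc_real ger0_norm.
- move=> s; rewrite normc_real /step.
  by case: ifP => _; [|case: ifP => _]; rewrite ?normr1 ?normr0// ger0_norm//; lra.
- move=> s sI; have /andP[s0 st] : 0 <= s <= tau R q by move: sI; rewrite /= in_itv.
  have lt_cos u v : 0 <= u -> v <= tau R q -> u < v ->
      cos (ln q%:R * v) < cos (ln q%:R * u).
    move=> u0 vt uv; have L := lnq_gt0 R q2.
    have pE : ln q%:R * tau R q = pi by rewrite mulrC divfK// gt_eqF.
    rewrite ltr_cos ?ltr_pM2l// in_itv /= -pE ler_pM2l// mulr_ge0 ?(ltW L)//=.
    - by rewrite ltW// (lt_le_trans uv).
    - by rewrite (le_trans u0 (ltW uv)).
  rewrite (_ : (fun n => _) = fun n => `|iter n (@smoothstep R) (h a s) - step a s|); last first.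
    by apply/funext => n; rewrite normc_realB.
  rewrite -(normr0 R); apply: cvg_norm; rewrite -(subrr (step a s)).
  apply: cvgB; last exact: cvg_cst.
  rewrite /step; case: ltgtP => sa.
  + apply: cvg_smoothstep1; have := lt_cos _ _ s0 at_ sa; have := h_itv a s.
    by rewrite /h => /andP[? ?] ?; apply/andP; split; lra.
  + apply: cvg_smoothstep0; have := lt_cos _ _ a0 st sa; have := h_itv a s.
    by rewrite /h => /andP[? ?] ?; apply/andP; split; lra.
  + rewrite sa; under eq_fun do rewrite /h subrr mul0r addr0 iter_smoothstep_half.
    exact: cvg_cst.
- by move=> n; apply: multiplier_smoothstep.
Qed.

Lemma multiplier_ray a : multiplier (fun s => (\1_(`]-oo, a[%classic) s)%:C).
Proof.
have m1 : cmeasurable [set: measurableTypeR R]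
    (fun s => (\1_(`]-oo, a[%classic) s : R)%:C).
  by apply: cmeasurable_real; apply: measurable_indic.
have b1 (s : measurableTypeR R) : normc (\1_(`]-oo, a[%classic) s : R)%:C <= 1.
  by rewrite normc_real indicE; case: (_ \in _); rewrite ?normr1 ?normr0.
have indE (s : R) : \1_(`]-oo, a[%classic) s = (s < a)%R%:R :> R.
  by rewrite indicE; congr (nat_of_bool _)%:R; apply/idP/idP; rewrite inE /= in_itv.
have [a0|a0] := leP a 0.
  apply: multiplier_eq m1 b1 _ (multiplier_cst 0) => s /=.
  by rewrite in_itv /= indE => /andP[s0 _]; rewrite ltNge (le_trans a0 s0).
have [at_|ta] := leP a (tau R q); last first.
  apply: multiplier_eq m1 b1 _ (multiplier_cst 1) => s /=.
  by rewrite in_itv /= indE => /andP[_ st]; rewrite (le_lt_trans st ta).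
(* Thresholds strictly below [a] avoid the value 1/2 that [step a] takes at [a]. *)
apply: (@multiplier_lim (fun n s => (step (a * (1 - n.+1%:R^-1)) s)%:C) _ 1) => //.
- move=> n s; rewrite normc_real /step.
  by case: ifP => _; [|case: ifP => _]; rewrite ?normr1 ?normr0// ger0_norm//; lra.
- move=> s _; apply: cvg_near_cst.
  have [sa|sa] := ltP s a.
    have as0 : 0 < a - s by rewrite subr_gt0.
    (* From this rank on [a / n.+1] is smaller than [a - s]. *)
    exists (Num.truncn (a / (a - s))) => // n nn.
    rewrite normc_realB indE sa /step ifT ?subrr ?normr0//.
    rewrite mulrBr mulr1 ltrBrDl -ltrBrDr ltr_pdivrMr// mulrC -ltr_pdivrMr//.
    by apply: (lt_le_trans (truncnS_gt _)); rewrite ler_nat.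
  exists 0%N => // n _; rewrite normc_realB indE ltNge sa /step.
  have aa : a * (1 - n.+1%:R^-1) < a by rewrite gtr_pMr// gtrBl invr_gt0.
  rewrite ifF ?ifF ?subrr ?normr0//; apply/negbTE;
    by rewrite -?leNgt ?gt_eqF// ?(lt_le_trans aa)// ltW// (lt_le_trans aa).
- move=> n; apply: multiplier_step; rewrite /= in_itv /=.
  have n1 : n.+1%:R^-1 <= 1 :> R by rewrite invf_le1// ler1n.
  have n0 : 0 <= n.+1%:R^-1 :> R by rewrite invr_ge0.
  rewrite mulr_ge0 ?subr_ge0// ?(ltW a0)//= (le_trans _ at_)// ger_pMr// gerBl//.
Qed.

Lemma multiplier_bounded (g : measurableTypeR R -> R[i]) (M : R) :
  cmeasurable setT g -> (forall s, normc (g s) <= M) -> multiplier g.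
Proof.
apply: (monotone_class (P := multiplier) _ _ _ (G := @RGenInftyO.G R)).
- exact: multiplier_cst.
- by move=> c f1 f2; exact: multiplier_lin.
- move=> f1 f2 N mf1 mf2 af1 f1N f2N cvgf.
  by apply: (multiplier_lim mf2 f1N f2N) => // s _; exact: cvgf.
- exact: RGenInftyO.measurableE.
- move=> _ _ [a ->] [b ->]; exists (Num.min a b).
  by apply/seteqP; split=> x /=; rewrite !in_itv /= lt_min; [move=> [-> ->]|move=> /andP].
- by move=> _ [a ->]; exact: multiplier_ray.
Qed.

(** [z^2] has modulus [q], at least 2. The quotient in [shadow_bwave] is therefore a bounded
    function of [s]. *)
Lemma normc_wave2B1 s : 1 <= normc (wave q s 2 - 1 : R[i]).
Proof.
have := le_normcD (wave q s 2 - 1) (1 : R[i]).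
rewrite subrK normc_wave (_ : normc (1 : R[i]) = 1); last by rewrite (normc_real 1) normr1.
rewrite (_ : _ / 2 = ln q%:R); last by field.
rewrite lnK ?posrE ?ltr0n; last by lia.
have : 2 <= q%:R :> R by rewrite (ler_nat _ 2).
lra.
Qed.

(** Off the shadow the two waves cancel; on it they leave [z^(|y| - 2) (z^2 - 1)], a function of [s]
    alone without zeros. *)
Lemma shadow_bwave (y p : X) t : adj y p -> dist Defs.root y = (dist Defs.root p).+1 ->
  (\1_(shadow y) t.1)%:C =
  wave q t.2 (2 - (dist Defs.root y)%:R) * (wave q t.2 2 - 1)^-1 *
  (bwave (R := R) y t - wave q t.2 (- 1) * bwave p t).
Proof.
move=> yp yE; rewrite indicE; have [yt|yt] := pselect (shadow y t.1).
  have pt : height R t.1 p = (dist Defs.root y)%:R - 1.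
    by rewrite (@height_beyond _ _ _ _ p y p)// ?distxx ?(distC p) (dist_adj yp).
  have := normc_wave2B1 t.2.
  rewrite mem_set// /bwave (height_shadow _ yt) pt !waveD !waveN.
  have := wave_neq0 q t.2 1; have := wave_neq0 q t.2 (dist Defs.root y)%:R.
  move: (wave _ _ _) (wave _ _ _) => z a a0 z0 zz.
  have zz1 : z * z - 1 != 0.
    by apply: contraTneq zz => ->; rewrite normc0 ler10.
  rewrite (_ : (_%:R)%:C = 1)//.
  by field; rewrite z0 a0 -?expr2 -?expr2 ?zz1 ?andbT//; move: zz1; rewrite -expr2.
rewrite memNset// /bwave (height_parent _ yp yE yt) waveD.
by rewrite mulrC [wave _ _ (-1) * _]mulrC subrr mul0r.
Qed.

Lemma approximable_shadow y (g : measurableTypeR R -> R[i]) (M : R) :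
  cmeasurable setT g -> (forall s, normc (g s) <= M) ->
  approximable (fun p => (\1_(shadow y) p.1)%:C * g p.2).
Proof.
move=> mg gM; have [_ gmul] := multiplier_bounded mg gM.
have bw y' : bounded_meas (bwave (X := X) (R := R) y').
  split; first exact: cmeasurable_bwave.
  by exists (expR (ln q%:R * (dist Defs.root y')%:R / 2)) => p; exact: normc_bwave.
have aw y' : approximable (bwave (X := X) (R := R) y').
  apply: approximable_span.
  rewrite (_ : bwave y' = fun p => 1 * bwave y' p + 0); last first.
    by apply/funext => p; rewrite mul1r addr0.
  by apply: in_span_cons; exact: in_span0.
have mwave (a : R) : cmeasurable [set: measurableTypeR R] (fun s => wave q s a).
  by apply: (cmeasurable_wave q (f := id) (g := fun=> a)) => //; exact: measurable_id.
have bwv (a : R) s : normc (wave q s a) <= expR (ln q%:R * `|a| / 2).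
  exact: wave_ge0_bound.
have [->|y0] := eqVneq y Defs.root.
  rewrite (_ : (fun p => _) = fun p => g p.2 * bwave Defs.root p).
    exact: gmul.
  by apply/funext => p; rewrite bwave_root shadow_root indicT mul1r mulr1.
have [p yp yE] := parent_exists y0.
rewrite (_ : (fun p => _) = fun t => g t.2 *
  (wave q t.2 (2 - (dist Defs.root y)%:R) * (wave q t.2 2 - 1)^-1 *
  (bwave (R := R) y t - wave q t.2 (- 1) * bwave p t))); last first.
  by apply/funext => t; rewrite (shadow_bwave _ yp yE) mulrC.
pose k (s : R) := wave q s (2 - (dist Defs.root y)%:R) * (wave q s 2 - 1)^-1.
have mk : multiplier k.
  apply: multiplierM.
    exact: multiplier_bounded (mwave _) (bwv _).
  apply: (@multiplier_bounded _ 1).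
    apply: cmeasurableV; apply: cmeasurableB => //; exact: cmeasurable_cst.
  move=> s; have s1 := normc_wave2B1 s.
  by rewrite normcV invf_le1// (lt_le_trans ltr01).
have m1 : multiplier (fun s => wave q s (- 1)).
  exact: multiplier_bounded (mwave _) (bwv _).
apply: gmul.
  apply: bounded_measM; first exact: mk.1.
  apply: bounded_measB => //; apply: bounded_measM => //; exact: m1.1.
apply: mk.2.
  apply: bounded_measB => //; apply: bounded_measM => //; exact: m1.1.
rewrite (_ : (fun t => _) = fun t => (- 1) * (wave q t.2 (- 1) * bwave p t) + bwave y t).
  apply: approximable_lin => //.
    by apply: bounded_measM => //; exact: m1.1.
  exact: m1.2.
by apply/funext => t; rewrite mulN1r addrC.
Qed.

(** The empty set is added because two shadows may be disjoint. *)
Lemma setI_closed_shadow :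
  setI_closed ((range (@shadow q X)) `|` [set set0]).
Proof.
move=> A B [[y _ <-]|->]; last by move=> _; right; rewrite set0I.
move=> [[y' _ <-]|->]; last by right; rewrite setI0.
by case: (shadow_setI y y') => ->; [right|left; exists y|left; exists y'].
Qed.

Lemma measurable_shadowE :
  @measurable _ (boundary X) = <<s (range (@shadow q X)) `|` [set set0] >>.
Proof.
apply/seteqP; split.
  by apply: sub_smallest2r => //; left.
apply: smallest_sub; first exact: smallest_sigma_algebra.
move=> A [yA|->]; first exact: sub_sigma_algebra.
exact: measurable0.
Qed.

Lemma approximable_rect (f : boundary X -> R[i]) (g : measurableTypeR R -> R[i]) (N M : R) :
  cmeasurable setT f -> (forall u, normc (f u) <= N) ->
  cmeasurable setT g -> (forall s, normc (g s) <= M) ->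
  approximable (fun p => f p.1 * g p.2).
Proof.
move=> mf fN mg gM.
have bg : bounded_meas (fun p => g p.2).
  by split; [exact: cmeasurable_snd|exists M => p].
have cfst (k : boundary X -> R[i]) : cmeasurable setT k ->
    cmeasurable [set: T] (fun p => k p.1).
  by move=> [k1 k2]; split; [exact: (measurableT_comp k1 measurable_fst)|
    exact: (measurableT_comp k2 measurable_fst)].
(* The factor [g] stays fixed; this monotone class runs over functions of the boundary point
   only. *)
pose P k := bounded_meas (fun p : T => k p.1) /\ approximable (fun p => k p.1 * g p.2).
suff [] : P f by [].
have bkg k : bounded_meas (fun p => k p.1) -> bounded_meas (fun p => k p.1 * g p.2).
  by move=> bk; exact: bounded_measM.
apply: (monotone_class (P := P) _ _ _ measurable_shadowE setI_closed_shadow _ mf fN).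
- split; first exact: bounded_meas_cst.
  rewrite (_ : (fun p => _) = fun p => (\1_(shadow (@Defs.root q X)) p.1)%:C * g p.2).
    exact: approximable_shadow gM.
  by apply/funext => p; rewrite shadow_root indicT.
- move=> c k1 k2 [b1 a1] [b2 a2]; split.
    by apply: bounded_measD => //; apply: bounded_measM => //; exact: bounded_meas_cst.
  rewrite (_ : (fun p => _) = fun p => c * (k1 p.1 * g p.2) + k2 p.1 * g p.2).
    by apply: approximable_lin => //; exact: bkg.
  by apply/funext => p; rewrite mulrDl mulrA.
- move=> k1 k2 K mk1 mk2 ak k1K k2K cvgk.
  have bk2 : bounded_meas (fun p : T => k2 p.1) by split; [exact: cfst|exists K => p].
  split => //.
  apply: (@approximable_lim (fun n p => k1 n p.1 * g p.2) _ (K * M)).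
  + by move=> n; exact: (bkg _ (ak n).1).1.
  + exact: (bkg _ bk2).1.
  + by move=> n p; rewrite normcM; apply: ler_pM; rewrite ?normc_ge0.
  + by move=> p; rewrite normcM; apply: ler_pM; rewrite ?normc_ge0.
  + move=> p _; under eq_fun do rewrite -mulrBl normcM.
    by rewrite -(mul0r (normc (g p.2))); apply: cvgM; [exact: cvgk|exact: cvg_cst].
  + by move=> n; exact: (ak n).2.
- move=> A GA; split.
    split.
      apply: (cfst (fun u => (\1_A u)%:C)); apply: cmeasurable_real; apply: measurable_indic.
      by rewrite measurable_shadowE; exact: sub_sigma_algebra.
    by exists 1 => p; rewrite normc_real indicE; case: (_ \in _); rewrite ?normr1 ?normr0.
  case: GA => [[y _ <-]|->]; first exact: approximable_shadow gM.
  rewrite (_ : (fun p => _) = fun=> 0); first by apply: approximable_span; exact: in_span0.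
  by apply/funext => p; rewrite indic0 mul0r.
Qed.

(** A further monotone class argument, now over measurable rectangles, whose indicators are products
    as in [approximable_rect]. *)
Theorem bounded_approximable (f : T -> R[i]) : bounded_meas f -> approximable f.
Proof.
move=> [mf [M fM]].
pose P k := bounded_meas k /\ approximable k.
have indic1 d' (T' : measurableType d') (A : set T') u : normc ((\1_A u : R)%:C) <= 1.
  by rewrite normc_real indicE; case: (_ \in _); rewrite ?normr1 ?normr0.
suff [] : P f by [].
apply: (monotone_class (P := P) _ _ _ (@measurable_prod_measurableType _ _ _ _) _ _ mf fM).
- split; first exact: bounded_meas_cst.
  rewrite (_ : (fun p => _) = fun p => (fun=> 1) p.1 * (fun=> 1) p.2).
    apply: (@approximable_rect (fun=> 1) (fun=> 1) (normc 1) (normc 1)) => //;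
      exact: cmeasurable_cst.
  by apply/funext => p; rewrite mulr1.
- move=> c k1 k2 [b1 a1] [b2 a2]; split; last exact: approximable_lin.
  by apply: bounded_measD => //; apply: bounded_measM => //; exact: bounded_meas_cst.
- move=> k1 k2 K mk1 mk2 ak k1K k2K cvgk; split; first by split=> //; exists K.
  apply: (approximable_lim mk1 mk2 k1K k2K) => [p _|n]; first exact: cvgk.
  exact: (ak n).2.
- move=> _ _ [A1 mA1 [B1 mB1 <-]] [A2 mA2 [B2 mB2 <-]].
  exists (A1 `&` A2); first exact: measurableI.
  by exists (B1 `&` B2); [exact: measurableI|rewrite setXI].
- move=> _ [A mA [B mB <-]]; split.
    split; last by exists 1 => p; exact: indic1.
    by apply: cmeasurable_real; apply: measurable_indic; exact: measurableX.
  rewrite (_ : (fun p => _) = fun p => (\1_A p.1)%:C * (\1_B p.2)%:C).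
    apply: (@approximable_rect (fun u => (\1_A u)%:C) (fun u => (\1_B u)%:C) 1 1) => //.
    + by apply: cmeasurable_real; exact: measurable_indic.
    + by move=> u; exact: indic1.
    + by apply: cmeasurable_real; exact: measurable_indic.
    + by move=> u; exact: indic1.
  by apply/funext => p; rewrite -rmorphM !indicE in_setX -natrM mulnb.
Qed.

End weighted_density.

(** * Parseval's identity for integrable functions *)

(** Integrability and linearity together, for peeling off the majorant of [cut_le] one term at a
    time. *)
Lemma Rintegral_axpy d (T : measurableType d) (R : realType)
    (m : {measure set T -> \bar R}) (D : set T) (a : R) (f g : T -> R) :
  measurable D -> m.-integrable D (EFin \o f) -> m.-integrable D (EFin \o g) ->
  m.-integrable D (EFin \o (fun x => a * f x + g x)) /\
  \int[m]_(x in D) (a * f x + g x) = a * \int[m]_(x in D) f x + \int[m]_(x in D) g x.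
Proof.
move=> mD jf jg; have jaf : m.-integrable D (EFin \o (fun x => a * f x)).
  exact: (integrableZl mD a jf).
split; first exact: (integrableD mD jaf jg).
by rewrite RintegralD// RintegralZl.
Qed.

Section integrable_parseval.
Variables (R : realType) (q : nat) (X : homogeneous_tree q).
Variable nu : probability (boundary X) R.
Hypothesis Hnu : is_boundary_measure nu.
Local Notation rho := (spectral_measure nu).
Local Notation D := (spectral_dom R X).
Local Notation T := (boundary X * measurableTypeR R)%type.
Local Notation wv := (@bwave R q X).

Let mD : measurable D := @measurable_spectral_dom R q X.

Let cm_wv y : cmeasurable D (wv y).
Proof.
by apply: cmeasurableS (cmeasurable_bwave R y).
Qed.

Lemma sqint_bwave y : sqint rho D (wv y).
Proof.
by apply: (@sqint_finite _ _ _ rho D _ _ mD (cm_wv y) (fun p _ => normc_bwave y p)).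
Qed.

Lemma cintegrable_mul_bwave (f : T -> R[i]) y : cintegrable rho D f ->
  cintegrable rho D (fun p => f p * (wv y p)^*).
Proof.
move=> cf; apply: (cintegrable_bounded mD (M := expR (ln q%:R * (dist Defs.root y)%:R / 2))) => //.
  exact: cmeasurableJ (cm_wv y).
by move=> p _; rewrite normc_conj normc_bwave.
Qed.

(** The counterpart of [cdot_comb] for an [f] that is only integrable: boundedness of the waves
    makes each product integrable. *)
Lemma cdot_bwave_comb (f : T -> R[i]) (s : seq X) (a : X -> R[i]) :
  cintegrable rho D f ->
  cdot rho D f (fun p => \sum_(y <- s) a y * wv y p) =
  \sum_(y <- s) (a y)^* * cdot rho D f (wv y).
Proof.
move=> cf; rewrite /cdot.
rewrite (_ : (fun p => _) = fun p => \sum_(y <- s) (a y)^* * (f p * (wv y p)^*)).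
  rewrite cintegral_sum//; last first.
    by move=> y; apply: cintegrableZ => //; exact: cintegrable_mul_bwave.
  by apply: eq_bigr => y _; rewrite cintegralZ//; exact: cintegrable_mul_bwave.
apply/funext => p; rewrite rmorph_sum mulr_sumr; apply: eq_bigr => y _.
by rewrite rmorphM mulrCA.
Qed.

(* Completing the square in each coefficient. *)
Lemma cdot_span_le (f v : T -> R[i]) (A : R) : cintegrable rho D f ->
  (forall s : seq X, uniq s -> \sum_(y <- s) normc (cdot rho D f (wv y)) ^+ 2 <= A) ->
  in_span wv v -> 2 * complex.Re (cdot rho D f v) - sqnorm rho D v <= A.
Proof.
move=> cf fA [s [a [us ->]]]; apply: le_trans (fA _ us).
rewrite cdot_bwave_comb// (sqnorm_comb mD sqint_bwave (cdot_bwave Hnu))//.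
rewrite re_sum mulr_sumr -sumrB; apply: ler_sum => y _.
rewrite [_^* * _]mulrC -subr_ge0.
apply: le_trans (sqr_ge0 (normc (cdot rho D f (wv y) - a y))) _.
rewrite sqr_normcB; lra.
Qed.

(** Large values are discarded and not clipped, so that the result is [z] or 0, the two cases of
    [cut_le]. *)
Definition cut (n : nat) (z : R[i]) : R[i] := if normc z <= n%:R then z else 0.

Lemma normc_cut n z : normc (cut n z) <= n%:R.
Proof. by rewrite /cut; case: ifP => // _; rewrite normc0. Qed.

(* Where [cut n z = 0] this is [2 |z| |v| <= t |z| |v|^2 + |z| / t]. *)
Lemma cut_le (n : nat) (z v : R[i]) (t : R) : 1 <= t ->
  normc (cut n z) ^+ 2 <= (2 * complex.Re (z * v^*) - normc v ^+ 2) +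
    t * (normc (cut n z - v) ^+ 2 * (1 + normc z)) + normc z / t.
Proof.
move=> t1; have t0 : 0 < t by rewrite (lt_le_trans ltr01).
have z0 := normc_ge0 z; have zt : 0 <= normc z / t by rewrite divr_ge0// ltW.
rewrite /cut; case: ifP => _.
  have := sqr_normcB z v; move: (sqr_ge0 (normc (z - v))).
  move: (normc (z - v) ^+ 2) (complex.Re _) => x r x0 xE.
  have : x <= t * (x * (1 + normc z)).
    apply: (@le_trans _ _ (x * (1 + normc z))); first by rewrite ler_peMr//; lra.
    by rewrite ler_peMl// mulr_ge0//; lra.
  by lra.
rewrite sub0r normcN normc0 expr0n /=.
have : - normc (z * v^*) <= complex.Re (z * v^*).
  by have := ler_norm_Re (z * v^*); rewrite ler_norml => /andP[].
rewrite normcM normc_conj; move: (complex.Re _) (normc_ge0 v) z0 => r.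
move: (normc v) (normc z) => x y x0 y0 H.
have : 0 <= y * ((t * x - 1) ^+ 2 / t) by rewrite mulr_ge0// divr_ge0// ?sqr_ge0// ltW.
rewrite (_ : _ * (_ / t) = t * (x ^+ 2 * y) - 2 * (y * x) + y / t); last first.
  by field; rewrite gt_eqF.
move=> K; have : x ^+ 2 <= t * x ^+ 2 by rewrite ler_peMl// sqr_ge0.
by rewrite mulrDr mulr1 mulrDr; lra.
Qed.

Lemma cut_cmeasurable n (f : T -> R[i]) : cmeasurable setT f ->
  cmeasurable setT (fun p => cut n (f p)).
Proof.
move=> mf; rewrite (_ : (fun p => _) = fun p =>
    (\1_(`]-oo, n%:R]%classic) (normc (f p)) : R)%:C * f p).
  apply: cmeasurableM => //; apply: cmeasurable_real.
  apply: (measurableT_comp (f := \1_(`]-oo, n%:R]%classic) : measurableTypeR R -> R)).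
    exact: measurable_indic.
  exact: measurable_normc.
apply/funext => p; rewrite /cut indicE.
have -> : (normc (f p) \in `]-oo, (n%:R : R)]%classic) = (normc (f p) <= n%:R).
  by apply/idP/idP; rewrite inE /= in_itv.
by case: ifP => _; rewrite ?mul1r ?mul0r.
Qed.

(** [cut_le] is integrated with [v] a combination of waves close to the cut function for the weight
    [1 + |f|]: [cdot_span_le] bounds the main part by [A], and the two error terms are at most
    [eps / 2] each. *)
Lemma sqnorm_cut_le (f : T -> R[i]) (A : R) n : cmeasurable setT f ->
  cintegrable rho D f ->
  (forall s : seq X, uniq s -> \sum_(y <- s) normc (cdot rho D f (wv y)) ^+ 2 <= A) ->
  sqnorm rho D (fun p => cut n (f p)) <= A.
Proof.
move=> mf cf fA; apply/ler_addgt0Pr => eps eps0.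
pose L := \int[rho]_(p in D) normc (f p).
have L0 : 0 <= L by apply: Rintegral_ge0 => p _; exact: normc_ge0.
(* Makes [L / t] at most [eps / 2]; the added 1 ensures the condition [1 <= t] of [cut_le]. *)
pose t := 1 + 2 * L / eps.
have t1 : 1 <= t by rewrite lerDl divr_ge0 ?mulr_ge0// ltW.
have t0 : 0 < t by rewrite (lt_le_trans ltr01).
have [_ if1] := (cintegrable_norm _ _ _).1 cf.
pose w p := 1 + normc (f p).
have w0 p : 0 <= w p by rewrite addr_ge0// normc_ge0.
have mw : measurable_fun setT w by apply: measurable_funD => //; exact: measurable_normc.
have iw : rho.-integrable D (EFin \o w).
  rewrite (_ : EFin \o w = fun p => 1%:E + (normc (f p))%:E)%E; last by apply/funext.
  by apply: integrableD => //; exact: finite_measure_integrable_cst.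
have mc := cut_cmeasurable n mf.
have bc : bounded_meas (fun p => cut n (f p)).
  by split=> //; exists n%:R => p; exact: normc_cut.
(* The division by [t] anticipates the factor [t] in front of the weighted error. *)
have e2 : 0 < eps / 2 / t by rewrite !divr_gt0.
have [v sv fv] := bounded_approximable w0 mw iw bc e2.
have [mv [M vM]] := bounded_meas_span sv.
have bv : bounded_meas v by split=> //; exists M.
have sqv : sqint rho D v.
  by apply: (@sqint_finite _ _ _ rho D _ M mD) => //; exact: cmeasurableS mv.
have mB : cmeasurable setT (fun p => cut n (f p) - v p) by exact: cmeasurableB.
have cfv : cintegrable rho D (fun p => f p * (v p)^*).
  apply: (cintegrable_bounded mD (M := M)) => //.
    by apply: cmeasurableS (cmeasurableJ mv).
  by move=> p _; rewrite normc_conj.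
have j1 := cintegrable_Re mD cfv.
have [_ j2] := sqv.
have j3 : rho.-integrable D (EFin \o (fun p => normc (cut n (f p) - v p) ^+ 2 * w p)).
  apply/integrableP; split; first exact: measurable_weighted.
  apply: le_lt_trans (ltry (eps / 2 / t)); apply: le_trans fv.
  rewrite /wnorm le_eqVlt; apply/orP; left; apply/eqP; apply: eq_integral => p _.
  by rewrite gee0_abs// lee_fin mulr_ge0// sqr_ge0.
have I3 : \int[rho]_(p in D) (normc (cut n (f p) - v p) ^+ 2 * w p) <= eps / 2 / t.
  rewrite -lee_fin; apply: le_trans fv; rewrite /Rintegral fineK//.
  exact: integrable_fin_num j3.
have j0 : rho.-integrable D (EFin \o (fun=> 0 : R)) by exact: finite_measure_integrable_cst.
have [k4 I4] := Rintegral_axpy t^-1 mD if1 j0.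
have [k3 J3] := Rintegral_axpy t mD j3 k4.
have [k2 J2] := Rintegral_axpy (- 1) mD j2 k3.
have [k1 J1] := Rintegral_axpy 2 mD j1 k2.
rewrite /sqnorm.
apply: (le_trans (le_Rintegral mD _ k1 _)).
- apply: (@sqint_finite _ _ _ rho D _ n%:R mD _ (fun p _ => normc_cut n (f p))).2.
  by apply: cmeasurableS mc.
- move=> p _; apply: le_trans (cut_le n (f p) (v p) t1) _.
  by rewrite /w addr0 mulN1r [t^-1 * _]mulrC !addrA.
rewrite J1 J2 J3 I4.
have := cdot_span_le cf fA sv; rewrite /cdot /cintegral /sqnorm /= -/L => H.
have /(ler_wpM2l (ltW t0)) := I3; rewrite (mulrC t (_ / t)) divfK ?gt_eqF// => H3.
have H4 : t^-1 * L <= eps / 2.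
  rewrite mulrC ler_pdivrMr// /t mulrDr mulr1 (_ : eps / 2 * _ = L); last by field; rewrite gt_eqF.
  by rewrite lerDr divr_ge0// ltW.
by rewrite Rintegral_cst// mul0r addr0; lra.
Qed.

(** Bessel's inequality gives one half when [f] is square integrable. For the other half the bound
    of [sqnorm_cut_le] is uniform in [n], so monotone convergence yields square integrability as a
    conclusion. *)
Theorem parseval_bwave (f : T -> R[i]) : cintegrable rho D f ->
  (\esum_(y in [set: X]) (normc (cdot rho D f (wv y)) ^+ 2)%:E =
   \int[rho]_(p in D) (normc (f p) ^+ 2)%:E)%E.
Proof.
move=> cf; apply/eqP; rewrite eq_le; apply/andP; split.
  have [fin|] := ltP (\int[rho]_(p in D) (normc (f p) ^+ 2)%:E)%E +oo%E; last first.
    by move=> /(le_trans _) ->//; exact: leey.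
  have sf : sqint rho D f by apply/sqintP; split=> //; exact: cf.1.
  apply: esum_le_seq => s us; rewrite sumEFin (sqnormE mD sf) lee_fin.
  exact: (bessel mD sqint_bwave (cdot_bwave Hnu)).
have [fin|] := ltP (\esum_(y in [set: X]) (normc (cdot rho D f (wv y)) ^+ 2)%:E)%E +oo%E; last first.
  by move=> /(le_trans _) ->//; exact: leey.
(* Extension by 0: the approximation results ask for measurability on the whole space, and [f] is
   measurable on [D] only. *)
pose g p := (\1_D p)%:C * f p.
have fg p : D p -> g p = f p by move=> Dp; rewrite /g indicE mem_set// mul1r.
have mg : cmeasurable setT g.
  have [[m1 m2] _] := cf; split.
    rewrite (_ : (fun p => _) = (fun p => complex.Re (f p)) \_ D).
      exact/(measurable_restrictT _ mD).
    apply/funext => p; rewrite patchE /g indicE; case: ifP => _; rewrite ?mul1r ?mul0r//.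
  rewrite (_ : (fun p => _) = (fun p => complex.Im (f p)) \_ D).
    exact/(measurable_restrictT _ mD).
  by apply/funext => p; rewrite patchE /g indicE; case: ifP => _; rewrite ?mul1r ?mul0r.
have cg : cintegrable rho D g.
  split; first exact: cmeasurableS mg.
  rewrite (eq_integral (fun p => (normc (f p))%:E)); first exact: cf.2.
  by move=> p /set_mem Dp; rewrite fg.
set E := (\esum_(y in _) _)%E in fin *.
have E0 : (0 <= E)%E by apply: esum_ge0 => y _; rewrite lee_fin sqr_ge0.
have gA (s : seq X) : uniq s -> \sum_(y <- s) normc (cdot rho D g (wv y)) ^+ 2 <= fine E.
  move=> us; rewrite -lee_fin fineK ?ge0_fin_numE// -sumEFin.
  rewrite (eq_bigr (fun y => (normc (cdot rho D f (wv y)) ^+ 2)%:E)).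
    by apply: seq_le_esum => // y; rewrite lee_fin sqr_ge0.
  move=> y _; congr ((normc _ ^+ 2)%:E); apply: eq_cintegral.
  by move=> p /set_mem Dp; rewrite fg.
rewrite (eq_integral (fun p => limn (fun n => (normc (cut n (g p)) ^+ 2)%:E))); last first.
  move=> p /set_mem Dp; rewrite -fg//; apply/esym/cvg_lim => //.
  apply: cvg_near_cst; exists (Num.truncn (normc (g p))).+1 => // n /= gn.
  rewrite /cut ifT// ltW// (lt_le_trans (truncnS_gt _))// ler_nat//.
have mcut n : measurable_fun D (fun p => (normc (cut n (g p)) ^+ 2)%:E).
  apply/measurable_EFinP/measurable_sqr_normc; apply: cmeasurableS (cut_cmeasurable n mg) => //.
have cvgI := cvg_monotone_convergence (mu := rho) mD mcut.
rewrite -(cvg_lim _ (cvgI _ _))//; last 2 first.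
- by move=> n p _; rewrite lee_fin sqr_ge0.
- move=> p _ n m nm; rewrite lee_fin /cut; case: ifPn => [gn|_].
    by rewrite ifT// (le_trans gn)// ler_nat.
  by rewrite normc0 expr0n sqr_ge0.
apply: lime_le.
  apply/cvg_ex; eexists; apply: cvgI.
  - by move=> n p _; rewrite lee_fin sqr_ge0.
  - move=> p _ n m nm; rewrite lee_fin /cut; case: ifPn => [gn|_].
      by rewrite ifT// (le_trans gn)// ler_nat.
    by rewrite normc0 expr0n sqr_ge0.
apply: nearW => n.
have sq : sqint rho D (fun p => cut n (g p)).
  apply: (@sqint_finite _ _ _ rho D _ n%:R mD _ (fun p _ => normc_cut n (g p))).
  exact: cmeasurableS (cut_cmeasurable n mg).
by rewrite (sqnormE mD sq) -(fineK (x := E)) ?ge0_fin_numE// lee_fin sqnorm_cut_le.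
Qed.

End integrable_parseval.

(** * Counting measure on the vertices *)

Section counting_measure_vertices.
Variables (R : realType) (q : nat) (X : homogeneous_tree q).

(* [counting] already carries a canonical sigma-finite structure, on [nat], so an
   alias is needed to give it another one on [X]. *)
Definition vertex_counting : set X -> \bar R := counting.

HB.instance Definition _ := Measure.on vertex_counting.

Lemma measurable_fun_vertices d (T : measurableType d) (f : X -> T) : measurable_fun setT f.
Proof. by []. Qed.

(** Fibres of an injection into the natural numbers; they reduce integrals and measurability over
    the vertices to single vertices. *)
Lemma vertex_layers : exists F : nat -> set X, [/\ \bigcup_n F n = setT, trivIset setT F &
  forall n, F n = set0 \/ exists x, F n = [set x]].
Proof.
have /countable_injP[c cI] := countable_tree X.
exists (fun n => c @^-1` [set n]); split.
- by apply/seteqP; split=> // x _; exists (c x).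
- exact: trivIset_preimage1.
- move=> n; have [[x cx]|nx] := pselect (exists x, c x = n).
    right; exists x; apply/seteqP; split=> [y /= cy|_ ->//].
    by apply: cI; rewrite ?inE// cy cx.
  by left; apply/seteqP; split=> // y /= cy; apply: nx; exists y.
Qed.

Lemma counting1 (x : X) : (counting [set x] : \bar R) = 1%E.
Proof. by rewrite /counting asboolT// fset_set1 finmap.cardfs1. Qed.

Lemma integral_vertices (f : X -> \bar R) : (forall x, 0 <= f x)%E ->
  (\int[counting]_(x in setT) f x = \esum_(x in [set: X]) f x)%E.
Proof.
move=> f0; have [F [FT tF F1]] := vertex_layers.
rewrite -{1}FT ge0_integral_bigcup//.
rewrite nneseries_esumT; last by move=> n; exact: integral_ge0.
rewrite -FT esum_bigcupT//; apply: eq_esum => n _.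
case: (F1 n) => [->|[x ->]]; first by rewrite integral_set0 esum_set0.
rewrite esum_set1// (eq_integral (cst (f x))); last by move=> y /set_mem ->.
by rewrite integral_cst//= counting1 mule1.
Qed.

Lemma sigma_finite_vertices : sigma_finite [set: X] vertex_counting.
Proof.
have [F [FT _ F1]] := vertex_layers; exists F => // n; split=> //.
case: (F1 n) => [->|[x ->]]; first by rewrite measure0.
by rewrite /vertex_counting counting1 ltry.
Qed.

HB.instance Definition _ := @Measure_isSigmaFinite.Build _ _ _ vertex_counting sigma_finite_vertices.

Lemma exchange_esum (I J : choiceType) (a : I -> J -> \bar R) :
  (forall i j, 0 <= a i j)%E ->
  (\esum_(i in [set: I]) \esum_(j in [set: J]) a i j =
   \esum_(j in [set: J]) \esum_(i in [set: I]) a i j)%E.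
Proof.
move=> a0; rewrite !esum_esum//.
rewrite (reindex_esum ([set: J] `*`` fun=> [set: I]) _ (fun k => (k.2, k.1)))//.
split=> //= [[j i] [j' i'] _ _ /= [-> ->]//|[i j] _]; by exists (j, i).
Qed.

Variable nu : probability (boundary X) R.
Local Notation rho := (spectral_measure nu).
Local Notation D := (spectral_dom R X).
Local Notation S := (boundary X * measurableTypeR R)%type.

Let mD : measurable D := @measurable_spectral_dom R q X.

Lemma measurable_phase_dom : measurable (phase_dom R X).
Proof. exact: measurableX. Qed.

Lemma integral_phase (f : X * S -> \bar R) :
  measurable_fun (phase_dom R X) f -> (forall p, 0 <= f p)%E ->
  (\int[phase_measure nu]_(p in phase_dom R X) f p =
   \esum_(x in [set: X]) \int[rho]_(p in D) f (x, p))%E.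
Proof.
move=> mf f0; pose g := f \_ (phase_dom R X).
have mg : measurable_fun setT g by exact/(measurable_restrictT _ measurable_phase_dom).
have g0 p : (0 <= g p)%E by rewrite /g patchE; case: ifP.
rewrite integral_mkcond.
pose c : {sigma_finite_measure set X -> \bar R} := vertex_counting.
pose r : {sigma_finite_measure set S -> \bar R} := rho.
have /= -> := @fubini_tonelli1 _ _ _ _ _ c r g mg g0.
rewrite -integral_vertices.
  apply: eq_integral => x _; rewrite /fubini_F [RHS]integral_mkcond.
  apply: eq_integral => p _; rewrite /g !patchE.
  rewrite (_ : ((x, p) \in _) = (p \in D))//.
  by apply/idP/idP => /set_mem H; apply/mem_set; [case: H|split].
by move=> x; apply: integral_ge0.
Qed.

(** The vertices are countable and every set of them is measurable, so a preimage is a countable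
    union of strips over single vertices. *)
Lemma measurable_phase_sections d (T : measurableType d) (f : X * S -> T) :
  (forall x, measurable_fun setT (fun p => f (x, p))) -> measurable_fun setT f.
Proof.
move=> mf _ B mB; have [F [FT tF F1]] := vertex_layers.
rewrite setTI (_ : _ @^-1` _ = \bigcup_n ((f @^-1` B) `&` (F n `*` setT))); last first.
  apply/seteqP; split=> [[x p] /= fB|_ [n _ []]//].
  have [n _ Fx] : (\bigcup_n F n) x by rewrite FT.
  by exists n.
apply: bigcupT_measurable => n; case: (F1 n) => [->|[x ->]].
  by rewrite set0X setI0.
rewrite (_ : _ `&` _ = [set x] `*` ((fun p => f (x, p)) @^-1` B)).
  by apply: measurableX => //; have := mf x measurableT _ mB; rewrite setTI.
by apply/seteqP; split=> -[y p] [/=]; [move=> fB [/= <-]|move=> ->].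
Qed.

Lemma cmeasurable_section (b : X * S -> R[i]) x :
  cmeasurable (phase_dom R X) b -> cmeasurable D (fun p => b (x, p)).
Proof.
move=> [m1 m2]; split.
  apply: (measurable_comp measurable_phase_dom _ m1 (measurable_funTS (pair1_measurable x))).
  by move=> _ [p Dp <-]; split.
apply: (measurable_comp measurable_phase_dom _ m2 (measurable_funTS (pair1_measurable x))).
by move=> _ [p Dp <-]; split.
Qed.

End counting_measure_vertices.

(** * Operators on square-summable functions *)

Section square_summable.
Variables (R : realType) (q : nat) (X : homogeneous_tree q).
Local Notation cnt := (counting : set X -> \bar R).
Implicit Types f g k : X -> R[i].

Lemma cmeasurable_vertices f : cmeasurable setT f.
Proof. by split; exact: measurable_fun_vertices. Qed.

Lemma ell2P f : ell2 f <-> sqint cnt setT f.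
Proof.
rewrite sqintP; split=> -[mf H]; split=> //.
  by apply: (lty_poweRy _ H); rewrite invr_eq0.
exact: poweR_lty.
Qed.

Lemma ell2normE f : ell2 f -> ell2norm f = (Num.sqrt (sqnorm cnt setT f))%:E.
Proof.
move=> /ell2P f2; rewrite /ell2norm /L2norm (sqnormE measurableT f2) poweR_EFin.
by rewrite powR12_sqrt// sqnorm_ge0.
Qed.

Lemma sqnorm_esum f : ell2 f ->
  (\esum_(x in [set: X]) (normc (f x) ^+ 2)%:E = (sqnorm cnt setT f)%:E)%E.
Proof.
move=> /ell2P f2; rewrite -(sqnormE measurableT f2) integral_vertices// => x.
by rewrite lee_fin sqr_ge0.
Qed.

Lemma sqr_ell2norm f :
  (ell2norm f `^ 2 = \esum_(x in [set: X]) (normc (f x) ^+ 2)%:E)%E.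
Proof.
rewrite /ell2norm /L2norm -poweRrM mulVf// poweRe1.
  by rewrite integral_vertices// => x; rewrite lee_fin sqr_ge0.
by apply: integral_ge0 => x _; rewrite lee_fin sqr_ge0.
Qed.

Lemma esum_lty_ell2 f :
  (\esum_(x in [set: X]) (normc (f x) ^+ 2)%:E < +oo)%E -> ell2 f.
Proof.
move=> H; apply/ell2P/sqintP; split; first exact: cmeasurable_vertices.
by rewrite integral_vertices// => x; rewrite lee_fin sqr_ge0.
Qed.

Lemma normc_le_sqnorm f x : ell2 f -> normc (f x) ^+ 2 <= sqnorm cnt setT f.
Proof.
move=> f2; rewrite -lee_fin -(sqnorm_esum f2).
have := @seq_le_esum R X (fun x => (normc (f x) ^+ 2)%:E) [:: x].
by rewrite big_seq1; apply=> // y; rewrite lee_fin sqr_ge0.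
Qed.

Definition delta (y x : X) : R[i] := (x == y)%:R.

Lemma integral_single (h : X -> \bar R) y : (forall x, x != y -> h x = 0%E) ->
  (\int[counting]_(x in setT) h x = h y)%E.
Proof.
move=> h0; rewrite (_ : h = (cst (h y)) \_ [set y]); last first.
  apply/funext => x; rewrite patchE; case: ifPn => [/set_mem -> //|xy].
  by apply: h0; apply: contra xy => /eqP ->; rewrite inE.
rewrite -integral_mkcond integral_cst//= counting1 mule1.
by rewrite patchE ifT ?inE.
Qed.

Lemma cintegral_single f y : (forall x, x != y -> f x = 0) ->
  cintegral cnt setT f = f y.
Proof.
move=> f0; rewrite /cintegral /Rintegral !(integral_single (y := y)) /=; first by case: (f y).
- by move=> x xy; rewrite f0.
- by move=> x xy; rewrite f0.
Qed.

Lemma ell2_delta y : ell2 (delta y).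
Proof.
apply/ell2P/sqintP; split; first exact: cmeasurable_vertices.
rewrite (integral_single (y := y)) ?ltry// => x xy.
by rewrite /delta (negbTE xy) normc0 expr0n.
Qed.

Let sqint_delta y : sqint cnt setT (delta y). Proof. exact/ell2P/ell2_delta. Qed.

Lemma cdot_delta f y : cdot cnt setT f (delta y) = f y.
Proof.
rewrite /cdot (cintegral_single (y := y)) /delta ?eqxx.
  by rewrite (conjc_realC (1 : R)) mulr1.
by move=> x xy; rewrite (negbTE xy) (conjc_realC (0 : R)) mulr0.
Qed.

Lemma cdot_deltal f y : cdot cnt setT (delta y) f = (f y)^*.
Proof.
rewrite /cdot (cintegral_single (y := y)) /delta ?eqxx ?mul1r// => x xy.
by rewrite (negbTE xy) mul0r.
Qed.

Lemma delta_orthonormal y y' : cdot cnt setT (delta y) (delta y') = (y == y')%:R.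
Proof. by rewrite cdot_delta /delta eq_sym. Qed.

(** Otherwise all finite partial sums would be at most the squared norm minus [eps], and so would
    their supremum, which is the squared norm. *)
Lemma delta_dense f (eps : R) : ell2 f -> 0 < eps -> exists2 s : seq X, uniq s &
  sqnorm cnt setT (fun x => f x - \sum_(y <- s) f y * delta y x) < eps.
Proof.
move=> f2 eps0; apply: contrapT => H.
suff : 0 <= - eps by rewrite oppr_ge0 leNgt eps0.
rewrite -(lerD2l (sqnorm cnt setT f)) addr0 -lee_fin -(sqnorm_esum f2); apply: esum_le_seq => s us.
rewrite sumEFin lee_fin leNgt; apply/negP => lt; apply: H; exists s => //.
rewrite (sqnorm_sub_comb measurableT sqint_delta delta_orthonormal)//; last exact/ell2P.
under eq_bigr do rewrite cdot_delta.
rewrite [X in _ + X]big1 ?addr0; first by lra.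
by move=> y _; rewrite cdot_delta subrr normc0 expr0n.
Qed.

Lemma delta_basis : orthonormal_basis delta.
Proof.
split=> [y|y y'|f f2 eps eps0]; [exact: ell2_delta|exact: delta_orthonormal|].
have [|s us fs] := delta_dense f2 (eps := eps ^+ 2); first by rewrite exprn_gt0.
exists s, f; rewrite ell2normE.
  by rewrite lte_fin -(ger0_norm (ltW eps0)) -sqrtr_sqr ltr_sqrt// exprn_gt0.
apply/ell2P/sqintB => //; first exact/ell2P.
by apply: sqint_sum => // y; exact: sqintZ.
Qed.

(** * Rows of a bounded operator *)

Section rows.
Variable S : (X -> R[i]) -> X -> R[i].
Hypothesis bS : bounded_operator S.

(** Conjugated, since [cdot] conjugates its second argument and [S f x] is to become [cdot] of [f]
    with the row. *)
Definition conj_row x y : R[i] := (S (delta y) x)^*.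

Lemma operator0 : S (fun=> 0) = fun=> 0.
Proof.
have [_ lS _] := bS; have z2 : @ell2 R q X (fun=> 0) by apply/ell2P; exact: sqint0.
have := lS (-1) _ _ z2 z2; rewrite (_ : (fun x : X => _) = fun=> 0); last first.
  by apply/funext => x; rewrite mulr0 addr0.
by move=> ->; apply/funext => x; rewrite mulN1r addNr.
Qed.

Lemma operator_comb (s : seq X) (a : X -> R[i]) x :
  S (fun x => \sum_(y <- s) a y * delta y x) x = \sum_(y <- s) a y * (conj_row x y)^*.
Proof.
have [_ lS _] := bS; elim: s => [|y s IH].
  rewrite big_nil (_ : (fun x => _) = fun=> 0) ?operator0//.
  by apply/funext => z; rewrite big_nil.
rewrite big_cons -IH (_ : (fun x => _) = fun x =>
    a y * delta y x + \sum_(y <- s) a y * delta y x); last first.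
  by apply/funext => z; rewrite big_cons.
rewrite lS; [by rewrite /conj_row conjcI|exact: ell2_delta|].
by apply/ell2P/sqint_sum => // z; exact: sqintZ.
Qed.

Lemma operator_bound : exists2 M : R, 0 <= M &
  forall f x, ell2 f -> normc (S f x) ^+ 2 <= M * sqnorm cnt setT f.
Proof.
have [S2 _ [M SM]] := bS; exists (M ^+ 2) => [|f x f2]; first exact: sqr_ge0.
apply: le_trans (normc_le_sqnorm x (S2 _ f2)) _.
have := SM f f2; rewrite !ell2normE//; last exact: S2.
rewrite -EFinM lee_fin => H.
rewrite -(sqr_sqrtr (sqnorm_ge0 cnt setT (S f))) -(sqr_sqrtr (sqnorm_ge0 cnt setT f)).
by rewrite -exprMn lerXn2r// nnegrE ?sqrtr_ge0// (le_trans _ H)// sqrtr_ge0.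
Qed.

(** The operator is tested on a finite piece of the row itself: with [Q] the squared norm of that
    piece, boundedness says [Q^2 <= M Q]. *)
Lemma ell2_conj_row x : ell2 (conj_row x).
Proof.
have [M M0 SM] := operator_bound; apply: esum_lty_ell2.
apply: le_lt_trans (ltry M); apply: esum_le_seq => s us; rewrite sumEFin lee_fin.
set Q := \sum_(y <- s) _.
have f2 : ell2 (fun z => \sum_(y <- s) conj_row x y * delta y z).
  by apply/ell2P/sqint_sum => // z; exact: sqintZ.
have := SM _ x f2; rewrite operator_comb.
rewrite (sqnorm_comb measurableT sqint_delta delta_orthonormal)// -/Q.
rewrite (_ : \sum_(y <- s) _ = Q%:C); last first.
  by rewrite /Q rmorph_sum; apply: eq_bigr => y _; rewrite mulcJ.
have Q0 : 0 <= Q by apply: sumr_ge0 => y _; exact: sqr_ge0.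
rewrite normc_real ger0_norm// expr2 => H.
have [->//|Qn] := eqVneq Q 0.
by move: H; rewrite ler_pM2r// lt_neqAle eq_sym Qn.
Qed.

(** Riesz representation made explicit: both sides agree on finite combinations of the [delta]s and
    are continuous in [f]. *)
Lemma operator_row f x : ell2 f -> S f x = cdot cnt setT f (conj_row x).
Proof.
move=> f2; have [M M0 SM] := operator_bound; have [_ lS _] := bS.
have r2 : sqint cnt setT (conj_row x) by exact/ell2P/ell2_conj_row.
have f2' : sqint cnt setT f by exact/ell2P.
set N := sqnorm cnt setT (conj_row x); have N0 : 0 <= N by exact: sqnorm_ge0.
apply/eqP; rewrite -subr_eq0; apply/eqP/eq0_normc/eqP.
rewrite -sqrf_eq0 eq_le sqr_ge0 andbT; apply/ler_addgt0Pr => eps eps0; rewrite add0r.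
(* [2 M] and [2 N] come from the errors of [S g x] and of the inner product of [g] with the row; the
   1 keeps the denominator positive. *)
have C0 : 0 < 2 * M + 2 * N + 1 by lra.
have e0 : 0 < eps / (2 * M + 2 * N + 1) by rewrite divr_gt0.
have [s us fs] := delta_dense f2 e0.
set v := fun x => \sum_(y <- s) f y * delta y x.
set g := fun x => f x - \sum_(y <- s) f y * delta y x in fs *.
have v2 : sqint cnt setT v by apply: sqint_sum => // z; exact: sqintZ.
have g2 : sqint cnt setT g by apply: sqintB.
have Sf : S f x = S g x + S v x.
  rewrite {1}(_ : f = fun x => 1 * g x + v x); last first.
    by apply/funext => z; rewrite mul1r /g subrK.
  by rewrite lS ?mul1r//; exact/ell2P.
have cf : cdot cnt setT f (conj_row x) = cdot cnt setT g (conj_row x) + cdot cnt setT v (conj_row x).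
  by rewrite -cdotDl//; congr cdot; apply/funext => z; rewrite /g subrK.
have Sv : S v x = cdot cnt setT v (conj_row x).
  rewrite operator_comb /v cdot_suml//; apply: eq_bigr => y _.
  by rewrite cdot_deltal.
rewrite Sf cf Sv (_ : _ - _ = S g x - cdot cnt setT g (conj_row x)); last by ring.
apply: le_trans (sqr_normcD_le _ _) _; rewrite normcN.
have h1 : normc (S g x) ^+ 2 <= M * sqnorm cnt setT g by apply: SM; exact/ell2P.
have h2 := cauchy_schwarz measurableT g2 r2; rewrite -/N in h2.
have : (2 * M + 2 * N + 1) * sqnorm cnt setT g <= eps.
  by rewrite mulrC -ler_pdivlMr// ltW.
have := sqnorm_ge0 cnt setT g; move: (sqnorm _ _ g) h1 h2 => G; lra.
Qed.

End rows.

(** Each [S (e i) x] is, up to conjugation, a coefficient of the row [k x]. After exchanging the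
    sums, Parseval's identity in each row removes the basis. *)
Lemma HSnorm_rows (I : choiceType) (e : I -> X -> R[i]) (S : (X -> R[i]) -> X -> R[i])
    (k : X -> X -> R[i]) :
  orthonormal_basis e -> (forall x, ell2 (k x)) ->
  (forall f x, ell2 f -> S f x = cdot cnt setT f (k x)) ->
  (HSnorm e S =
   (\esum_(x in [set: X]) \esum_(y in [set: X]) (normc (k x y) ^+ 2)%:E) `^ 2^-1)%E.
Proof.
move=> [e2 oe de] k2 SE; congr (_ `^ _)%E.
under eq_esum do rewrite sqr_ell2norm.
rewrite exchange_esum; last by move=> i x; rewrite lee_fin sqr_ge0.
apply: eq_esum => x _; rewrite sqnorm_esum// -sqnormE//; last exact/ell2P.
rewrite -(parseval measurableT _ oe)//.
- apply: eq_esum => i _; rewrite SE// cdotC ?normc_conj//; exact/ell2P.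
- by move=> i; exact/ell2P.
- exact/ell2P.
- move=> eps eps0; have [|s [a sa]] := de (k x) (k2 x) (Num.sqrt eps); first by rewrite sqrtr_gt0.
  exists (fun x => \sum_(i <- s) a i * e i x); first exact: in_span_sum.
  move: sa; rewrite ell2normE ?lte_fin ?ltr_sqrt//.
  apply/ell2P/sqintB => //; first exact/ell2P.
  by apply: sqint_sum => // i; apply: sqintZ => //; exact/ell2P.
Qed.

End square_summable.

(** * Pseudo-differential operators *)

Section pseudo_differential_kernel.
Variables (R : realType) (q : nat) (X : homogeneous_tree q).
Variable nu : probability (boundary X) R.
Hypothesis Hnu : is_boundary_measure nu.
Local Notation rho := (spectral_measure nu).
Local Notation D := (spectral_dom R X).
Local Notation T := (boundary X * measurableTypeR R)%type.
Local Notation wv := (@bwave R q X).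
Local Notation cnt := (counting : set X -> \bar R).
Variable sigma : X * T -> R[i].
Hypothesis Hsigma : cmeasurable (phase_dom R X) sigma.

Let mD : measurable D := @measurable_spectral_dom R q X.

(** The function [b] of the theorem, in terms of waves. *)
Definition conj_symbol (p : X * T) : R[i] := (sigma p)^* * wv p.1 p.2.

Lemma cmeasurable_conj_symbol : cmeasurable (phase_dom R X) conj_symbol.
Proof.
apply: cmeasurableM; first exact: cmeasurableJ.
apply: (cmeasurableS (E := setT)) => //; split; apply: measurable_phase_sections => x.
  by have [] := cmeasurable_bwave R x.
by have [] := cmeasurable_bwave R x.
Qed.

Lemma helgason_seq (f : X -> R[i]) (s : seq X) p : uniq s ->
  (forall y, y \notin s -> f y = 0) ->
  helgason f p = \sum_(y <- s) f y * wv y p.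
Proof.
move=> us fs; rewrite /helgason (fsbigE s)//.
  by apply: eq_big => y; rewrite ?in_setT.
by move=> y _ /fs ->; rewrite mul0r.
Qed.

Lemma finite_support (f : X -> R[i]) : finitely_supported f ->
  exists2 s : seq X, uniq s & forall y, y \notin s -> f y = 0.
Proof.
move=> /finite_seqP[s sE]; exists (undup s); first exact: undup_uniq.
move=> y; rewrite mem_undup => ys; apply: contrapT => /eqP fy.
have : [set` s] y by rewrite -sE.
by rewrite /= (negbTE ys).
Qed.

Lemma finitely_supported_delta y : finitely_supported (@delta R q X y).
Proof.
apply: (sub_finite_set (B := [set y])) => // x /=; rewrite /delta.
by have [->//|_] := eqVneq x y; rewrite eqxx.
Qed.

(** Both the convergence of the operator on finitely supported functions and its matrix are read off
    from this form. *)
Lemma pdo_integrand_seq (f : X -> R[i]) (s : seq X) x : uniq s ->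
  (forall y, y \notin s -> f y = 0) ->
  pdo_integrand sigma f x = fun p =>
    \sum_(y <- s) f y * (conj_symbol (x, p) * (wv y p)^*)^*.
Proof.
move=> us fs; apply/funext => p; rewrite /pdo_integrand (helgason_seq _ us fs) mulr_sumr.
apply: eq_bigr => y _; rewrite /conj_symbol /=.
have conj3 (a u v : R[i]) : (a^* * u * v^*)^* = a * u^* * v.
  by rewrite !conjcM !conjcI.
have -> : qpow q ((2^-1 -i* p.2) * (height R p.1 x)%:C) = (wv x p)^*.
  rewrite /bwave /wave /qpow conj_cexp; congr cexp.
  by apply: complex_eq; rewrite !reim /=; ring.
by rewrite conj3 mulrCA mulrA [_^* * _]mulrC mulrA.
Qed.

Section converging.
Hypothesis cs : forall x, cintegrable rho D (fun p => conj_symbol (x, p)).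

Let cterm x y : cintegrable rho D (fun p => (conj_symbol (x, p) * (wv y p)^*)^*).
Proof. by apply: (cintegrableJ mD); exact: (cintegrable_mul_bwave y (cs x)). Qed.

Lemma pdo_seq (f : X -> R[i]) (s : seq X) x : uniq s ->
  (forall y, y \notin s -> f y = 0) ->
  pdo nu sigma f x =
  \sum_(y <- s) f y * (cdot rho D (fun p => conj_symbol (x, p)) (wv y))^*.
Proof.
move=> us fs; rewrite /pdo (pdo_integrand_seq _ us fs) cintegral_sum//; last first.
  by move=> y; exact: (cintegrableZ mD _ (cterm x y)).
by apply: eq_bigr => y _; rewrite cintegralZ// (cintegralJ mD (cintegrable_mul_bwave y (cs x))).
Qed.

Lemma pdo_converges_symbol : pdo_converges nu sigma.
Proof.
move=> f /finite_support[s us fs] x; rewrite (pdo_integrand_seq _ us fs).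
by apply: cintegrable_sum => // y; exact: (cintegrableZ mD _ (cterm x y)).
Qed.

Definition symbol_row x y : R[i] := cdot rho D (fun p => conj_symbol (x, p)) (wv y).

Lemma esum_symbol_row :
  (\esum_(x in [set: X]) \esum_(y in [set: X]) (normc (symbol_row x y) ^+ 2)%:E =
   \int[phase_measure nu]_(p in phase_dom R X) (normc (conj_symbol p) ^+ 2)%:E)%E.
Proof.
rewrite integral_phase; first by apply: eq_esum => x _; exact: parseval_bwave.
  exact/measurable_EFinP/measurable_sqr_normc/cmeasurable_conj_symbol.
by move=> p; rewrite lee_fin sqr_ge0.
Qed.

Lemma HSnorm_symbol_row (I : choiceType) (e : I -> X -> R[i]) (S : (X -> R[i]) -> X -> R[i]) :
  orthonormal_basis e -> (forall x, ell2 (symbol_row x)) ->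
  (forall f x, ell2 f -> S f x = cdot cnt setT f (symbol_row x)) ->
  HSnorm e S = L2norm (phase_measure nu) (phase_dom R X) conj_symbol.
Proof. by move=> be r2 SE; rewrite (HSnorm_rows be r2 SE) esum_symbol_row. Qed.

(** A bounded operator is determined by its rows, and these by its values at the [delta]s, where [S]
    agrees with the pseudo-differential operator. *)
Lemma HSnorm_pdo (I : choiceType) (e : I -> X -> R[i]) (S : (X -> R[i]) -> X -> R[i]) :
  orthonormal_basis e -> bounded_operator S -> pdo_extends_to nu sigma S ->
  HSnorm e S = L2norm (phase_measure nu) (phase_dom R X) conj_symbol.
Proof.
move=> be bS Sext.
have rowE x : conj_row S x = symbol_row x.
  apply/funext => y; rewrite /conj_row (Sext _ (finitely_supported_delta y)).
  rewrite (@pdo_seq _ [:: y])//.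
    by rewrite big_seq1 /delta eqxx mul1r conjcI.
  by move=> y'; rewrite inE /delta => /negbTE ->.
apply: HSnorm_symbol_row => // [x|f x f2]; rewrite -rowE; first exact: ell2_conj_row.
exact: operator_row.
Qed.

Hypothesis b2 : (\int[phase_measure nu]_(p in phase_dom R X)
   (normc (conj_symbol p) ^+ 2)%:E < +oo)%E.

(** [helgason] is a finite sum, meant for finite supports, so the extension to square-summable
    functions is defined through the matrix. *)
Definition row_operator (f : X -> R[i]) (x : X) : R[i] := cdot cnt setT f (symbol_row x).

Lemma ell2_symbol_row x : ell2 (symbol_row x).
Proof.
apply: esum_lty_ell2; apply: le_lt_trans b2; rewrite -esum_symbol_row.
have := @seq_le_esum R X (fun x => \esum_(y in [set: X]) (normc (symbol_row x y) ^+ 2)%:E)%E [:: x].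
rewrite big_seq1; apply=> // z; apply: esum_ge0 => y _.
by rewrite lee_fin sqr_ge0.
Qed.

(** Cauchy-Schwarz in each row; the squared norms of the rows add up to that of [b]. *)
Lemma bounded_row_operator : bounded_operator row_operator.
Proof.
move: (b2); set B := (\int[phase_measure nu]_(p in phase_dom R X) _)%E => Bfin.
have B0 : (0 <= B)%E by apply: integral_ge0 => p _; rewrite lee_fin sqr_ge0.
have BE : B = (fine B)%:E by rewrite fineK// ge0_fin_numE.
have r2 x : sqint cnt setT (symbol_row x) by apply/ell2P; exact: ell2_symbol_row.
have bound f : ell2 f -> (\esum_(x in [set: X]) (normc (row_operator f x) ^+ 2)%:E <=
    (fine B * sqnorm cnt setT f)%:E)%E.
  move=> f2; have f2' : sqint cnt setT f by exact/ell2P.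
  apply: esum_le_seq => s us.
  apply: (@le_trans _ _ (\sum_(x <- s) (sqnorm cnt setT f * sqnorm cnt setT (symbol_row x))%:E)%E).
    by apply: lee_sum => x _; rewrite lee_fin; exact: cauchy_schwarz.
  rewrite sumEFin -mulr_sumr mulrC lee_fin ler_wpM2r ?sqnorm_ge0//.
  rewrite -lee_fin -BE /B -esum_symbol_row -sumEFin.
  rewrite (eq_bigr (fun x => \esum_(y in [set: X]) (normc (symbol_row x y) ^+ 2)%:E)%E).
    by apply: seq_le_esum => // x; apply: esum_ge0 => y _; rewrite lee_fin sqr_ge0.
  by move=> x _; rewrite sqnorm_esum//; exact: ell2_symbol_row.
have ell2r f : ell2 f -> ell2 (row_operator f).
  by move=> f2; apply: esum_lty_ell2; apply: le_lt_trans (bound f f2) _; rewrite ltry.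
split=> //.
- move=> a f g f2 g2; apply/funext => x.
  have [f2' g2'] : sqint cnt setT f /\ sqint cnt setT g by split; exact/ell2P.
  by rewrite /row_operator cdotDl ?cdotZl//; exact: sqintZ.
- exists (Num.sqrt (fine B)) => f f2; rewrite (ell2normE f2) (ell2normE (ell2r _ f2)) -EFinM lee_fin.
  rewrite -sqrtrM ?fine_ge0// ler_wsqrtr// -lee_fin -(sqnorm_esum (ell2r _ f2)).
  exact: bound.
Qed.

Lemma row_operator_extends : pdo_extends_to nu sigma row_operator.
Proof.
move=> f /finite_support[s us fs]; apply/funext => x; rewrite (pdo_seq _ us fs).
have d2 y : sqint cnt setT (@delta R q X y) by exact/ell2P/ell2_delta.
rewrite /row_operator {1}(_ : f = fun z => \sum_(y <- s) f y * delta R y z).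
  rewrite cdot_suml//; last exact/ell2P/ell2_symbol_row.
  by apply: eq_bigr => y _; rewrite cdot_deltal.
apply/funext => z; have [zs|/[dup] zs /fs ->] := boolP (z \in s).
  rewrite (bigD1_seq z)//= /delta eqxx mulr1 big1 ?addr0// => y /negbTE yz.
  by rewrite eq_sym yz mulr0.
rewrite big_seq big1// => y ys; rewrite /delta.
by case: eqVneq => [zy|_]; rewrite ?mulr0//; rewrite zy ys in zs.
Qed.

End converging.

(** One section is a single term of the sum over the vertices, and as [rho] is finite, pairing with
    the constant 1 passes from square integrability to integrability. *)
Lemma sqint_symbol_section : inL2 (phase_measure nu) (phase_dom R X) conj_symbol ->
  forall x, cintegrable rho D (fun p => conj_symbol (x, p)).
Proof.
move=> [mb b2] x; have mbx := cmeasurable_section x mb.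
have {}b2 := lty_poweRy _ b2.
have s1 : sqint rho D (fun=> 1 : R[i]).
  by apply: (@sqint_finite _ _ _ rho D _ (normc (1 : R[i])) mD) => //; exact: cmeasurable_cst.
have sb : sqint rho D (fun p => conj_symbol (x, p)).
  apply/sqintP; split=> //; apply: le_lt_trans (b2 _); last by rewrite invr_eq0.
  rewrite integral_phase; last 2 first.
  - exact/measurable_EFinP/measurable_sqr_normc.
  - by move=> p; rewrite lee_fin sqr_ge0.
  have := @seq_le_esum R X (fun x => \int[rho]_(p in D) (normc (conj_symbol (x, p)) ^+ 2)%:E)%E [:: x].
  rewrite big_seq1; apply=> // z; apply: integral_ge0 => p _.
  by rewrite lee_fin sqr_ge0.
have := cdot_cintegrable mD sb s1.
rewrite (_ : (fun p => _ * _) = fun p => conj_symbol (x, p))//.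
by apply/funext => p; rewrite (conjc_realC (1 : R)) mulr1.
Qed.

(** Convergence is tested on the point mass at the root, whose transform is the constant 1. *)
Lemma cintegrable_symbol_section : pdo_converges nu sigma ->
  forall x, cintegrable rho D (fun p => conj_symbol (x, p)).
Proof.
move=> /(_ _ (finitely_supported_delta Defs.root)) H x.
have := cintegrableJ mD (H x).
rewrite (@pdo_integrand_seq _ [:: Defs.root])//; last first.
  by move=> y; rewrite inE /delta => /negbTE ->.
rewrite (_ : (fun p => _^*) = fun p => conj_symbol (x, p))//.
apply/funext => p; rewrite big_seq1 /delta eqxx mul1r conjcI bwave_root.
by rewrite (conjc_realC (1 : R)) mulr1.
Qed.

End pseudo_differential_kernel.

Theorem theorem3p1 (R : realType) (q : nat) (X : homogeneous_tree q)
    (nu : probability (boundary X) R) (Hnu : is_boundary_measure nu)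
    (sigma : X * (boundary X * measurableTypeR R) -> R[i])
    (Hsigma : cmeasurable (phase_dom R X) sigma) :
  let b : X * (boundary X * measurableTypeR R) -> R[i] := fun p =>
    (sigma p)^* * qpow q ((2^-1 +i* p.2.2) * (height R p.2.1 p.1)%:C) in
  (pdo_hilbert_schmidt nu sigma <->
     inL2 (phase_measure nu) (phase_dom R X) b) /\
  (pdo_hilbert_schmidt nu sigma ->
     forall S, pdo_extends_to nu sigma S -> hilbert_schmidt S ->
     forall (I : choiceType) (e : I -> X -> R[i]), orthonormal_basis e ->
       HSnorm e S = L2norm (phase_measure nu) (phase_dom R X) b).
Proof.
move=> b; rewrite (_ : b = conj_symbol sigma)// => {b}.
split; last first.
  move=> [conv _] S Sext [bS _] I e be.
  have cs := cintegrable_symbol_section conv.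
  exact (HSnorm_pdo Hnu Hsigma cs be bS Sext).
split=> [[conv [S Sext [bS [I [e [be fin]]]]]]|bL2].
  split; first exact: cmeasurable_conj_symbol.
  by rewrite -(HSnorm_pdo Hnu Hsigma (cintegrable_symbol_section conv) be bS Sext).
have cs := sqint_symbol_section bL2.
have b2 : (\int[phase_measure nu]_(p in phase_dom R X)
    (normc (conj_symbol sigma p) ^+ 2)%:E < +oo)%E.
  by apply: lty_poweRy bL2.2; rewrite invr_eq0.
have bS := bounded_row_operator Hnu Hsigma cs b2.
have Sext := row_operator_extends Hnu Hsigma cs b2.
split; first exact: pdo_converges_symbol.
(* [hilbert_schmidt] asks for one basis with a finite sum; by [HSnorm_pdo] every basis gives the
   same value, so point masses serve. *)
exists (row_operator nu sigma) => //; split=> //; exists X, (@delta R q X).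
split; first exact: delta_basis.
by rewrite (HSnorm_pdo Hnu Hsigma cs (@delta_basis R q X) bS Sext); exact: bL2.2.
Qed.
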